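(* Let $k$ be a field of arbitrary characteristic, let $S\subset\mathbb{P}^3_k$ be a smooth quartic surface, and let $Q\subset S$ be a geometrically irreducible conic. Then $Q$ meets at most $48$ lines contained in $S$.
   Context: Lines are straight lines of $\mathbb{P}^3$. A line $\ell\subset S$ meets $Q$ if $\ell\cap Q\neq\emptyset$. *)

(* Defs.v *)
From HB Require Import structures.
From mathcomp Require Import all_boot all_order all_algebra.
From mathcomp Require Export mpoly.

Set Implicit Arguments.
Unset Strict Implicit.
Unset Printing Implicit Defensive.

Import GRing.Theory.
Local Open Scope ring_scope.

(* Closed subschemes of P^3_k are given by homogeneous forms in 'X_0, ..., 'X_3,
   and their geometry is tested on base change along every field extension
   [phi : k -> K] (a morphism of fields is injective). A K-point of P^3 is given
   by a nonzero row vector [x : 'rV[K]_4], and [p.@[x 0]] is the value of the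
   form [p] at [x]. *)

(* Jacobian criterion. The equation [f = 0] is not redundant: in characteristic
   2 it does not follow from the vanishing of the partial derivatives. The
   condition excludes [f = 0], which is 4.-homog. *)
Definition smooth_quartic (k : fieldType) (f : {mpoly k[4]}) : Prop :=
  f \is 4.-homog /\
  forall (K : fieldType) (phi : {rmorphism k -> K}) (x : 'rV[K]_4),
    x != 0 -> (map_mpoly phi f).@[x 0] = 0 ->
    exists i : 'I_4, (mderiv i (map_mpoly phi f)).@[x 0] != 0.

Definition in_ideal (k : fieldType) (s : seq {mpoly k[4]}) (p : {mpoly k[4]}) :
    Prop :=
  exists a : 'I_(size s) -> {mpoly k[4]}, p = \sum_(i < size s) a i * s`_i.

Definition prime_ideal (k : fieldType) (s : seq {mpoly k[4]}) : Prop :=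
  ~ in_ideal s 1 /\
  forall p1 p2, in_ideal s (p1 * p2) -> in_ideal s p1 \/ in_ideal s p2.

(* The conic {h = q = 0} in the plane {h = 0}. *)
Definition conic (k : fieldType) (h q : {mpoly k[4]}) : Prop :=
  [/\ h \is 1.-homog, h != 0, q \is 2.-homog & ~ in_ideal [:: h] q].

(* As usual for conics, irreducibility excludes double lines. *)
Definition geometrically_irreducible (k : fieldType) (s : seq {mpoly k[4]}) :
    Prop :=
  forall (K : fieldType) (phi : {rmorphism k -> K}),
    prime_ideal [seq map_mpoly phi p | p <- s].

(* {h = q = 0} is a closed subscheme of {f = 0}; the ideal (h, q) of a conic is
   saturated. *)
Definition conic_in_surface (k : fieldType) (h q f : {mpoly k[4]}) : Prop :=
  in_ideal [:: h; q] f.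

(* A line of P^3_k is a plane of k^4. *)
Definition line (k : fieldType) (l : {vspace 'rV[k]_4}) : Prop := \dim l = 2%N.

Definition base_change (k K : fieldType) (phi : {rmorphism k -> K})
    (l : {vspace 'rV[k]_4}) : {vspace 'rV[K]_4} :=
  <<[seq map_mx phi v | v <- vbasis l]>>%VS.

(* The k-points of [l] alone would not suffice here when k has fewer than 4
   elements. *)
Definition line_in_surface (k : fieldType) (l : {vspace 'rV[k]_4})
    (f : {mpoly k[4]}) : Prop :=
  forall (K : fieldType) (phi : {rmorphism k -> K}) (x : 'rV[K]_4),
    x \in base_change phi l -> (map_mpoly phi f).@[x 0] = 0.

(* The intersection is nonempty as a scheme: its points need not be rational
   over k. *)
Definition line_meets_conic (k : fieldType) (l : {vspace 'rV[k]_4})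
    (h q : {mpoly k[4]}) : Prop :=
  exists (K : fieldType) (phi : {rmorphism k -> K}) (x : 'rV[K]_4),
    [/\ x != 0, x \in base_change phi l,
        (map_mpoly phi h).@[x 0] = 0 & (map_mpoly phi q).@[x 0] = 0].

(* Main.v *)
Require Import Defs.
From HB Require Import structures.
From mathcomp Require Import all_boot all_order all_algebra all_field ring zify.
From Stdlib Require Import Classical FunctionalExtensionality.

Set Implicit Arguments.
Unset Strict Implicit.
Unset Printing Implicit Defensive.

Import GRing.Theory.
Local Open Scope ring_scope.

(* Write [f = h c + q r]. Parametrize the conic by [P(t)] of degree 2, let
   [T = P'(t)], and let [n(t)] be a second tangent direction of the surface at
   [P(t)], of degree 4. Then [f (P + u (n + l T)) = u^2 f2 + u^3 f3 + u^4 f4],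
   where [fi] has degree [i] in [l] and its coefficient of [l^j] has weight
   12 - 4j, 14 - 4j, 16 - 4j in [t] for [i = 2, 3, 4]. The lines of the surface
   that meet the conic outside its plane are common zeros [(t, l)] of [f2, f3, f4].
   If the resultant of [f2] and [f3] is nonzero, it has degree at most 44; if
   [f2] divides [f3] up to a factor in [t], the resultant of [f2] and [f4] has
   degree at most 48; if [f2] and [f3] share a factor linear in [l], intersecting
   it with [f4] and the cofactor with [f3] gives at most 46 zeros. A factor common
   to all three would give a one-parameter family of lines on the surface, which
   is impossible because the normal bundle O(-2) of a line has no sections. The
   lines in the plane of the conic are components of [r = 0], so there are at most
   two, and if there is one the first bound drops to 46. *)

(** The slope of 4 per power of [l] is invisible in the frame [(n, T)], whose degrees 4 and 1 differ
    by 3. In homogeneous parameters [T] is one partial derivative of [P], the other is [2 P - t T],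
    and the frame [(t n, t T - 2 P)] has degrees 5 and 1. Both frames describe the same lines, so
    degrees are bounded in the second one and carried back by dividing by powers of [t]. The
    parametrization misses one point of the conic. Over an infinite extension where the conic has a
    point, the missing point is chosen off [r = 0] and off the lines that leave the plane. Then each
    of these lines is seen at a finite [t], and the leading coefficient [- r (P)] of [f2] has degree
    exactly 4. The drop to 46 is delicate only when [f2] divides [f3]. If [f2] has no content, its
    leading coefficient divides that of [f3], which is minus the derivative of [r (P)]. So this
    derivative is 0 and the characteristic is 2; a line of the surface in the plane then makes the
    leading coefficient of [f4] vanish, or is a double line of [r = 0], which smoothness forbids. *)

(** * Forms as tensors *)

Section Multilinear.

Variables (K : Type) (R : comNzRingType) (i : K -> R).
Implicit Types (x y z : 'rV[R]_4) (a : R).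

Definition lin (h : 'I_4 -> K) x : R := \sum_j i (h j) * x 0 j.
Definition bil (q : 'I_4 -> 'I_4 -> K) x y : R := \sum_j x 0 j * lin (q j) y.
Definition tri (c : 'I_4 -> 'I_4 -> 'I_4 -> K) x y z : R :=
  \sum_j x 0 j * bil (c j) y z.

Lemma linD h x y : lin h (x + y) = lin h x + lin h y.
Proof. by rewrite -big_split; apply: eq_bigr => j _; rewrite mxE mulrDr. Qed.

Lemma linZ h a x : lin h (a *: x) = a * lin h x.
Proof. by rewrite [RHS]mulr_sumr; apply: eq_bigr => j _; rewrite mxE mulrCA. Qed.

Lemma bilDl q x y z : bil q (x + y) z = bil q x z + bil q y z.
Proof. by rewrite -big_split; apply: eq_bigr => j _; rewrite mxE mulrDl. Qed.

Lemma bilDr q x y z : bil q x (y + z) = bil q x y + bil q x z.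
Proof. by rewrite -big_split; apply: eq_bigr => j _; rewrite linD mulrDr. Qed.

Lemma bilZl q a x y : bil q (a *: x) y = a * bil q x y.
Proof. by rewrite [RHS]mulr_sumr; apply: eq_bigr => j _; rewrite mxE -mulrA. Qed.

Lemma bilZr q a x y : bil q x (a *: y) = a * bil q x y.
Proof. by rewrite [RHS]mulr_sumr; apply: eq_bigr => j _; rewrite linZ mulrCA. Qed.

Lemma triD1 c x x' y z : tri c (x + x') y z = tri c x y z + tri c x' y z.
Proof. by rewrite -big_split; apply: eq_bigr => j _; rewrite mxE mulrDl. Qed.

Lemma triD2 c x y y' z : tri c x (y + y') z = tri c x y z + tri c x y' z.
Proof. by rewrite -big_split; apply: eq_bigr => j _; rewrite bilDl mulrDr. Qed.

Lemma triD3 c x y z z' : tri c x y (z + z') = tri c x y z + tri c x y z'.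
Proof. by rewrite -big_split; apply: eq_bigr => j _; rewrite bilDr mulrDr. Qed.

Lemma triZ1 c a x y z : tri c (a *: x) y z = a * tri c x y z.
Proof. by rewrite [RHS]mulr_sumr; apply: eq_bigr => j _; rewrite mxE -mulrA. Qed.

Lemma triZ2 c a x y z : tri c x (a *: y) z = a * tri c x y z.
Proof. by rewrite [RHS]mulr_sumr; apply: eq_bigr => j _; rewrite bilZl mulrCA. Qed.

Lemma triZ3 c a x y z : tri c x y (a *: z) = a * tri c x y z.
Proof. by rewrite [RHS]mulr_sumr; apply: eq_bigr => j _; rewrite bilZr mulrCA. Qed.

End Multilinear.

(* The tensors of [h], [q], [r], [c] in the equation [f = h c + q r] of the
   surface: [h = q = 0] is the conic, [h = r = 0] the residual conic. *)
Record forms (K : Type) := Forms {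
  th : 'I_4 -> K;
  tq : 'I_4 -> 'I_4 -> K;
  tr : 'I_4 -> 'I_4 -> K;
  tc : 'I_4 -> 'I_4 -> 'I_4 -> K }.

Section FormValues.

Variables (K : Type) (w : forms K) (R : comNzRingType) (i : K -> R).
Implicit Types (x y z : 'rV[R]_4) (a : R).

(** The tensors are not assumed symmetric: forms are evaluated on the diagonal, and [qp], [rp],
    [cp], [cq] are their polarizations, so no division by 2 or 3 occurs. The coefficient map [i] is
    a bare function, so that it can be composed freely with morphisms. *)
Definition hv x := lin i (th w) x.
Definition qv x := bil i (tq w) x x.
Definition qp x y := bil i (tq w) x y + bil i (tq w) y x.
Definition rv x := bil i (tr w) x x.
Definition rp x y := bil i (tr w) x y + bil i (tr w) y x.
Definition cv x := tri i (tc w) x x x.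
Definition cp x y :=
  tri i (tc w) x x y + tri i (tc w) x y x + tri i (tc w) y x x.
Definition cq x y z :=
  tri i (tc w) x y z + tri i (tc w) x z y + tri i (tc w) y x z +
  tri i (tc w) y z x + tri i (tc w) z x y + tri i (tc w) z y x.

Definition Fv x := hv x * cv x + qv x * rv x.
Definition dFv x y :=
  hv y * cv x + hv x * cp x y + qp x y * rv x + qv x * rp x y.

Lemma hvD x y : hv (x + y) = hv x + hv y. Proof. exact: linD. Qed.
Lemma hvZ a x : hv (a *: x) = a * hv x. Proof. exact: linZ. Qed.

Lemma qvD x y : qv (x + y) = qv x + qp x y + qv y.
Proof. by rewrite /qv /qp !(bilDl, bilDr); ring. Qed.
Lemma qvZ a x : qv (a *: x) = a ^+ 2 * qv x.
Proof. by rewrite /qv !(bilZl, bilZr); ring. Qed.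
Lemma qpDl x y z : qp (x + y) z = qp x z + qp y z.
Proof. by rewrite /qp !(bilDl, bilDr); ring. Qed.
Lemma qpDr x y z : qp x (y + z) = qp x y + qp x z.
Proof. by rewrite /qp !(bilDl, bilDr); ring. Qed.
Lemma qpZl a x y : qp (a *: x) y = a * qp x y.
Proof. by rewrite /qp !(bilZl, bilZr); ring. Qed.
Lemma qpZr a x y : qp x (a *: y) = a * qp x y.
Proof. by rewrite /qp !(bilZl, bilZr); ring. Qed.
Lemma qpC x y : qp x y = qp y x.
Proof. exact: addrC. Qed.
Lemma qpxx x : qp x x = 2 * qv x.
Proof. by rewrite /qp /qv; ring. Qed.

Lemma rvD x y : rv (x + y) = rv x + rp x y + rv y.
Proof. by rewrite /rv /rp !(bilDl, bilDr); ring. Qed.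
Lemma rvZ a x : rv (a *: x) = a ^+ 2 * rv x.
Proof. by rewrite /rv !(bilZl, bilZr); ring. Qed.
Lemma rpDl x y z : rp (x + y) z = rp x z + rp y z.
Proof. by rewrite /rp !(bilDl, bilDr); ring. Qed.
Lemma rpDr x y z : rp x (y + z) = rp x y + rp x z.
Proof. by rewrite /rp !(bilDl, bilDr); ring. Qed.
Lemma rpZl a x y : rp (a *: x) y = a * rp x y.
Proof. by rewrite /rp !(bilZl, bilZr); ring. Qed.
Lemma rpZr a x y : rp x (a *: y) = a * rp x y.
Proof. by rewrite /rp !(bilZl, bilZr); ring. Qed.
Lemma rpC x y : rp x y = rp y x.
Proof. exact: addrC. Qed.
Lemma rpxx x : rp x x = 2 * rv x.
Proof. by rewrite /rp /rv; ring. Qed.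

Lemma cvD x y : cv (x + y) = cv x + cp x y + cp y x + cv y.
Proof. by rewrite /cv /cp !(triD1, triD2, triD3); ring. Qed.
Lemma cvZ a x : cv (a *: x) = a ^+ 3 * cv x.
Proof. by rewrite /cv !(triZ1, triZ2, triZ3); ring. Qed.
Lemma cpDl x y z : cp (x + y) z = cp x z + cq x y z + cp y z.
Proof. by rewrite /cp /cq !(triD1, triD2, triD3); ring. Qed.
Lemma cpDr x y z : cp x (y + z) = cp x y + cp x z.
Proof. by rewrite /cp !(triD1, triD2, triD3); ring. Qed.
Lemma cpZl a x y : cp (a *: x) y = a ^+ 2 * cp x y.
Proof. by rewrite /cp !(triZ1, triZ2, triZ3); ring. Qed.
Lemma cpZr a x y : cp x (a *: y) = a * cp x y.
Proof. by rewrite /cp !(triZ1, triZ2, triZ3); ring. Qed.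
Lemma cpxx x : cp x x = 3 * cv x.
Proof. by rewrite /cp /cv; ring. Qed.
Lemma cqD2 x y y' z : cq x (y + y') z = cq x y z + cq x y' z.
Proof. by rewrite /cq !(triD1, triD2, triD3); ring. Qed.
Lemma cqD3 x y z z' : cq x y (z + z') = cq x y z + cq x y z'.
Proof. by rewrite /cq !(triD1, triD2, triD3); ring. Qed.
Lemma cqZ2 a x y z : cq x (a *: y) z = a * cq x y z.
Proof. by rewrite /cq !(triZ1, triZ2, triZ3); ring. Qed.
Lemma cqZ1 a x y z : cq (a *: x) y z = a * cq x y z.
Proof. by rewrite /cq !(triZ1, triZ2, triZ3); ring. Qed.
Lemma cqZ3 a x y z : cq x y (a *: z) = a * cq x y z.
Proof. by rewrite /cq !(triZ1, triZ2, triZ3); ring. Qed.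
Lemma cqC12 x y z : cq x y z = cq y x z.
Proof. by rewrite /cq; ring. Qed.
Lemma cqC23 x y z : cq x y z = cq x z y.
Proof. by rewrite /cq; ring. Qed.
Lemma cqxx1 x y : cq x x y = 2 * cp x y.
Proof. by rewrite /cq /cp; ring. Qed.
Lemma cqxx2 x y : cq x y y = 2 * cp y x.
Proof. by rewrite /cq /cp; ring. Qed.
Lemma cqxx3 x y : cq x y x = 2 * cp x y.
Proof. by rewrite /cq /cp; ring. Qed.

Lemma dFvD x y z : dFv x (y + z) = dFv x y + dFv x z.
Proof. by rewrite /dFv hvD cpDr qpDr rpDr; ring. Qed.
Lemma dFvZ a x y : dFv x (a *: y) = a * dFv x y.
Proof. by rewrite /dFv hvZ cpZr qpZr rpZr; ring. Qed.
Lemma dFvxx x : dFv x x = 4 * Fv x.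
Proof. by rewrite /dFv /Fv cpxx qpxx rpxx; ring. Qed.

Definition Fmid x y :=
  hv x * cp y x + hv y * cp x y + qv x * rv y + qp x y * rp x y + qv y * rv x.
Definition dFmid x y z :=
  hv z * cp x y + hv x * cq x y z + hv y * cp x z + qp x z * rp x y +
  qp y z * rv x + qv x * rp y z + qp x y * rp x z.

Lemma Fv_line x y u : Fv (x + u *: y) = Fv x + u * dFv x y +
  u ^+ 2 * Fmid x y + u ^+ 3 * dFv y x + u ^+ 4 * Fv y.
Proof.
rewrite /Fv hvD hvZ cvD cpZr cpZl cvZ qvD qpZr qvZ rvD rpZr rvZ /dFv /Fmid.
by rewrite (qpC y x) (rpC y x); ring.
Qed.

Lemma dFv_line x y z u : dFv (x + u *: y) z =
  dFv x z + u * dFmid x y z + u ^+ 2 * dFmid y x z + u ^+ 3 * dFv y z.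
Proof.
rewrite /dFv hvD hvZ cvD cpZr cpZl cvZ qvD qpZr qvZ rvD rpZr rvZ.
rewrite cpDl cpZl cqZ2 qpDl qpZl rpDl rpZl /dFmid.
by rewrite (qpC y x) (rpC y x) (cqC12 y x); ring.
Qed.

Lemma dFmid_same1 x y : dFmid x y y = 2 * Fmid x y.
Proof. by rewrite /dFmid /Fmid cqxx2 qpxx rpxx; ring. Qed.

Lemma dFmid_same2 x y : dFmid y x y = 3 * dFv y x.
Proof.
rewrite /dFmid /dFv cqxx3 cpxx qpxx rpxx (qpC y x) (rpC y x) (qpC x y) (rpC x y).
ring.
Qed.

End FormValues.

(** * Expansion of the quartic along the tangent directions at a point of the conic *)

Section Pencil.

Variables (K : Type) (w : forms K) (R : comNzRingType) (i : K -> R).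
Variables (P n T : 'rV[R]_4).

Local Notation hv := (hv w i).
Local Notation qv := (qv w i).
Local Notation qp := (qp w i).
Local Notation rv := (rv w i).
Local Notation rp := (rp w i).
Local Notation cv := (cv w i).
Local Notation cp := (cp w i).
Local Notation cq := (cq w i).

(* [tanij] is the coefficient of [u^i l^j] in [f (P + u (n + l T))]. *)
Definition tan20 := hv n * cp P n + qp P n * rp P n + qv n * rv P.
Definition tan21 := hv n * cp P T + qp P n * rp P T + qp n T * rv P.
Definition tan22 := qv T * rv P.
Definition tan30 := hv n * cp n P + qp P n * rv n + qv n * rp P n.
Definition tan31 :=
  hv n * cq n T P + qp P n * rp n T + qv n * rp P T + qp n T * rp P n.
Definition tan32 :=
  hv n * cp T P + qp P n * rv T + qp n T * rp P T + qv T * rp P n.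
Definition tan33 := qv T * rp P T.
Definition tan40 := hv n * cv n + qv n * rv n.
Definition tan41 := hv n * cp n T + qv n * rp n T + qp n T * rv n.
Definition tan42 := hv n * cp T n + qv n * rv T + qp n T * rp n T + qv T * rv n.
Definition tan43 := hv n * cv T + qp n T * rv T + qv T * rp n T.
Definition tan44 := qv T * rv T.

Definition tan2 l := tan20 + tan21 * l + tan22 * l ^+ 2.
Definition tan3 l := tan30 + tan31 * l + tan32 * l ^+ 2 + tan33 * l ^+ 3.
Definition tan4 l :=
  tan40 + tan41 * l + tan42 * l ^+ 2 + tan43 * l ^+ 3 + tan44 * l ^+ 4.

Hypothesis hP : hv P = 0.
Hypothesis hT : hv T = 0.
Hypothesis qP : qv P = 0.
Hypothesis qPT : qp P T = 0.
Hypothesis tangent : hv n * cv P + qp P n * rv P = 0.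

Lemma Fv_pencil u l :
  Fv w i (P + u *: (n + l *: T)) =
  u ^+ 2 * tan2 l + u ^+ 3 * tan3 l + u ^+ 4 * tan4 l.
Proof.
rewrite /Fv hvD hvZ hvD hvZ hP hT qvD qpZr qpDr qpZr qvZ qvD qpZr qvZ qP qPT.
rewrite cvD cpZr cpZl cpDr cpDl cpZr cpZl cqZ2 cvZ cvD cpZr cpZl cvZ.
rewrite rvD rpZr rpDr rpZr rvZ rvD rpZr rvZ.
rewrite -[RHS]addr0 -(mulr0 u) -[X in _ = _ + u * X]tangent.
rewrite /tan2 /tan3 /tan4 /tan20 /tan21 /tan22 /tan30 /tan31 /tan32 /tan33.
by rewrite /tan40 /tan41 /tan42 /tan43 /tan44; ring.
Qed.

End Pencil.

(** * Change of frame between the two affine charts of the conic *)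

Section Twist.

Variables (K : Type) (w : forms K) (R : comNzRingType) (i : K -> R).
Variables (P n T : 'rV[R]_4) (t : R).
Hypothesis qP : qv w i P = 0.
Hypothesis qPT : qp w i P T = 0.
Hypothesis tangent : hv w i n * cv w i P + qp w i P n * rv w i P = 0.

(* For [P = e0 + t e1 + t^2 e2] and [T = e1 + 2 t e2] the quadratic terms of
   [t T] and [2 P] cancel: [T' = - 2 e0 - t e1]. *)
Let n' := t *: n.
Let T' := t *: T + (- 2) *: P.

Ltac expand :=
  rewrite /tan20 /tan21 /tan22 /tan30 /tan31 /tan32 /tan33 /tan40 /tan41 /tan42
    /tan43 /tan44 /n' /T'
    !(hvD, hvZ, qvD, qvZ, qpDl, qpDr, qpZl, qpZr, qpxx, rvD, rvZ, rpDl, rpDr,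
      rpZl, rpZr, rpxx, cvD, cvZ, cpDl, cpDr, cpZl, cpZr, cpxx, cqD2, cqD3,
      cqZ1, cqZ2, cqZ3, cqxx1, cqxx2, cqxx3)
    ?[cq w i T P n]cqC12 ?[cq w i P T n]cqC23 ?[cq w i P n T]cqC12
    ?[cq w i n P T]cqC23 ?[cq w i T n P]cqC12
    ?[qp w i T P]qpC ?[qp w i n P]qpC ?[rp w i T P]rpC ?[rp w i n P]rpC
    ?[rp w i T n]rpC ?[qp w i T n]qpC ?qP ?qPT.

(** Since [n' + l T' = t (n + l T) - 2 l P], homogeneity turns [f (P + u (n' + l T'))] into [(1 - 2
    l u)^2 t^2 u^2 f2 + (1 - 2 l u) t^3 u^3 f3 + t^4 u^4 f4]. The identities of this section compare
    the coefficients of [u^i l^j]. *)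
Lemma twist20 : tan20 w i P n' = t ^+ 2 * tan20 w i P n.
Proof. by expand; ring. Qed.

Lemma twist21 : tan21 w i P n' T' = t ^+ 2 * tan21 w i P n T.
(* The component [- 2 P] of [T'] contributes [- 6] through [cp P P], and [- 4 - 2] through [rp P P]
   and [qp n P]: together [- 6 t] times the left-hand side of [tangent]. *)
Proof. by rewrite -[RHS]addr0 -(mulr0 (-6 * t)) -[X in _ = _ + _ * X]tangent; expand; ring. Qed.

Lemma twist30 : tan30 w i P n' = t ^+ 3 * tan30 w i P n.
Proof. by expand; ring. Qed.

Lemma twist31 : tan31 w i P n' T' =
  t ^+ 3 * tan31 w i P n T - 4 * t ^+ 2 * tan20 w i P n.
Proof. by expand; ring. Qed.

Lemma twist32 : tan32 w i P n' T' =
  t ^+ 3 * tan32 w i P n T - 4 * t ^+ 2 * tan21 w i P n T.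
Proof. by rewrite -[RHS]addr0 -(mulr0 (12 * t)) -[X in _ = _ + _ * X]tangent; expand; ring. Qed.

Lemma twist33 : tan33 w i P T' =
  t ^+ 3 * tan33 w i P T - 4 * t ^+ 2 * tan22 w i P T.
Proof. by expand; ring. Qed.

Lemma twist40 : tan40 w i n' = t ^+ 4 * tan40 w i n.
Proof. by expand; ring. Qed.

Lemma twist41 : tan41 w i n' T' =
  t ^+ 4 * tan41 w i n T - 2 * t ^+ 3 * tan30 w i P n.
Proof. by expand; ring. Qed.

Lemma twist42 : tan42 w i n' T' =
  t ^+ 4 * tan42 w i n T - 2 * t ^+ 3 * tan31 w i P n T
  + 4 * t ^+ 2 * tan20 w i P n.
Proof. by expand; ring. Qed.

Lemma twist43 : tan43 w i n' T' =
  t ^+ 4 * tan43 w i n T - 2 * t ^+ 3 * tan32 w i P n T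
  + 4 * t ^+ 2 * tan21 w i P n T.
Proof. by rewrite -[RHS]addr0 -(mulr0 (-8 * t)) -[X in _ = _ + _ * X]tangent; expand; ring. Qed.

Lemma twist44 : tan44 w i T' =
  t ^+ 4 * tan44 w i T - 2 * t ^+ 3 * tan33 w i P T
  + 4 * t ^+ 2 * tan22 w i P T.
Proof. by expand; ring. Qed.

End Twist.

Section Naturality.

Variables (K : Type) (w : forms K) (R S : comNzRingType) (i : K -> R).
Variable f : {rmorphism R -> S}.
Implicit Types (x y z : 'rV[R]_4).

Lemma lin_map h x : f (lin i h x) = lin (f \o i) h (map_mx f x).
Proof.
by rewrite rmorph_sum; apply: eq_bigr => j _; rewrite rmorphM mxE.
Qed.

Lemma bil_map q x y : f (bil i q x y) = bil (f \o i) q (map_mx f x) (map_mx f y).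
Proof.
by rewrite rmorph_sum; apply: eq_bigr => j _; rewrite rmorphM mxE lin_map.
Qed.

Lemma tri_map c x y z :
  f (tri i c x y z) = tri (f \o i) c (map_mx f x) (map_mx f y) (map_mx f z).
Proof.
by rewrite rmorph_sum; apply: eq_bigr => j _; rewrite rmorphM mxE bil_map.
Qed.

Lemma hv_map x : f (hv w i x) = hv w (f \o i) (map_mx f x).
Proof. exact: lin_map. Qed.
Lemma qv_map x : f (qv w i x) = qv w (f \o i) (map_mx f x).
Proof. exact: bil_map. Qed.
Lemma rv_map x : f (rv w i x) = rv w (f \o i) (map_mx f x).
Proof. exact: bil_map. Qed.
Lemma cv_map x : f (cv w i x) = cv w (f \o i) (map_mx f x).
Proof. exact: tri_map. Qed.
Lemma qp_map x y : f (qp w i x y) = qp w (f \o i) (map_mx f x) (map_mx f y).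
Proof. by rewrite rmorphD !bil_map. Qed.
Lemma rp_map x y : f (rp w i x y) = rp w (f \o i) (map_mx f x) (map_mx f y).
Proof. by rewrite rmorphD !bil_map. Qed.
Lemma cp_map x y : f (cp w i x y) = cp w (f \o i) (map_mx f x) (map_mx f y).
Proof. by rewrite !rmorphD !tri_map. Qed.
Lemma cq_map x y z :
  f (cq w i x y z) = cq w (f \o i) (map_mx f x) (map_mx f y) (map_mx f z).
Proof. by rewrite !rmorphD !tri_map. Qed.

Definition atoms_map :=
  (hv_map, qv_map, rv_map, cv_map, qp_map, rp_map, cp_map, cq_map).

Lemma Fv_map x : f (Fv w i x) = Fv w (f \o i) (map_mx f x).
Proof. by rewrite /Fv -!atoms_map !(rmorphD, rmorphM). Qed.
Lemma dFv_map x y : f (dFv w i x y) = dFv w (f \o i) (map_mx f x) (map_mx f y).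
Proof. by rewrite /dFv -!atoms_map !(rmorphD, rmorphM). Qed.

Lemma dFmid_map x y z : f (dFmid w i x y z) =
  dFmid w (f \o i) (map_mx f x) (map_mx f y) (map_mx f z).
Proof. by rewrite /dFmid -!atoms_map !(rmorphD, rmorphM). Qed.
Lemma Fmid_map x y :
  f (Fmid w i x y) = Fmid w (f \o i) (map_mx f x) (map_mx f y).
Proof. by rewrite /Fmid -!atoms_map !(rmorphD, rmorphM). Qed.

Lemma tan2_map P n T l : f (tan20 w i P n) + f (tan21 w i P n T) * l +
    f (tan22 w i P T) * l ^+ 2 =
  tan2 w (f \o i) (map_mx f P) (map_mx f n) (map_mx f T) l.
Proof.
rewrite /tan2 /tan20 /tan21 /tan22 -!atoms_map.
by rewrite !(rmorphD, rmorphM, rmorphXn).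
Qed.

Lemma tan3_map P n T l : f (tan30 w i P n) + f (tan31 w i P n T) * l +
    f (tan32 w i P n T) * l ^+ 2 + f (tan33 w i P T) * l ^+ 3 =
  tan3 w (f \o i) (map_mx f P) (map_mx f n) (map_mx f T) l.
Proof.
rewrite /tan3 /tan30 /tan31 /tan32 /tan33 -!atoms_map.
by rewrite !(rmorphD, rmorphM, rmorphXn).
Qed.

Lemma tan4_map n T l : f (tan40 w i n) + f (tan41 w i n T) * l +
    f (tan42 w i n T) * l ^+ 2 + f (tan43 w i n T) * l ^+ 3 +
    f (tan44 w i T) * l ^+ 4 =
  tan4 w (f \o i) (map_mx f n) (map_mx f T) l.
Proof.
rewrite /tan4 /tan40 /tan41 /tan42 /tan43 /tan44 -!atoms_map.
by rewrite !(rmorphD, rmorphM, rmorphXn).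
Qed.

End Naturality.

(** * Degrees, resultants and common zeros *)

Section Degree.

Variable K : fieldType.
Implicit Types p q : {poly K}.

Definition dle p d := (size p <= d.+1)%N.

Lemma dleW p d e : dle p d -> (d <= e)%N -> dle p e.
Proof. by rewrite /dle => h le; apply: leq_trans h _. Qed.

Lemma dle0 d : dle 0 d. Proof. by rewrite /dle size_poly0. Qed.

Lemma dleC c : dle c%:P 0. Proof. by rewrite /dle size_polyC; case: (c != 0). Qed.

Lemma dle1 : dle 1 0. Proof. exact: dleC. Qed.

Lemma dle_nat n : dle n%:R 0. Proof. by rewrite -polyC_natr; apply: dleC. Qed.

Lemma dleX n : dle 'X^n n. Proof. by rewrite /dle size_polyXn. Qed.

Lemma dleX1 : dle 'X 1. Proof. by rewrite /dle size_polyX. Qed.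

Lemma dleD p q d : dle p d -> dle q d -> dle (p + q) d.
Proof.
by rewrite /dle => hp hq; rewrite (leq_trans (size_polyD _ _)) // geq_max hp.
Qed.

Lemma dleN p d : dle p d -> dle (- p) d.
Proof. by rewrite /dle size_polyN. Qed.

Lemma dleM p q d e : dle p d -> dle q e -> dle (p * q) (d + e).
Proof.
rewrite /dle => hp hq; apply: leq_trans (size_polyMleq _ _) _.
by rewrite -ltnS; move: hp hq; lia.
Qed.

Lemma dle_exp p d n : dle p d -> dle (p ^+ n) (d * n).
Proof.
move=> hp; elim: n => [|n IH]; first by rewrite expr0 muln0 dle1.
by rewrite exprS mulnS; apply: dleM.
Qed.

Lemma dle_sum (I : Type) (r : seq I) (P : pred I) (F : I -> {poly K}) d :
  (forall i, P i -> dle (F i) d) -> dle (\sum_(i <- r | P i) F i) d.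
Proof.
by move=> h; elim/big_rec: _ => [|i p Pi]; [exact: dle0|apply/dleD/h].
Qed.

Lemma dle_mulX p d n : dle ('X^n * p) (n + d) -> dle p d.
Proof.
have [-> _|nz] := eqVneq p 0; first exact: dle0.
rewrite /dle size_monicM ?monicXn // size_polyXn; lia.
Qed.

Lemma dle_pred p d : dle p d -> ((size p).-1 <= d)%N.
Proof. rewrite /dle; lia. Qed.

End Degree.

Ltac dle_term :=
  match goal with
  | H : is_true (dle ?p _) |- is_true (dle ?p _) => exact H
  | |- is_true (dle (_ * _) _) => eapply dleM; dle_term
  | |- is_true (dle (- _) _) => eapply dleN; dle_term
  | |- is_true (dle ('X ^+ _) _) => exact: dleX
  | |- is_true (dle (_ ^+ _) _) => eapply dle_exp; dle_term
  | |- is_true (dle 'X _) => exact: dleX1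
  | |- is_true (dle 1 _) => exact: dle1
  | |- is_true (dle _%:R _) => exact: dle_nat
  end.

Ltac dle_tac :=
  match goal with
  | H : is_true (dle ?p _) |- is_true (dle ?p _) =>
      apply: dleW; [exact H | clear; lia]
  | |- is_true (dle (_ + _) _) => apply: dleD; dle_tac
  | |- is_true (dle (- (_ + _)) _) => apply: dleN; dle_tac
  | |- _ => eapply dleW; [dle_term | clear; lia]
  end.

(** * The resultant of a quadratic and a quartic, by explicit formulas *)

Section Resultant.

Variable R : comNzRingType.
Implicit Types a b c g k z : R.

(* The resultant [a^4 g(l) g(l')] of [a x^2 + b x + c], with roots [l], [l'],
   and the quartic [g]. *)
Definition res24 a b c g0 g1 g2 g3 g4 : R :=
  let s1 := - b in
  let s2 := b ^+ 2 - 2 * a * c in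
  let s3 := - b ^+ 3 + 3 * a * b * c in
  let s4 := b ^+ 4 - 4 * a * b ^+ 2 * c + 2 * a ^+ 2 * c ^+ 2 in
  g0 ^+ 2 * a ^+ 4 + g1 ^+ 2 * a ^+ 3 * c + g2 ^+ 2 * a ^+ 2 * c ^+ 2 +
  g3 ^+ 2 * a * c ^+ 3 + g4 ^+ 2 * c ^+ 4 +
  g0 * g1 * a ^+ 3 * s1 + g0 * g2 * a ^+ 2 * s2 + g0 * g3 * a * s3 +
  g0 * g4 * s4 + g1 * g2 * a ^+ 2 * c * s1 + g1 * g3 * a * c * s2 +
  g1 * g4 * c * s3 + g2 * g3 * a * c ^+ 2 * s1 + g2 * g4 * c ^+ 2 * s2 +
  g3 * g4 * c ^+ 3 * s1.

Definition res23 a b c g0 g1 g2 g3 : R :=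
  let s1 := - b in
  let s2 := b ^+ 2 - 2 * a * c in
  let s3 := - b ^+ 3 + 3 * a * b * c in
  g0 ^+ 2 * a ^+ 3 + g1 ^+ 2 * a ^+ 2 * c + g2 ^+ 2 * a * c ^+ 2 +
  g3 ^+ 2 * c ^+ 3 +
  g0 * g1 * a ^+ 2 * s1 + g0 * g2 * a * s2 + g0 * g3 * s3 +
  g1 * g2 * a * c * s1 + g1 * g3 * c * s2 + g2 * g3 * c ^+ 2 * s1.

Definition rem1 a b c g1 g2 g3 g4 : R :=
  a ^+ 3 * g1 - a ^+ 2 * b * g2 + a * g3 * (b ^+ 2 - a * c) +
  g4 * (- b ^+ 3 + 2 * a * b * c).
Definition rem0 a b c g0 g2 g3 g4 : R :=
  a ^+ 3 * g0 - a ^+ 2 * c * g2 + a * b * c * g3 + g4 * (a * c ^+ 2 - c * b ^+ 2).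
Definition quo2 a g4 : R := a ^+ 2 * g4.
Definition quo1 a b g3 g4 : R := a ^+ 2 * g3 - a * b * g4.
Definition quo0 a b c g2 g3 g4 : R :=
  a ^+ 2 * g2 - a * b * g3 + b ^+ 2 * g4 - a * c * g4.

(** Pseudo-division of the quartic by the quadratic; its three steps cost [a ^+ 3]. *)
Lemma divE a b c g0 g1 g2 g3 g4 x :
  a ^+ 3 * (g0 + g1 * x + g2 * x ^+ 2 + g3 * x ^+ 3 + g4 * x ^+ 4) =
  (c + b * x + a * x ^+ 2) *
    (quo0 a b c g2 g3 g4 + quo1 a b g3 g4 * x + quo2 a g4 * x ^+ 2) +
  (rem0 a b c g0 g2 g3 g4 + rem1 a b c g1 g2 g3 g4 * x).
Proof. by rewrite /quo0 /quo1 /quo2 /rem0 /rem1; ring. Qed.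

(** At the roots [l], [l'] of the quadratic [a ^+ 3 * g] takes the values [q + p l] and [q + p l'].
    Their product times [a] is the right-hand side, as [a (l + l') = - b] and [a l l' = c]. *)
Lemma res24_rem a b c g0 g1 g2 g3 g4 :
  let p := rem1 a b c g1 g2 g3 g4 in
  let q := rem0 a b c g0 g2 g3 g4 in
  a ^+ 3 * res24 a b c g0 g1 g2 g3 g4 = a * q ^+ 2 - b * p * q + c * p ^+ 2.
Proof. by rewrite /res24 /rem0 /rem1; ring. Qed.

Lemma res24_0 a b c g0 g1 g2 g3 :
  res24 a b c g0 g1 g2 g3 0 = a * res23 a b c g0 g1 g2 g3.
Proof. by rewrite /res24 /res23; ring. Qed.

(** Adding a multiple of the quadratic to the quartic does not change its values at the two
    roots. *)
Lemma res24_mod a b c g0 g1 g2 g3 g4 z0 z1 z2 :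
  res24 a b c (g0 + z0 * c) (g1 + z0 * b + z1 * c) (g2 + z0 * a + z1 * b + z2 * c)
    (g3 + z1 * a + z2 * b) (g4 + z2 * a) = res24 a b c g0 g1 g2 g3 g4.
Proof. by rewrite /res24; ring. Qed.

Lemma res24Zg a b c g0 g1 g2 g3 g4 k :
  res24 a b c (k * g0) (k * g1) (k * g2) (k * g3) (k * g4) =
  k ^+ 2 * res24 a b c g0 g1 g2 g3 g4.
Proof. by rewrite /res24; ring. Qed.

Lemma res24Z a b c g0 g1 g2 g3 g4 k :
  res24 (k * a) (k * b) (k * c) g0 g1 g2 g3 g4 =
  k ^+ 4 * res24 a b c g0 g1 g2 g3 g4.
Proof. by rewrite /res24; ring. Qed.

End Resultant.

Section Count.

Variable K : fieldType.
Implicit Types p q a b c g : {poly K}.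

(** The resultant has degree 4 in [a, b, c], degree 2 in the [gi], and is isobaric of weight 8; each
    unit of weight costs 4 in the degree, whence 32. *)
Lemma dle_res24 a b c g0 g1 g2 g3 g4 d e :
  dle a d -> dle b (d + 4) -> dle c (d + 8) ->
  dle g4 e -> dle g3 (e + 4) -> dle g2 (e + 8) -> dle g1 (e + 12) ->
  dle g0 (e + 16) ->
  dle (res24 a b c g0 g1 g2 g3 g4) (2 * e + 4 * d + 32).
Proof.
move=> ha hb hc h4 h3 h2 h1 h0.
have hs1 : dle (- b) (d + 4) by exact: dleN.
have hs2 : dle (b ^+ 2 - 2 * a * c) (2 * d + 8) by dle_tac.
have hs3 : dle (- b ^+ 3 + 3 * a * b * c) (3 * d + 12) by dle_tac.
have hs4 : dle (b ^+ 4 - 4 * a * b ^+ 2 * c + 2 * a ^+ 2 * c ^+ 2) (4 * d + 16).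
  by dle_tac.
by rewrite /res24; dle_tac.
Qed.

Lemma dvdp_factor_cancel p t u n :
  t != u -> ('X - t%:P) ^+ n %| ('X - u%:P) * p -> ('X - t%:P) ^+ n %| p.
Proof.
move=> tu; rewrite Gauss_dvdpr // coprimep_expl // coprimep_XsubC.
by rewrite root_XsubC eq_sym.
Qed.

(** Roots are counted with multiplicity because two lines may pass through the same point of the
    conic. *)
Lemma size_multiroots p (ts : seq K) : p != 0 ->
  (forall t, ('X - t%:P) ^+ count_mem t ts %| p) -> (size ts < size p)%N.
Proof.
elim: ts p => [|t ts IH] p nz h /=; first by rewrite size_poly_gt0.
have /dvdpP [p1 pE] : ('X - t%:P) %| p.
  by apply: dvdp_trans (h t); rewrite /= eqxx exprS dvdp_mulr.
rewrite pE mulf_eq0 negb_or in nz; case/andP: nz => nz1 nz2.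
rewrite pE size_Mmonic ?monicXsubC // size_XsubC addn2 /= ltnS.
apply: IH => // u; move: (h u) => /=; rewrite pE mulrC.
have [<-|ne] /= := eqVneq t u; last by apply: dvdp_factor_cancel; rewrite eq_sym.
by rewrite exprS dvdp_mul2l // polyXsubC_eq0.
Qed.

(** Over a given [t] there are at most two points, since [a.[t] != 0]. One point makes the resultant
    vanish at [t]. Two points annihilate the linear remainder [q + p l] at [t], so [p] and [q]
    vanish there and [a q^2 - b p q + c p^2] has a double root. The factors [a ^+ 3] and [k] are
    prime to ['X - t]. *)
Lemma count_quadratic a b c g0 g1 g2 g3 g4 k r (s : seq (K * K)) :
  uniq s ->
  (forall x, x \in s -> [/\ a.[x.1] != 0, k.[x.1] != 0,
     c.[x.1] + b.[x.1] * x.2 + a.[x.1] * x.2 ^+ 2 = 0 &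
     g0.[x.1] + g1.[x.1] * x.2 + g2.[x.1] * x.2 ^+ 2 + g3.[x.1] * x.2 ^+ 3
       + g4.[x.1] * x.2 ^+ 4 = 0]) ->
  res24 a b c g0 g1 g2 g3 g4 = k * r -> r != 0 ->
  (size s <= (size r).-1)%N.
Proof.
move=> us hs rE nz.
rewrite -ltnS prednK ?size_poly_gt0 // -(size_map fst); apply: size_multiroots => // t.
have -> : count_mem t [seq x.1 | x <- s] = size [seq x <- s | x.1 == t].
  by rewrite count_map size_filter.
have := filter_uniq (fun x : K * K => x.1 == t) us.
have : forall x, x \in [seq x <- s | x.1 == t] -> [/\ x.1 = t, a.[t] != 0,
    k.[t] != 0, c.[t] + b.[t] * x.2 + a.[t] * x.2 ^+ 2 = 0 &
    (rem0 a b c g0 g2 g3 g4).[t] + (rem1 a b c g1 g2 g3 g4).[t] * x.2 = 0].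
  move=> x; rewrite mem_filter => /andP [/eqP xt xs].
  have [] := hs x xs; rewrite xt => h1 h2 h3 h4; split => //.
  have := divE a.[t] b.[t] c.[t] g0.[t] g1.[t] g2.[t] g3.[t] g4.[t] x.2.
  rewrite h3 h4 mulr0 mul0r add0r => ->.
  by rewrite /rem0 /rem1 !hornerE.
set q := rem0 _ _ _ _ _ _ _; set p := rem1 _ _ _ _ _ _ _.
have kE : (a ^+ 3 * k) * r = a * q ^+ 2 - b * p * q + c * p ^+ 2.
  by rewrite -mulrA -rE res24_rem.
clearbody p q; have divr n : a.[t] != 0 -> k.[t] != 0 ->
    ('X - t%:P) ^+ n %| a * q ^+ 2 - b * p * q + c * p ^+ 2 ->
    ('X - t%:P) ^+ n %| r.
  move=> at0 kt0; rewrite -kE Gauss_dvdpr // coprimep_expl // coprimep_sym.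
  rewrite coprimep_XsubC.
  by rewrite rootM negb_or !rootE horner_exp expf_neq0.
case: [seq x <- s | x.1 == t] => [|x [|y [|z l]]] h u; first exact: dvd1p.
- have [_ at0 kt0 f0 g0'] := h _ (mem_head _ _).
  apply: divr => //; rewrite expr1 dvdp_XsubCl rootE.
  rewrite !(hornerD, hornerN, hornerM, horner_exp).
  apply/eqP/(mulfI at0); rewrite mulr0.
  have -> : q.[t] = - (p.[t] * x.2) by apply/eqP; rewrite -addr_eq0 g0'.
  rewrite -(mulr0 (a.[t] * p.[t] ^+ 2)) -f0; ring.
- have [_ at0 kt0 f0 g0'] := h _ (mem_head _ _).
  have [|_ _ _ f1 g1'] := h y; first by rewrite !inE eqxx orbT.
  move: u; rewrite /= inE andbT => xy.
  have xy2 : x.2 - y.2 != 0.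
    rewrite subr_eq0; apply: contraNneq xy => e2.
    have [e1 _ _ _ _] := h _ (mem_head _ _).
    have [|e1' _ _ _ _] := h y; first by rewrite !inE eqxx orbT.
    by case: x y e1 e1' e2 {h f0 g0' f1 g1'} => [? ?] [? ?] /= -> -> ->.
  have p0 : p.[t] = 0.
    apply/(mulIf xy2); rewrite mul0r mulrBr.
    by rewrite -[RHS](subrr 0) -{1}g0' -g1'; ring.
  have q0 : q.[t] = 0 by move: g0'; rewrite p0 mul0r addr0.
  apply: divr => //=.
  have /dvdpP [p1 ->] : ('X - t%:P) %| p by rewrite dvdp_XsubCl rootE p0.
  have /dvdpP [q1 ->] : ('X - t%:P) %| q by rewrite dvdp_XsubCl rootE q0.
  apply/dvdpP.
  by exists (a * q1 ^+ 2 - b * p1 * q1 + c * p1 ^+ 2); ring.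
- exfalso.
  have [ex at0 _ fx _] := h x (mem_head _ _).
  have [|ey _ _ fy _] := h y; first by rewrite !inE eqxx orbT.
  have [|ez _ _ fz _] := h z; first by rewrite !inE eqxx !orbT.
  have neq (v w : K * K) : v.1 = t -> w.1 = t -> v != w -> v.2 != w.2.
    by case: v w => [v1 v2] [w1 w2] /= -> ->; rewrite xpair_eqE eqxx.
  move: u; rewrite /= !inE !negb_or => /andP [/and3P [xy xz _] /andP [/andP [yz _] _]].
  have root3 v w : v != w -> c.[t] + b.[t] * v + a.[t] * v ^+ 2 = 0 ->
      c.[t] + b.[t] * w + a.[t] * w ^+ 2 = 0 -> b.[t] + a.[t] * (v + w) = 0.
    move=> vw hv hw; have vw' : v - w != 0 by rewrite subr_eq0.
    apply/(mulIf vw'); rewrite mul0r -[RHS](subrr 0) -{1}hv -hw; ring.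
  have h1 := root3 _ _ (neq _ _ ex ey xy) fx fy.
  have h2 := root3 _ _ (neq _ _ ex ez xz) fx fz.
  have : a.[t] * (y.2 - z.2) = 0.
    by rewrite -[RHS](subrr 0) -{1}h1 -h2; ring.
  by move/eqP; rewrite mulf_eq0 (negbTE at0) subr_eq0 (negbTE (neq _ _ ey ez yz)).
Qed.

Lemma count_linear a b e (s : seq (K * K)) :
  uniq s ->
  (forall x, x \in s ->
     [/\ a.[x.1] != 0, b.[x.1] + a.[x.1] * x.2 = 0 & e.[x.1] = 0]) ->
  e != 0 -> (size s <= (size e).-1)%N.
Proof.
move=> us hs nz.
rewrite -ltnS prednK ?size_poly_gt0 // -(size_map fst).
apply: max_poly_roots => //.
  by apply/allP => t /mapP [x xs ->]; have [_ _ ] := hs _ xs; move/eqP.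
rewrite map_inj_in_uniq // => x y xs ys.
have [ax bx _] := hs _ xs; have [ay by_ _] := hs _ ys.
case: x y ax bx ay by_ {xs ys} => [t x] [u y] /= ax bx ay by_ tu.
move: bx by_; rewrite -tu => bx by_; congr pair; apply: (mulfI ax).
by apply: (addrI b.[t]); rewrite bx by_.
Qed.

End Count.

Ltac size_lia :=
  clear; repeat match goal with
  | |- context [size (polyseq ?p)] => move: (size (polyseq p)) => ?
  end; lia.

Section Factor.

Variable K : fieldType.
Implicit Types a b c p q : {poly K}.

(* [- q / p] is a root of [a x^2 + b x + c]; Gauss's lemma. *)
Lemma quadratic_factor a b c p q :
  p != 0 -> a * q ^+ 2 - b * p * q + c * p ^+ 2 = 0 ->
  exists a1 b1 a2 b2, [/\ a1 != 0, p * b1 = q * a1, a = a1 * a2,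
    b = a2 * b1 + a1 * b2 & c = b1 * b2].
Proof.
move=> nz eq0; set g := gcdp p q.
have gnz : g != 0 by rewrite gcdp_eq0 negb_and nz.
set a1 := p %/ g; set b1 := q %/ g.
have pE : p = a1 * g by rewrite /a1 divpK // dvdp_gcdl.
have qE : q = b1 * g by rewrite /b1 divpK // dvdp_gcdr.
have cop : coprimep a1 b1 by apply: coprimep_div_gcd; rewrite nz.
clearbody a1 b1; clearbody g.
have a1nz : a1 != 0 by apply: contraNneq nz => a0; rewrite pE a0 mul0r.
have eq1 : a * b1 ^+ 2 - b * a1 * b1 + c * a1 ^+ 2 = 0.
  apply: (mulIf (expf_neq0 2 gnz)); rewrite mul0r -[RHS]eq0 pE qE; ring.
have /Pdiv.Field.dvdpP [a2 aE] : a1 %| a.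
  rewrite -(Gauss_dvdpl _ (coprimep_expr 2 cop)); apply/Pdiv.Field.dvdpP.
  exists (b * b1 - c * a1); apply/eqP; rewrite -subr_eq0 -[X in _ == X]eq1.
  by apply/eqP; ring.
have eq2 : a2 * b1 ^+ 2 - b * b1 + c * a1 = 0.
  by apply: (mulIf a1nz); rewrite mul0r -[RHS]eq1 aE; ring.
have cE0 : c * a1 = b1 * (b - a2 * b1).
  by apply/eqP; rewrite -subr_eq0 -[X in _ == X]eq2; apply/eqP; ring.
have /Pdiv.Field.dvdpP [b2 bE] : a1 %| b - a2 * b1.
  rewrite -(Gauss_dvdpr _ cop); apply/Pdiv.Field.dvdpP.
  by exists c; rewrite cE0.
exists a1, b1, a2, b2; split => //.
- by rewrite pE qE; ring.
- by rewrite aE mulrC.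
- by rewrite [a1 * b2]mulrC -bE; ring.
- by apply: (mulIf a1nz); rewrite cE0 bE; ring.
Qed.

(** If [b1] had larger degree, the bound on [b1 * b2] would make [b2] small, and [a2 * b1] would
    dominate [a1 * b2] in the sum and exceed its bound. *)
Lemma dle_factor a1 a2 b1 b2 d1 d2 :
  size a1 = d1.+1 -> size a2 = d2.+1 -> dle (b1 * b2) (d1 + d2 + 8) ->
  dle (a2 * b1 + a1 * b2) (d1 + d2 + 4) -> dle b1 (d1 + 4).
Proof.
rewrite /dle => s1 s2 hc hb; rewrite leqNgt; apply/negP => lt.
have nz1 : b1 != 0 by rewrite -size_poly_gt0; lia.
have nz2 : a2 != 0 by rewrite -size_poly_gt0 s2.
have s3 : size (a2 * b1) = (d2 + size b1)%N by rewrite size_mul // s2.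
have s4 : (size (a1 * b2)%R <= d1 + d2 + 4)%N.
  have [->|nz] := eqVneq b2 0; first by rewrite mulr0 size_poly0.
  have anz : a1 != 0 by rewrite -size_poly_gt0 s1.
  by rewrite size_mul // s1; move: hc lt; rewrite size_mul //; size_lia.
have lt2 : (size (a1 * b2)%R < size (a2 * b1)%R)%N by rewrite s3; move: s4 lt; size_lia.
by move: hb lt; rewrite size_polyDl // s3; size_lia.
Qed.

End Factor.

Lemma eq_res24 (R : comNzRingType) (a b c g0 g1 g2 g3 g4 h0 h1 h2 h3 h4 : R) :
  g0 = h0 -> g1 = h1 -> g2 = h2 -> g3 = h3 -> g4 = h4 ->
  res24 a b c g0 g1 g2 g3 g4 = res24 a b c h0 h1 h2 h3 h4.
Proof. by move=> -> -> -> -> ->. Qed.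

Section PencilCount.

Variable K : fieldType.
Variables a b c m0 m1 m2 m3 g0 g1 g2 g3 g4 : {poly K}.

Let f2 : {poly {poly K}} := c%:P + b%:P * 'X + a%:P * 'X ^+ 2.
Let f3 : {poly {poly K}} :=
  m0%:P + m1%:P * 'X + m2%:P * 'X ^+ 2 + m3%:P * 'X ^+ 3.
Let f4 : {poly {poly K}} :=
  g0%:P + g1%:P * 'X + g2%:P * 'X ^+ 2 + g3%:P * 'X ^+ 3 + g4%:P * 'X ^+ 4.

Hypothesis size_a : size a = 5.
Hypothesis db : dle b 8.
Hypothesis dc : dle c 12.
Let t : {poly K} := 'X.
(* The left-hand sides are the coefficients in the frame of section [Twist]. *)
Hypothesis dm0 : dle (t ^+ 3 * m0) 17.
Hypothesis dm1 : dle (t ^+ 3 * m1 - 4 * t ^+ 2 * c) 13.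
Hypothesis dm2 : dle (t ^+ 3 * m2 - 4 * t ^+ 2 * b) 9.
Hypothesis dm3 : dle (t ^+ 3 * m3 - 4 * t ^+ 2 * a) 5.
Hypothesis dg0 : dle (t ^+ 4 * g0) 20.
Hypothesis dg1 : dle (t ^+ 4 * g1 - 2 * t ^+ 3 * m0) 16.
Hypothesis dg2 : dle (t ^+ 4 * g2 - 2 * t ^+ 3 * m1 + 4 * t ^+ 2 * c) 12.
Hypothesis dg3 : dle (t ^+ 4 * g3 - 2 * t ^+ 3 * m2 + 4 * t ^+ 2 * b) 8.
Hypothesis dg4 : dle (t ^+ 4 * g4 - 2 * t ^+ 3 * m3 + 4 * t ^+ 2 * a) 4.

Hypothesis no_ruling : forall d : {poly {poly K}},
  d %| f2 -> d %| f3 -> d %| f4 -> (size d <= 1)%N.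

Variable s : seq (K * K).
Hypothesis us : uniq s.
Hypothesis sa : forall x, x \in s -> a.[x.1] != 0.
Hypothesis s2 : forall x, x \in s ->
  c.[x.1] + b.[x.1] * x.2 + a.[x.1] * x.2 ^+ 2 = 0.
Hypothesis s3 : forall x, x \in s ->
  m0.[x.1] + m1.[x.1] * x.2 + m2.[x.1] * x.2 ^+ 2 + m3.[x.1] * x.2 ^+ 3 = 0.
Hypothesis s4 : forall x, x \in s ->
  g0.[x.1] + g1.[x.1] * x.2 + g2.[x.1] * x.2 ^+ 2 + g3.[x.1] * x.2 ^+ 3
  + g4.[x.1] * x.2 ^+ 4 = 0.

Let anz : a != 0. Proof. by rewrite -size_poly_gt0 size_a. Qed.
Let da : dle a 4. Proof. by rewrite /dle size_a. Qed.
Let a3nz : a ^+ 3 != 0. Proof. exact: expf_neq0. Qed.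

Let p3 := rem1 a b c m1 m2 m3 0.
Let q3 := rem0 a b c m0 m2 m3 0.
Let p4 := rem1 a b c g1 g2 g3 g4.
Let q4 := rem0 a b c g0 g2 g3 g4.

(** [hom2], [hom3], [hom4] are [u^i fi (- v / u)]; they vanish when [v + u l] divides [fi] up to a
    factor in [t]. *)
Definition hom2 u v := c * u ^+ 2 - b * u * v + a * v ^+ 2.
Definition hom3 u v :=
  m0 * u ^+ 3 - m1 * u ^+ 2 * v + m2 * u * v ^+ 2 - m3 * v ^+ 3.
Definition hom4 u v := g0 * u ^+ 4 - g1 * u ^+ 3 * v + g2 * u ^+ 2 * v ^+ 2
  - g3 * u * v ^+ 3 + g4 * v ^+ 4.

Lemma generic_count :
  res24 a b c m0 m1 m2 m3 0 != 0 -> (size s <= 46)%N.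
Proof.
move=> nz; set r := res24 _ _ _ _ _ _ _ _ in nz.
have dr : dle r 44.
  (* In the twisted frame the weights are [d = 4], [e = 1], which gives 50, and [t ^+ 3] on [f3]
     accounts for 6. As [f3] is read as a quartic with leading coefficient 0, the bound 44 includes
     a factor [a] of degree 4. *)
  apply: (@dle_mulX _ _ _ 6).
  have -> : 'X^6 * r = res24 a b c (t ^+ 3 * m0) (t ^+ 3 * m1 - 4 * t ^+ 2 * c)
      (t ^+ 3 * m2 - 4 * t ^+ 2 * b) (t ^+ 3 * m3 - 4 * t ^+ 2 * a) 0.
    by rewrite /r /res24 -/t; ring.
  by apply: (@dleW _ _ (2 * 1 + 4 * 4 + 32)) => //; apply: dle_res24 => //; exact: dle0.
apply: leq_trans (leq_trans (dle_pred dr) _) => //.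
apply: (@count_quadratic _ a b c m0 m1 m2 m3 0 1 r s) => // [x xs|].
  split; first exact: sa.
  - by rewrite hornerC oner_eq0.
  - exact: s2.
  - by rewrite horner0 mul0r addr0 s3.
by rewrite mul1r.
Qed.

Lemma hom3E u v : a ^+ 3 * hom3 u v =
  hom2 u v * (quo0 a b c m2 m3 0 * u - quo1 a b m3 0 * v)
  + u ^+ 2 * (q3 * u - p3 * v).
Proof.
by rewrite /hom3 /hom2 /p3 /q3 /quo0 /quo1 /rem1 /rem0; ring.
Qed.

(** On a common root of [f2] and [f3] the twisted quartic is just [t ^+ 4] times [f4]. It has degree
    at most [20 + 4 d] there, and dividing by [t ^+ 4] gives the bound. *)
Lemma dle_hom4 u v d : dle u d -> dle v (d + 4) ->
  hom2 u v = 0 -> hom3 u v = 0 -> dle (hom4 u v) (16 + 4 * d).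
Proof.
move=> du dv h2 h3; apply: (@dle_mulX _ _ _ 4).
have -> : 'X^4 * hom4 u v = (t ^+ 4 * g0) * u ^+ 4
    - (t ^+ 4 * g1 - 2 * t ^+ 3 * m0) * u ^+ 3 * v
    + (t ^+ 4 * g2 - 2 * t ^+ 3 * m1 + 4 * t ^+ 2 * c) * u ^+ 2 * v ^+ 2
    - (t ^+ 4 * g3 - 2 * t ^+ 3 * m2 + 4 * t ^+ 2 * b) * u * v ^+ 3
    + (t ^+ 4 * g4 - 2 * t ^+ 3 * m3 + 4 * t ^+ 2 * a) * v ^+ 4.
  have e : 2 * t ^+ 3 * v * hom3 u v + 4 * t ^+ 2 * v ^+ 2 * hom2 u v = 0.
    by rewrite h2 h3 !mulr0 addr0.
  by rewrite -[LHS]addr0 -[X in _ + X = _]e /hom4 /hom3 /hom2 -/t; ring.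
by dle_tac.
Qed.

Lemma dle_hom3 u v d : dle u d -> dle v (d + 4) ->
  hom2 u v = 0 -> dle (hom3 u v) (14 + 3 * d).
Proof.
move=> du dv h2; apply: (@dle_mulX _ _ _ 3).
have -> : 'X^3 * hom3 u v = (t ^+ 3 * m0) * u ^+ 3
    - (t ^+ 3 * m1 - 4 * t ^+ 2 * c) * u ^+ 2 * v
    + (t ^+ 3 * m2 - 4 * t ^+ 2 * b) * u * v ^+ 2
    - (t ^+ 3 * m3 - 4 * t ^+ 2 * a) * v ^+ 3.
  have e : 4 * t ^+ 2 * v * hom2 u v = 0 by rewrite h2 mulr0.
  by rewrite -[LHS]addr0 -[X in _ + X = _]e /hom3 /hom2 -/t; ring.
by dle_tac.
Qed.

Lemma dvdp_hom3 u v : u != 0 -> hom3 u v = 0 -> v%:P + u%:P * 'X %| f3.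
Proof.
move=> unz h3; apply/Pdiv.Idomain.dvdpP.
exists (u ^+ 3, (u ^+ 2 * m1 - u * v * m2 + v ^+ 2 * m3)%:P
  + (u * (u * m2 - v * m3))%:P * 'X + (u ^+ 2 * m3)%:P * 'X ^+ 2).
  exact: expf_neq0.
rewrite -[LHS]subr0 -(polyC0 {poly K}) -h3 /f3 /hom3 /= -mul_polyC.
by rewrite !(polyCM, polyCD, polyCN, polyCB, polyC_exp); ring.
Qed.

Lemma dvdp_hom4 u v : u != 0 -> hom4 u v = 0 -> v%:P + u%:P * 'X %| f4.
Proof.
move=> unz h4; apply/Pdiv.Idomain.dvdpP.
exists (u ^+ 4, (u ^+ 3 * g1 - u ^+ 2 * v * g2 + u * v ^+ 2 * g3 - v ^+ 3 * g4)%:P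
  + (u * (u ^+ 2 * g2 - u * v * g3 + v ^+ 2 * g4))%:P * 'X
  + (u ^+ 2 * (u * g3 - v * g4))%:P * 'X ^+ 2 + (u ^+ 3 * g4)%:P * 'X ^+ 3).
  exact: expf_neq0.
rewrite -[LHS]subr0 -(polyC0 {poly K}) -h4 /f4 /hom4 /= -mul_polyC.
by rewrite !(polyCM, polyCD, polyCN, polyCB, polyC_exp); ring.
Qed.

Lemma horner_hom4 u v x : u.[x.1] != 0 -> v.[x.1] + u.[x.1] * x.2 = 0 ->
  x \in s -> (hom4 u v).[x.1] = 0.
Proof.
move=> unz uv xs; have vE : v.[x.1] = - (u.[x.1] * x.2).
  by apply/eqP; rewrite -addr_eq0 uv.
rewrite /hom4 !(hornerD, hornerN, hornerM, horner_exp) vE.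
by rewrite -[RHS](mulr0 (u.[x.1] ^+ 4)) -(s4 xs); ring.
Qed.

Lemma horner_hom3 u v x : u.[x.1] != 0 -> v.[x.1] + u.[x.1] * x.2 = 0 ->
  x \in s -> (hom3 u v).[x.1] = 0.
Proof.
move=> unz uv xs; have vE : v.[x.1] = - (u.[x.1] * x.2).
  by apply/eqP; rewrite -addr_eq0 uv.
rewrite /hom3 !(hornerD, hornerN, hornerM, horner_exp) vE.
by rewrite -[RHS](mulr0 (u.[x.1] ^+ 3)) -(s3 xs); ring.
Qed.

Lemma size_linear (u v : {poly K}) : u != 0 -> size (v%:P + u%:P * 'X) = 2.
Proof.
move=> unz; rewrite addrC size_MXaddC.
by rewrite polyC_eq0 (negbTE unz) /= size_polyC unz.
Qed.

(** Here [f2 = (v + u l) (v' + u' l)] and the first factor divides [f3]. It cannot divide [f4] as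
    well, so the points on it are zeros of [hom4 u v]; the other points are zeros of
    [hom3 u' v']. *)
Lemma split_count : p3 != 0 -> a * q3 ^+ 2 - b * p3 * q3 + c * p3 ^+ 2 = 0 ->
  (size s <= 46)%N.
Proof.
move=> pnz /(quadratic_factor pnz) [u [v [u' [v' [unz pv aE bE cE]]]]].
have u'nz : u' != 0 by apply: contraNneq anz => u0; rewrite aE u0 mulr0.
have [d su] : exists d, size u = d.+1.
  by exists (size u).-1; rewrite prednK // size_poly_gt0.
have [d' su'] : exists d, size u' = d.+1.
  by exists (size u').-1; rewrite prednK // size_poly_gt0.
have dd : (d + d')%N = 4.
  by move: size_a; rewrite aE size_mul // su su'; size_lia.
have dv : dle v (d + 4).
  by apply: (@dle_factor _ u u' v v' d d'); rewrite -?bE -?cE ?dd.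
have dv' : dle v' (d' + 4).
  apply: (@dle_factor _ u' u v' v d' d) => //.
    by rewrite mulrC -cE addnC (addnC d') dd.
  by rewrite addrC -bE (addnC d') dd.
have h2 : hom2 u v = 0 by rewrite /hom2 aE bE cE; ring.
have h2' : hom2 u' v' = 0 by rewrite /hom2 aE bE cE; ring.
have h3 : hom3 u v = 0.
  apply: (mulfI a3nz); rewrite hom3E h2 mul0r add0r pv.
  by rewrite subrr !mulr0.
have du : dle u d by rewrite /dle su.
have du' : dle u' d' by rewrite /dle su'.
have h4 : hom4 u v != 0.
  apply/eqP => h4.
  have := @no_ruling (v%:P + u%:P * 'X).
  rewrite (dvdp_hom3 unz h3) (dvdp_hom4 unz h4) size_linear //.
  have -> : v%:P + u%:P * 'X %| f2; last by move=> /(_ isT isT isT).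
  rewrite /f2 aE bE cE.
  have -> : (v * v')%:P + (u' * v + u * v')%:P * 'X + (u * u')%:P * 'X^2
     = (v%:P + u%:P * 'X) * (v'%:P + u'%:P * 'X) :> {poly {poly K}}.
    by rewrite !(polyCM, polyCD); ring.
  exact: dvdp_mulIl.
have ua x : x \in s -> u.[x.1] != 0 /\ u'.[x.1] != 0.
  by move/sa; rewrite aE hornerM mulf_eq0 negb_or => /andP [].
have on (l : seq (K * K)) : uniq l -> {subset l <= s} ->
    (forall x, x \in l -> v.[x.1] + u.[x.1] * x.2 = 0) ->
    (size l <= 16 + 4 * d)%N.
  move=> ul ls hl; apply: leq_trans (dle_pred (dle_hom4 du dv h2 h3)).
  apply: (@count_linear _ u v) => // x xl; have [ux _] := ua x (ls _ xl).
  by split; [exact: ux|exact: hl|apply: horner_hom4; rewrite ?hl ?ls].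
(* If both factors divide [f3], both have the root [- q3 / p3] of the nonzero remainder. Then [f2]
   is a square up to a factor in [t], and all points lie on the first factor. *)
have [h3'|h3'] := eqVneq (hom3 u' v') 0.
  have pv' : p3 * v' = q3 * u'.
    apply/esym/eqP; rewrite -subr_eq0.
    have := hom3E u' v'; rewrite h3' h2' mulr0 mul0r add0r => /esym/eqP.
    by rewrite mulf_eq0 expf_eq0 /= (negbTE u'nz).
  have vv : u * v' = u' * v.
    by apply: (mulfI pnz); rewrite mulrCA pv' [RHS]mulrCA pv; ring.
  apply: (@leq_trans (16 + 4 * d)); last by move: dd; size_lia.
  apply: on => // x xs; have [ux u'x] := ua x xs.
  have := s2 xs; rewrite aE bE cE !(hornerD, hornerM) => e.
  have vvx : u.[x.1] * v'.[x.1] = u'.[x.1] * v.[x.1] by rewrite -!hornerM vv.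
  have : (v.[x.1] + u.[x.1] * x.2) ^+ 2 = 0.
    apply: (mulfI u'x); rewrite mulr0 -[RHS](mulr0 u.[x.1]) -e.
    rewrite -[RHS]addr0 -(mulr0 (v.[x.1] + u.[x.1] * x.2)) -(subrr (u.[x.1] * v'.[x.1])).
    by rewrite {2}vvx; ring.
  by move/eqP; rewrite expf_eq0 => /andP [_ /eqP].
pose P (x : K * K) := v.[x.1] + u.[x.1] * x.2 == 0.
rewrite -(perm_size (permEl (perm_filterC P s))) size_cat.
(* As [d + d' = 4], the sum is [42 + d], at most 46. *)
apply: (@leq_trans ((16 + 4 * d) + (14 + 3 * d'))); last by move: dd; size_lia.
apply: leq_add.
  apply: on; first exact: filter_uniq.
    by move=> x; rewrite mem_filter => /andP [].
  by move=> x; rewrite mem_filter => /andP [/eqP].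
apply: leq_trans (dle_pred (dle_hom3 du' dv' h2')).
apply: (@count_linear _ u' v') => //; first exact: filter_uniq.
move=> x; rewrite mem_filter => /andP [/= nP xs]; have [ux u'x] := ua x xs.
have e : v'.[x.1] + u'.[x.1] * x.2 = 0.
  apply: (mulfI nP); rewrite mulr0 -[RHS](s2 xs) aE bE cE.
  by rewrite !(hornerD, hornerM); ring.
by split=> //; apply: horner_hom3.
Qed.

Section Divisible.

Hypothesis p30 : p3 = 0.
Hypothesis q30 : q3 = 0.

Lemma dvdp_f2_f3 : f2 %| f3.
Proof.
apply/Pdiv.Idomain.dvdpP.
exists (a ^+ 3, (quo0 a b c m2 m3 0)%:P + (quo1 a b m3 0)%:P * 'X) => //=.
have := divE a%:P b%:P c%:P m0%:P m1%:P m2%:P m3%:P 0 ('X : {poly {poly K}}).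
rewrite -mul_polyC polyC_exp /f3 mul0r addr0 => ->.
have -> : rem0 a%:P b%:P c%:P m0%:P m2%:P m3%:P 0 = q3%:P :> {poly {poly K}}.
  by rewrite /q3 /rem0 !(polyCM, polyCD, polyCN, polyCB, polyC_exp, polyC0).
have -> : rem1 a%:P b%:P c%:P m1%:P m2%:P m3%:P 0 = p3%:P :> {poly {poly K}}.
  by rewrite /p3 /rem1 !(polyCM, polyCD, polyCN, polyCB, polyC_exp, polyC0); ring.
rewrite p30 q30 /f2 /quo0 /quo1 /quo2.
by rewrite !(polyCM, polyCD, polyCN, polyCB, polyC_exp, polyC0); ring.
Qed.

(** A zero resultant gives [f2] and [f4] a common factor: [f2] itself if the remainder is zero, a
    linear one otherwise. It divides [f3] because [f2] does, against [no_ruling]. *)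
Lemma res24_neq0 : res24 a b c g0 g1 g2 g3 g4 != 0.
Proof.
apply/eqP => r0.
have eq0 : a * q4 ^+ 2 - b * p4 * q4 + c * p4 ^+ 2 = 0.
  by rewrite -[LHS]res24_rem r0 mulr0.
have f4E : (a ^+ 3) *: f4 = f2 * ((quo0 a b c g2 g3 g4)%:P +
    (quo1 a b g3 g4)%:P * 'X + (quo2 a g4)%:P * 'X ^+ 2) + (q4%:P + p4%:P * 'X).
  have := divE a%:P b%:P c%:P g0%:P g1%:P g2%:P g3%:P g4%:P ('X : {poly {poly K}}).
  rewrite -mul_polyC polyC_exp /f4 => ->.
  rewrite /f2 /quo0 /quo1 /quo2 /q4 /p4 /rem0 /rem1.
  by rewrite !(polyCM, polyCD, polyCN, polyCB, polyC_exp); ring.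
have [p40|pnz] := eqVneq p4 0.
  have q40 : q4 = 0.
    move: eq0; rewrite p40 !mulr0 mul0r subr0 expr0n mulr0 addr0 => /eqP.
    by rewrite mulf_eq0 (negbTE anz) expf_eq0 => /eqP.
  have := @no_ruling f2 (dvdpp _) dvdp_f2_f3.
  have -> : f2 %| f4.
    by rewrite -(dvdpZr _ _ a3nz) f4E p40 q40 mul0r !addr0 dvdp_mulIl.
  move=> /(_ isT); rewrite leqNgt => /negP; apply.
  have sX : size (a%:P * 'X^2 : {poly {poly K}}) = 3.
    by rewrite size_Cmul // size_polyXn.
  rewrite /f2 addrC size_polyDl sX //.
  apply: leq_ltn_trans (size_polyD _ _) _; rewrite gtn_max size_polyC.
  have [->|bnz] := eqVneq b 0; first by rewrite mul0r size_poly0; case: (c != 0).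
  by rewrite size_Cmul // size_polyX; case: (c != 0).
have [u [v [u' [v' [unz pv aE bE cE]]]]] := quadratic_factor pnz eq0.
have := @no_ruling (v%:P + u%:P * 'X); rewrite size_linear //.
have df2 : v%:P + u%:P * 'X %| f2.
  rewrite /f2 aE bE cE.
  have -> : (v * v')%:P + (u' * v + u * v')%:P * 'X + (u * u')%:P * 'X^2
     = (v%:P + u%:P * 'X) * (v'%:P + u'%:P * 'X) :> {poly {poly K}}.
    by rewrite !(polyCM, polyCD); ring.
  exact: dvdp_mulIl.
rewrite df2 (dvdp_trans df2 dvdp_f2_f3).
have -> : v%:P + u%:P * 'X %| f4; last by move=> /(_ isT isT isT).
rewrite -(dvdpZr _ _ a3nz) f4E dvdp_add ?dvdp_mulr //.
rewrite -(dvdpZr _ _ unz).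
have -> : u *: (q4%:P + p4%:P * 'X) = p4 *: (v%:P + u%:P * 'X).
  by rewrite -!mul_polyC !mulrDr !mulrA -!polyCM pv mulrC [u * p4]mulrC.
by rewrite dvdpZr.
Qed.

(* As [f2] divides [f3] up to [a ^+ 3], the change of frame of section [Twist]
   multiplies [f4] by [t ^+ 4] modulo [f2]. *)
Lemma dle_res24_f4 : dle (res24 a b c g0 g1 g2 g3 g4) 48.
Proof.
set r := res24 _ _ _ _ _ _ _ _.
apply: (@dle_mulX _ _ _ 8).
set r' := res24 a b c (t ^+ 4 * g0) (t ^+ 4 * g1 - 2 * t ^+ 3 * m0)
  (t ^+ 4 * g2 - 2 * t ^+ 3 * m1 + 4 * t ^+ 2 * c)
  (t ^+ 4 * g3 - 2 * t ^+ 3 * m2 + 4 * t ^+ 2 * b)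
  (t ^+ 4 * g4 - 2 * t ^+ 3 * m3 + 4 * t ^+ 2 * a).
suff -> : 'X^8 * r = r'.
  (* The twisted weights [d = e = 4] give 56, of which [t ^+ 4] on [f4] accounts for 8. *)
  by apply: (@dleW _ _ (2 * 4 + 4 * 4 + 32)) => //; apply: dle_res24.
apply: (mulfI (expf_neq0 2 a3nz)).
have -> : 'X^8 * r = (t ^+ 4) ^+ 2 * r by rewrite -exprM.
rewrite mulrA -exprMn -!res24Zg.
set k0 := quo0 a b c m2 m3 0; set k1 := quo1 a b m3 0.
(* With [a^3 f3 = f2 (k0 + k1 l)], the terms [a^3 (- 2 l t^3 f3 + 4 l^2 t^2 f2)] of the twisted
   quartic are [f2] times the polynomial in [l] with these coefficients. *)
rewrite -(res24_mod _ _ _ _ _ _ _ _ 0 (- 2 * t ^+ 3 * k0)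
  (- 2 * t ^+ 3 * k1 + 4 * t ^+ 2 * a ^+ 3)).
have e0 : a ^+ 3 * m0 = k0 * c.
  by rewrite -[RHS]addr0 -q30 /k0 /q3 /quo0 /rem0; ring.
have e1 : a ^+ 3 * m1 = k0 * b + k1 * c.
  by rewrite -[RHS]addr0 -p30 /k0 /k1 /p3 /quo0 /quo1 /rem1; ring.
have e2 : a ^+ 3 * m2 = k0 * a + k1 * b by rewrite /k0 /k1 /quo0 /quo1; ring.
have e3 : a ^+ 3 * m3 = k1 * a by rewrite /k1 /quo1; ring.
clearbody k0 k1.
apply: eq_res24.
- ring.
- transitivity (a ^+ 3 * t ^+ 4 * g1 - 2 * t ^+ 3 * (a ^+ 3 * m0)); last by ring.
  by rewrite e0; ring.
- transitivity (a ^+ 3 * t ^+ 4 * g2 - 2 * t ^+ 3 * (a ^+ 3 * m1)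
    + 4 * t ^+ 2 * a ^+ 3 * c); last by ring.
  by rewrite e1; ring.
- transitivity (a ^+ 3 * t ^+ 4 * g3 - 2 * t ^+ 3 * (a ^+ 3 * m2)
    + 4 * t ^+ 2 * a ^+ 3 * b); last by ring.
  by rewrite e2; ring.
- transitivity (a ^+ 3 * t ^+ 4 * g4 - 2 * t ^+ 3 * (a ^+ 3 * m3)
    + 4 * t ^+ 2 * a ^+ 3 * a); last by ring.
  by rewrite e3; ring.
Qed.

Lemma quadratic_count k r : (forall x, x \in s -> k.[x.1] != 0) ->
  res24 a b c g0 g1 g2 g3 g4 = k * r -> (size s + (size k).-1 <= 48)%N.
Proof.
move=> ks rE.
have := res24_neq0; rewrite rE mulf_eq0 negb_or => /andP [knz rnz].
have le : (size s <= (size r).-1)%N.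
  by apply: (count_quadratic us _ rE rnz) => x xs; split; auto.
have := dle_res24_f4; rewrite rE /dle size_mul //.
by rewrite -!size_poly_gt0 in knz rnz; move: le knz rnz; size_lia.
Qed.

(* The resultant is divisible by [k ^+ 4] for the content [k] of [f2], and by [a]
   if [g4 = 0]. *)
Lemma content_count : (a %| m3 -> g4 = 0) -> (size s <= 46)%N.
Proof.
move=> ext; set k := gcdp a (gcdp b c).
have ka : k %| a by rewrite dvdp_gcdl.
have kb : k %| b by rewrite (dvdp_trans (dvdp_gcdr _ _)) ?dvdp_gcdl.
have kc : k %| c by rewrite (dvdp_trans (dvdp_gcdr _ _)) ?dvdp_gcdr.
have [cop|ncop] := eqVneq (size k) 1; last first.
  have /Pdiv.Field.dvdpP [a' aE] := ka; have /Pdiv.Field.dvdpP [b' bE] := kb.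
  have /Pdiv.Field.dvdpP [c' cE] := kc.
  have knz : k != 0 by rewrite gcdp_eq0 negb_and anz.
  have /quadratic_count : forall x, x \in s -> (k ^+ 4).[x.1] != 0.
    move=> x /sa; rewrite aE hornerM mulf_eq0 negb_or horner_exp => /andP [_ kx].
    exact: expf_neq0.
  have -> : res24 a b c g0 g1 g2 g3 g4 =
      k ^+ 4 * res24 a' b' c' g0 g1 g2 g3 g4.
    by rewrite -res24Z !(mulrC k) -aE -bE -cE.
  move=> /(_ _ erefl); rewrite size_exp /=.
  by rewrite -size_poly_gt0 in knz; move: ncop knz; size_lia.
(* Gauss's lemma: [f2] is primitive, so it divides [f3] over the polynomial ring and its leading
   coefficient divides [m3]. Below, [a] divides [m3] times [b^2], [b c] and [c^2], hence times the
   square of a combination of [b] and [c] that is prime to [a]. *)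
suff am : a %| m3.
  have g40 := ext am.
  have := @quadratic_count a _ sa; rewrite g40 res24_0 => /(_ _ erefl).
  by rewrite size_a; size_lia.
have e1 : a ^+ 2 * m1 - a * b * m2 + m3 * (b ^+ 2 - a * c) = 0.
  by apply: (mulfI anz); rewrite mulr0 -p30 /p3 /rem1; ring.
have e0 : a ^+ 2 * m0 - a * c * m2 + b * c * m3 = 0.
  by apply: (mulfI anz); rewrite mulr0 -q30 /q3 /rem0; ring.
have bb : b ^+ 2 * m3 = a * (m3 * c - a * m1 + b * m2).
  by rewrite -[LHS]subr0 -e1; ring.
have bc : b * c * m3 = a * (c * m2 - a * m0).
  by rewrite -[LHS]subr0 -e0; ring.
have cc : c ^+ 2 * m3 = a * (c * m1 - b * m0).
  apply: (mulfI anz).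
  have e : c * (a ^+ 2 * m1 - a * b * m2 + m3 * (b ^+ 2 - a * c))
      - b * (a ^+ 2 * m0 - a * c * m2 + b * c * m3) = 0.
    by rewrite e1 e0 !mulr0 subr0.
  by rewrite -[LHS]addr0 -[X in _ + X = _]e; ring.
have [[x y] /= xy] := Bezoutp b c.
have cg : coprimep a (x * b + y * c).
  rewrite /coprimep (eqp_size (eqp_gcdr a xy)); exact/eqP.
rewrite -(Gauss_dvdpr _ (coprimep_expr 2 cg)).
apply/Pdiv.Field.dvdpP.
exists (x ^+ 2 * (m3 * c - a * m1 + b * m2) + 2 * x * y * (c * m2 - a * m0)
  + y ^+ 2 * (c * m1 - b * m0)).
transitivity (x ^+ 2 * (b ^+ 2 * m3) + 2 * x * y * (b * c * m3)
  + y ^+ 2 * (c ^+ 2 * m3)); first by ring.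
by rewrite bb bc cc; ring.
Qed.

End Divisible.

Lemma pencil_count :
  (size s <= 48)%N /\ ((a %| m3 -> g4 = 0) -> (size s <= 46)%N).
Proof.
have [r0|] := eqVneq (res24 a b c m0 m1 m2 m3 0) 0; last first.
  by move/generic_count => le; split=> [|_ //]; exact: leq_trans le _.
have eq0 : a * q3 ^+ 2 - b * p3 * q3 + c * p3 ^+ 2 = 0.
  by rewrite -[LHS]res24_rem r0 mulr0.
have [p30|pnz] := eqVneq p3 0; last first.
  by have le := split_count pnz eq0; split=> [|_ //]; exact: leq_trans le _.
have q30 : q3 = 0.
  move: eq0; rewrite p30 !mulr0 mul0r subr0 expr0n mulr0 addr0 => /eqP.
  by rewrite mulf_eq0 (negbTE anz) expf_eq0 => /eqP.
split; last exact: content_count.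
have := @quadratic_count p30 q30 1 (res24 a b c g0 g1 g2 g3 g4).
rewrite size_poly1 addn0 mul1r; apply => // x _.
by rewrite hornerC oner_eq0.
Qed.

End PencilCount.

(** * Lines on a smooth quartic surface *)

Lemma irreducible_divisor (K : fieldType) (p : {poly K}) :
  (1 < size p)%N -> exists2 q, irreducible_poly q & q %| p.
Proof.
have [n le] := ubnP (size p); elim: n p le => // n IH p le sp.
have [irr|red] := classic (irreducible_poly p); first by exists p.
have [q [sq qp nqp]] : exists q : {poly K}, [/\ size q != 1, q %| p & ~~ (q %= p)].
  apply: NNPP => none; apply: red; split=> // q sq qp.
  by apply: contraT => nqp; case: none; exists q.
have pnz : p != 0 by rewrite -size_poly_gt0 ltnW.
have qnz : q != 0 by apply: contraNneq pnz => q0; rewrite -dvd0p -q0.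
have lt : (size q < size p)%N.
  by rewrite ltn_neqAle dvdp_leq // andbT dvdp_size_eqp.
have [||r irr rq] := IH q; last by exists r => //; apply: dvdp_trans rq qp.
  by apply: leq_trans lt _; rewrite -ltnS.
by rewrite ltn_neqAle eq_sym sq size_poly_gt0.
Qed.

Lemma root_in_extension (K : fieldType) (p : {poly K}) : (1 < size p)%N ->
  exists (L : fieldType) (j : {rmorphism K -> L}) (x : L), root (map_poly j p) x.
Proof.
move=> /irreducible_divisor [q irr qp].
have [L _ [x rx _]] := irredp_FAdjoin irr.
exists L, (in_alg L), x; have /Pdiv.Field.dvdpP [r ->] := qp.
by rewrite rmorphM rootM rx orbT.
Qed.

Definition smooth_forms (K : fieldType) (w : forms K) :=
  forall (L : fieldType) (j : {rmorphism K -> L}) (x : 'rV[L]_4),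
    x != 0 -> Fv w j x = 0 -> (forall y, dFv w j x y = 0) -> False.

(** Stated over every extension so that a basis over [K] serves directly at points defined over a
    larger field; spanning over [K] suffices, as an invertible matrix stays invertible. *)
Definition frame (K : fieldType) (e0 e1 e2 e3 : 'rV[K]_4) :=
  forall (L : fieldType) (j : {rmorphism K -> L}),
    (forall x : 'rV[L]_4, exists y0 y1 y2 y3, x = y0 *: map_mx j e0 +
       y1 *: map_mx j e1 + y2 *: map_mx j e2 + y3 *: map_mx j e3) /\
    (forall y0 y1 y2 y3, y0 *: map_mx j e0 + y1 *: map_mx j e1 +
       y2 *: map_mx j e2 + y3 *: map_mx j e3 = 0 ->
       [/\ y0 = 0, y1 = 0, y2 = 0 & y3 = 0]).

Lemma big_I4 (V : zmodType) (F : 'I_4 -> V) : \sum_i F i =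
  F ord0 + F (lift ord0 ord0) + F (lift ord0 (lift ord0 ord0))
  + F (lift ord0 (lift ord0 (lift ord0 ord0))).
Proof.
by rewrite !big_ord_recl big_ord0 addr0 !addrA.
Qed.

Lemma frame_span (K : fieldType) (e0 e1 e2 e3 : 'rV[K]_4) :
  (forall x, exists y0 y1 y2 y3,
     x = y0 *: e0 + y1 *: e1 + y2 *: e2 + y3 *: e3) ->
  frame e0 e1 e2 e3.
Proof.
move=> span; pose e := [:: e0; e1; e2; e3].
pose E : 'M[K]_4 := \matrix_i e`_i.
have /fin_all_exists [Y YE] : forall i : 'I_4,
    exists y : 'rV[K]_4, delta_mx 0 i = y *m E :> 'rV[K]_4.
  move=> i; have [y0 [y1 [y2 [y3 ->]]]] := span (delta_mx 0 i).
  exists (\row_j [:: y0; y1; y2; y3]`_j).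
  by rewrite mulmx_sum_row big_I4 !mxE !rowK.
have uE : E \in unitmx.
  have /mulmx1_unit [] // : (\matrix_i Y i) *m E = 1%:M.
  by apply/row_matrixP => i; rewrite row_mul rowK -YE rowE mulmx1.
move=> L j.
have combE (y : 'rV[L]_4) : y *m map_mx j E =
    y 0 ord0 *: map_mx j e0 + y 0 (lift ord0 ord0) *: map_mx j e1 +
    y 0 (lift ord0 (lift ord0 ord0)) *: map_mx j e2 +
    y 0 (lift ord0 (lift ord0 (lift ord0 ord0))) *: map_mx j e3.
  by rewrite mulmx_sum_row big_I4 -!map_row !rowK.
have uE' : map_mx j E \in unitmx by rewrite map_unitmx.
split=> [x|y0 y1 y2 y3 eq0].
  have := combE (x *m invmx (map_mx j E)); rewrite mulmxKV // => ->.
  by do 4!eexists.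
pose y : 'rV[L]_4 := \row_j [:: y0; y1; y2; y3]`_j.
have y0E : y = 0.
  apply: (can_inj (mulmxK uE')); rewrite mul0mx combE -[RHS]eq0.
  by rewrite !mxE.
by split; [have := congr1 (fun v : 'rV_4 => v 0 ord0) y0E
  | have := congr1 (fun v : 'rV_4 => v 0 (lift ord0 ord0)) y0E
  | have := congr1 (fun v : 'rV_4 => v 0 (lift ord0 (lift ord0 ord0))) y0E
  | have := congr1 (fun v : 'rV_4 => v 0 (lift ord0 (lift ord0 (lift ord0 ord0)))) y0E];
  rewrite !mxE.
Qed.

(** * Infinitesimal rigidity of a line on a smooth quartic *)

Section Rigid.

Variables (K L : fieldType) (w : forms K) (i : {rmorphism K -> L}).
Hypothesis smooth : smooth_forms w.
Variables P V T N : 'rV[L]_4.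
Hypothesis fr : frame P V T N.

Local Notation I := (polyC \o i).
Local Notation lift_ := (map_mx (polyC : L -> {poly L})).

Let x := lift_ P + 'X *: lift_ V.
Hypothesis on_line : Fv w I x = 0.

(** The differential of the quartic along the line, in a constant direction: a cubic in the
    parameter of the line. *)
Definition dpoly z := dFv w I x (lift_ z).

Lemma dpolyE z : dpoly z = (dFv w i P z)%:P + 'X * (dFmid w i P V z)%:P
  + 'X ^+ 2 * (dFmid w i V P z)%:P + 'X ^+ 3 * (dFv w i V z)%:P.
Proof. by rewrite /dpoly /x dFv_line -!dFv_map -!dFmid_map. Qed.

Lemma line_coefs :
  [/\ Fv w i P = 0, dFv w i P V = 0, Fmid w i P V = 0, dFv w i V P = 0
    & Fv w i V = 0].
Proof.
have := on_line; rewrite /x Fv_line -!Fv_map -!dFv_map -!Fmid_map /=.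
rewrite -['X]expr1 !(mulrC ('X ^+ _)) => /polyP eq0.
by split; [have := eq0 0 | have := eq0 1%N | have := eq0 2 | have := eq0 3
  | have := eq0 4]; rewrite !coefD !coefCM !coefXn !coefC /=;
  rewrite !(mulr0, mulr1, addr0, add0r).
Qed.

(** This is the derivative of [f (P + X V) = 0] with respect to the parameter. *)
Lemma dpolyV : dpoly V = 0.
Proof.
have [_ h1 h2 h3 h4] := line_coefs.
by rewrite dpolyE dFmid_same1 dFmid_same2 dFvxx h1 h2 h3 h4 !mulr0 !addr0.
Qed.

(** Euler's relation [dFv x x = 4 f (x)], combined with [dpolyV]. *)
Lemma dpolyP : dpoly P = 0.
Proof.
have : dFv w I x x = 0 by rewrite dFvxx on_line mulr0.
by rewrite {2}/x dFvD dFvZ -!/(dpoly _) dpolyV mulr0 addr0.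
Qed.

(** The differential vanishes along [P] and [V] already, so a common zero for [T] and [N] is a
    singular point of the surface. *)
Lemma dpoly_no_root (M : fieldType) (j : {rmorphism L -> M}) u :
  (map_poly j (dpoly T)).[u] = 0 -> (map_poly j (dpoly N)).[u] = 0 -> False.
Proof.
move=> rT rN.
pose ev : {rmorphism {poly L} -> M} := horner_eval u \o map_poly j.
have evC : ev \o polyC =1 j by move=> c; rewrite /= map_polyC /= /horner_eval hornerC.
have evl z : map_mx ev (lift_ z) = map_mx j z.
  by apply/matrixP => a b; rewrite !mxE; exact: evC.
pose x0 := map_mx j P + u *: map_mx j V.
have xE : map_mx ev x = x0.
  rewrite /x map_mxD map_mxZ !evl; congr (_ + _ *: _).
  by rewrite /= map_polyX /horner_eval hornerX.
have [span free] := fr j.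
have eqI : ev \o I = j \o i.
  by apply: functional_extensionality => z; exact: evC.
have d0 z : dFv w (j \o i) x0 (map_mx j z) = ev (dpoly z).
  by rewrite /dpoly dFv_map eqI evl xE.
apply: (@smooth M (j \o i) x0).
- apply/eqP => x00; have [|/eqP] := free 1 u 0 0; last by rewrite oner_eq0.
  by rewrite scale1r !scale0r !addr0.
- have <- : ev (Fv w I x) = Fv w (j \o i) x0 by rewrite Fv_map eqI xE.
  by rewrite on_line rmorph0.
- move=> y; have [y0 [y1 [y2 [y3 ->]]]] := span y.
  rewrite !dFvD !dFvZ !d0 dpolyP dpolyV rmorph0 !mulr0 !add0r.
  by rewrite [ev _]rT [ev _]rN !mulr0 addr0.
Qed.

Lemma coprime_dpoly : coprimep (dpoly T) (dpoly N).
Proof.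
have [g0|gnz] := eqVneq (gcdp (dpoly T) (dpoly N)) 0.
  move/eqP: g0; rewrite gcdp_eq0 => /andP [/eqP T0 /eqP N0].
  by case: (@dpoly_no_root L idfun 0); rewrite map_poly_id // ?T0 ?N0 horner0.
apply: contraT => ncop; exfalso.
have : (1 < size (gcdp (dpoly T) (dpoly N)))%N.
  by rewrite ltn_neqAle eq_sym ncop size_poly_gt0.
move=> /root_in_extension [M [j [u]]]; rewrite gcdp_map root_gcd => /andP [rT rN].
by apply: (@dpoly_no_root M j u); apply/eqP.
Qed.

(** The point at infinity [V] of the line is smooth too: there the differential is given by the
    coefficients of degree 3. *)
Lemma size_dpoly : (size (dpoly T) == 4) || (size (dpoly N) == 4).
Proof.
have le z : (size (dpoly z) <= 4)%N.
  apply/leq_sizeP => k; rewrite dpolyE -['X]expr1 !(mulrC ('X ^+ _)).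
  by case: k => [|[|[|[|k]]]] // _; rewrite !coefD !coefCM !coefXn coefC /=;
    rewrite !mulr0 !addr0.
have c3 z : (dpoly z)`_3 = dFv w i V z.
  rewrite dpolyE -['X]expr1 !(mulrC ('X ^+ _)) !coefD !coefCM !coefXn coefC /=.
  by rewrite !mulr0 !add0r mulr1.
have [T0|nz] := eqVneq (dpoly T)`_3 0; last first.
  by rewrite eqn_leq le /= ltnNge (contraNN _ nz) // => /leq_sizeP ->.
have [N0|nz] := eqVneq (dpoly N)`_3 0; last first.
  by rewrite orbC eqn_leq le /= ltnNge (contraNN _ nz) // => /leq_sizeP ->.
have [span free] := fr idfun.
have idm (z : 'rV[L]_4) : map_mx idfun z = z by apply/matrixP => a b; rewrite mxE.
rewrite !idm in span free.
have [_ _ _ VP FV] := line_coefs.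
case: (@smooth L i V) => //.
- apply/eqP => V0; have [|_ /eqP] := free 0 1 0 0; last by rewrite oner_eq0.
  by rewrite V0 !scale0r scale1r !addr0.
- move=> y; have [y0 [y1 [y2 [y3 ->]]]] := span y.
  by rewrite !dFvD !dFvZ VP dFvxx FV -!c3 T0 N0 !mulr0 !addr0.
Qed.

(* The normal bundle of a line on the surface is O(-2): it has no sections. *)
Lemma rigid_line y0 y1 y2 y3 :
  (y0%:P + 'X * y1%:P) * dpoly T + (y2%:P + 'X * y3%:P) * dpoly N = 0 ->
  [/\ y0 = 0, y1 = 0, y2 = 0 & y3 = 0].
Proof.
have lin0 (u v : L) (g : {poly L}) : size g = 4 -> g %| u%:P + 'X * v%:P ->
    u%:P + 'X * v%:P = 0.
  move=> sg gd; apply/eqP; apply: contraLR gd => nz.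
  rewrite gtNdvdp // sg addrC mulrC size_MXaddC.
  by case: ifP => // _; rewrite ltnS size_polyC; case: (v != 0).
have coef (u v : L) : u%:P + 'X * v%:P = 0 -> u = 0 /\ v = 0.
  move=> /polyP eq0; split; [have := eq0 0|have := eq0 1%N];
  by rewrite coefD coefC mulrC coefCM coefX coef0 /= ?mulr0 ?mulr1 ?addr0 ?add0r.
set m1 := _ + _ * y1%:P; set m2 := _ + _ * y3%:P => eq0.
suff [/coef [-> ->] /coef [-> ->]] : m1 = 0 /\ m2 = 0 by [].
have cop := coprime_dpoly.
have [/eqP sT|/eqP sN] := orP size_dpoly.
  have m20 : m2 = 0.
    apply: lin0 sT _; rewrite -(Gauss_dvdpl _ cop).
    have -> : m2 * dpoly N = - m1 * dpoly T.
      by apply/eqP; rewrite mulNr -addr_eq0 addrC eq0.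
    exact: dvdp_mulIr.
  split=> //; apply/eqP; move/eqP: eq0; rewrite m20 mul0r addr0 mulf_eq0.
  by rewrite -[dpoly T == 0]size_poly_eq0 sT orbF.
have m10 : m1 = 0.
  apply: lin0 sN _; rewrite coprimep_sym in cop; rewrite -(Gauss_dvdpl _ cop).
  have -> : m1 * dpoly T = - m2 * dpoly N.
    by apply/eqP; rewrite mulNr -addr_eq0 eq0.
  exact: dvdp_mulIr.
split=> //; apply/eqP; move/eqP: eq0; rewrite m10 mul0r add0r mulf_eq0.
by rewrite -[dpoly N == 0]size_poly_eq0 sN orbF.
Qed.

End Rigid.

Section VectorDegree.

Variables (K : fieldType) (w : forms K).
Implicit Types (x y z : 'rV[{poly K}]_4).

Definition vdle x d := forall j, dle (x 0 j) d.

Local Notation I := (polyC : K -> {poly K}).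

Lemma vdleD x y d : vdle x d -> vdle y d -> vdle (x + y) d.
Proof. by move=> hx hy j; rewrite mxE; apply: dleD. Qed.

Lemma vdleZ a x d e : dle a d -> vdle x e -> vdle (a *: x) (d + e).
Proof. by move=> ha hx j; rewrite mxE; apply: dleM. Qed.

Lemma vdle_const (e : 'rV[K]_4) : vdle (map_mx polyC e) 0.
Proof. by move=> j; rewrite mxE; apply: dleC. Qed.

Lemma vdleW x d e : vdle x d -> (d <= e)%N -> vdle x e.
Proof. by move=> hx le j; apply: dleW (hx j) le. Qed.

Lemma dle_lin h x d : vdle x d -> dle (lin I h x) d.
Proof.
by move=> hx; apply: dle_sum => j _; rewrite -[d]add0n; apply: dleM => //; apply: dleC.
Qed.

Lemma dle_bil q x y d e : vdle x d -> vdle y e -> dle (bil I q x y) (d + e).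
Proof. by move=> hx hy; apply: dle_sum => j _; apply: dleM => //; apply: dle_lin. Qed.

Lemma dle_tri c x y z d e k : vdle x d -> vdle y e -> vdle z k ->
  dle (tri I c x y z) (d + e + k).
Proof.
move=> hx hy hz; apply: dle_sum => j _; rewrite -addnA.
by apply: dleM => //; apply: dle_bil.
Qed.

Lemma dle_hv x d : vdle x d -> dle (hv w I x) d.
Proof. exact: dle_lin. Qed.

Lemma dle_qv x d : vdle x d -> dle (qv w I x) (d + d).
Proof. by move=> hx; apply: dle_bil. Qed.

Lemma dle_rv x d : vdle x d -> dle (rv w I x) (d + d).
Proof. by move=> hx; apply: dle_bil. Qed.

Lemma dle_qp x y d e : vdle x d -> vdle y e -> dle (qp w I x y) (d + e).
Proof.
by move=> hx hy; apply: dleD; [|rewrite addnC]; apply: dle_bil.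
Qed.

Lemma dle_rp x y d e : vdle x d -> vdle y e -> dle (rp w I x y) (d + e).
Proof.
by move=> hx hy; apply: dleD; [|rewrite addnC]; apply: dle_bil.
Qed.

Lemma dle_cv x d : vdle x d -> dle (cv w I x) (d + d + d).
Proof. by move=> hx; apply: dle_tri. Qed.

Lemma dle_cp x y d e : vdle x d -> vdle y e -> dle (cp w I x y) (d + d + e).
Proof.
move=> hx hy; apply: dleD; [apply: dleD|]; first exact: dle_tri.
  by rewrite addnAC; apply: dle_tri.
by rewrite [(d + d + e)%N]addnC addnA; apply: dle_tri.
Qed.

Lemma dle_cq x y z d e k : vdle x d -> vdle y e -> vdle z k ->
  dle (cq w I x y z) (d + e + k).
Proof.
move=> hx hy hz.
have h (u v t : 'rV[{poly K}]_4) du dv dt : vdle u du -> vdle v dv ->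
    vdle t dt -> (du + dv + dt)%N = (d + e + k)%N ->
    dle (tri I (tc w) u v t) (d + e + k).
  by move=> hu hv ht <-; apply: dle_tri.
by rewrite /cq; repeat apply: dleD; (eapply h; [eassumption..|]); lia.
Qed.

End VectorDegree.

Lemma coef1M (R : nzRingType) (p q : {poly R}) :
  (p * q)`_1 = p`_0 * q`_1 + p`_1 * q`_0.
Proof. by rewrite coefM !big_ord_recl big_ord0 addr0. Qed.

(** Cancellation modulo the square of the variable, that is, in dual numbers: [c] is invertible
    there up to passing to fractions. *)
Lemma coef01_cancel (R : idomainType) (c d f k : {poly R}) :
  c`_0 != 0 -> c * f = k * d -> d`_0 = 0 -> d`_1 = 0 -> f`_0 = 0 /\ f`_1 = 0.
Proof.
move=> cnz /polyP E d0 d1.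
have f0 : f`_0 = 0.
  by apply: (mulfI cnz); rewrite mulr0 -coef0M E coef0M d0 mulr0.
split=> //; apply: (mulfI cnz); have := E 1%N.
by rewrite !coef1M d0 d1 f0 !mulr0 !addr0.
Qed.

Lemma coef_lincomb (R : nzRingType) (a b c : R) (p q r : {poly R}) k :
  p`_k = 0 -> q`_k = 0 -> r`_k = 0 -> (a%:P * p + b%:P * q + c%:P * r)`_k = 0.
Proof. by move=> hp hq hr; rewrite !coefD !coefCM hp hq hr !mulr0 !addr0. Qed.

Lemma coef01_line (R : comNzRingType) (a b c d e : {poly R}) :
  (a + 'X * b + 'X ^+ 2 * c + 'X ^+ 3 * d + 'X ^+ 4 * e)`_0 = a`_0 /\
  (a + 'X * b + 'X ^+ 2 * c + 'X ^+ 3 * d + 'X ^+ 4 * e)`_1 = a`_1 + b`_0.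
Proof. by rewrite !coefD !coefXM !coefXnM /= !addr0. Qed.

Lemma coef3_cubic (R : comNzRingType) (c0 c1 c2 c3 q0 q1 q2 r0 r1 : R) :
  (c0%:P + 'X * c1%:P + 'X ^+ 2 * c2%:P + 'X ^+ 3 * c3%:P +
   (q0%:P + 'X * q1%:P + 'X ^+ 2 * q2%:P) * (r0%:P + 'X * r1%:P))`_3 =
  c3 + q2 * r1.
Proof.
set p : {poly R} := _ + _ * _.
have -> : p = (c0 + q0 * r0)%:P + 'X * (c1 + q1 * r0 + q0 * r1)%:P
    + 'X ^+ 2 * (c2 + q2 * r0 + q1 * r1)%:P + 'X ^+ 3 * (c3 + q2 * r1)%:P.
  by rewrite /p !(polyCD, polyCM); ring.
by rewrite !coefD coefC coefXM !coefXnM !coefC /= !add0r.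
Qed.

(** * First-order deformations of the lines of the pencil *)

Section Jet.

Variables (K L : fieldType) (j : {rmorphism K -> L}) (t : K) (l : L).

Local Notation S := {poly {poly L}}.

(* The outer variable is infinitesimal: [(jet y 'X, jet_pt z)] is the deformation
   of [(t, l)] in the direction [(y, z)]. The inner variable parametrizes the line. *)
Definition jet (y : L) : {rmorphism {poly K} -> S} :=
  horner_eval (((j t)%:P)%:P + 'X * (y%:P)%:P) \o map_poly (polyC \o polyC \o j).

Definition jet_pt (z : L) : S := (l%:P)%:P + 'X * (z%:P)%:P.

Lemma jetC y c : jet y c%:P = ((j c)%:P)%:P.
Proof. by rewrite /jet /= map_polyC /horner_eval hornerC. Qed.

Lemma jetX y : jet y 'X = ((j t)%:P)%:P + 'X * (y%:P)%:P.
Proof. by rewrite /jet /= map_polyX /horner_eval hornerX. Qed.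

Lemma coef_linear (c d : {poly L}) : (c%:P + 'X * d%:P)`_0 = c /\
  (c%:P + 'X * d%:P)`_1 = d.
Proof.
by rewrite !coefD !coefC !coefXM coefC /= addr0 add0r.
Qed.

Lemma jet_coef y p : (jet y p)`_0 = (j p.[t])%:P /\
  (jet y p)`_1 = (y * j p^`().[t])%:P.
Proof.
elim/poly_ind: p => [|p c [IH0 IH1]].
  by rewrite rmorph0 !coef0 deriv0 !horner0 rmorph0 mulr0.
have [c0 c1] := coef_linear (j t)%:P y%:P.
rewrite rmorphD rmorphM jetX jetC !coefD coef0M coef1M IH0 IH1 c0 c1 !coefC /=.
rewrite addr0 derivD derivM derivX derivC !hornerE.
by rewrite !(rmorphD, rmorphM) /=; split; rewrite -!(polyCD, polyCM); congr _%:P; ring.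
Qed.

(** First-order Taylor expansion; [a] and [b] are the partial derivatives of [d] at [(t, l)]. *)
Lemma jet2_coef (d : {poly {poly K}}) : exists a b : L, forall y z,
  ((map_poly (jet y) d).[jet_pt z])`_0 =
    ((map_poly j (map_poly (horner_eval t) d)).[l])%:P /\
  ((map_poly (jet y) d).[jet_pt z])`_1 = (y * a + z * b)%:P.
Proof.
elim/poly_ind: d => [|d c [a [b IH]]].
  exists 0, 0 => y z; rewrite !rmorph0 !horner0 !coef0 !mulr0 addr0.
  by rewrite rmorph0.
exists (a * l + j c^`().[t]),
  (b * l + (map_poly j (map_poly (horner_eval t) d)).[l]) => y z.
have [IH0 IH1] := IH y z; have [c0 c1] := coef_linear l%:P z%:P.
have [j0 j1] := jet_coef y c.
rewrite !(rmorphD, rmorphM) /= !map_polyX !map_polyC /= !hornerMXaddC.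
rewrite !coefD coef0M coef1M IH0 IH1 c0 c1 j0 j1 -!(polyCD, polyCM).
by split=> //; congr _%:P; ring.
Qed.

(** The deformed point is the original one plus ['X *: rest]. The value of [rest] at 0 is the
    velocity: [y] times the derivative in [t] plus [z] times the derivative in [l]. *)
Lemma jet_pencil (G N T : 'rV[{poly K}]_4) y z :
  let f := j \o horner_eval t in
  let D p := f p^`() in
  exists rest : 'rV[S]_4,
    map_mx (jet y) G + ('X)%:P *: (map_mx (jet y) N + jet_pt z *: map_mx (jet y) T)
    = map_mx polyC (map_mx polyC (map_mx f G)
        + 'X *: map_mx polyC (map_mx f N + l *: map_mx f T)) + 'X *: rest /\
    map_mx (horner_eval 0) rest = map_mx polyC (y *: map_mx D G)
      + 'X *: map_mx polyC (y *: (map_mx D N + l *: map_mx D T) + z *: map_mx f T).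
Proof.
move=> f D; set X := _ + _; exists (map_mx (drop_poly 1) X).
have takeE (p : {poly {poly L}}) : p = (p`_0)%:P + 'X * drop_poly 1 p.
  apply/polyP => k; rewrite coefD coefC coefXM coef_drop_poly.
  by case: k => [|k] /=; rewrite ?addr0 // add0r addn1.
have [l0 l1] := coef_linear l%:P z%:P; rewrite -/(jet_pt z) in l0 l1.
split; apply/matrixP => a k.
  rewrite [LHS]takeE !mxE; congr (_%:P + _).
  have [g0 _] := jet_coef y (G a k); have [n0 _] := jet_coef y (N a k).
  have [t0 _] := jet_coef y (T a k).
  by rewrite coefD coefCM coefD coef0M l0 g0 n0 t0 -polyCM -polyCD.
rewrite !mxE /horner_eval horner_coef0 coef_drop_poly add0n.
have [_ g1] := jet_coef y (G a k); have [_ n1] := jet_coef y (N a k).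
have [t0 t1] := jet_coef y (T a k).
rewrite coefD coefCM coefD coef1M l0 l1 g1 n1 t0 t1 -!(polyCD, polyCM).
by congr (_ + _ * _%:P); rewrite /D /f /= /horner_eval; ring.
Qed.

End Jet.

(** * The lines meeting a conic in normal form *)

Section Pencil.

Variables (K : fieldType) (w : forms K).
Variables e0 e1 e2 e3 : 'rV[K]_4.

Hypothesis fr : frame e0 e1 e2 e3.
Hypothesis smooth : smooth_forms w.
Hypothesis h0 : hv w id e0 = 0.
Hypothesis h1 : hv w id e1 = 0.
Hypothesis h2 : hv w id e2 = 0.
Hypothesis h3 : hv w id e3 = 1.
Hypothesis q0 : qv w id e0 = 0.
Hypothesis q1 : qv w id e1 = -1.
Hypothesis q2 : qv w id e2 = 0.
Hypothesis q01 : qp w id e0 e1 = 0.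
Hypothesis q02 : qp w id e0 e2 = 1.
Hypothesis q12 : qp w id e1 e2 = 0.
Hypothesis r2 : rv w id e2 != 0.

Section Points.

Variables (R : comNzRingType) (i : {rmorphism K -> R}).

(** In the plane of the conic [q] is [x0 x2 - x1^2], so these are all points of the conic except
    [e2]. By [r2] the missing point is off the residual conic, which makes [ga] of degree exactly
    4. *)
Definition pt (x : R) :=
  map_mx i e0 + x *: map_mx i e1 + x ^+ 2 *: map_mx i e2.
Definition tg (x : R) := map_mx i e1 + (2 * x) *: map_mx i e2.

Lemma hv_e : [/\ hv w i (map_mx i e0) = 0, hv w i (map_mx i e1) = 0,
  hv w i (map_mx i e2) = 0 & hv w i (map_mx i e3) = 1].
Proof.
have E x : hv w i (map_mx i x) = i (hv w id x) by rewrite hv_map.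
by split; rewrite E ?h0 ?h1 ?h2 ?h3 ?rmorph0 ?rmorph1.
Qed.

Lemma q_e : [/\ qv w i (map_mx i e0) = 0, qv w i (map_mx i e1) = -1,
  qv w i (map_mx i e2) = 0 & [/\ qp w i (map_mx i e0) (map_mx i e1) = 0,
  qp w i (map_mx i e0) (map_mx i e2) = 1 &
  qp w i (map_mx i e1) (map_mx i e2) = 0]].
Proof.
have E x : qv w i (map_mx i x) = i (qv w id x) by rewrite qv_map.
have E2 x y : qp w i (map_mx i x) (map_mx i y) = i (qp w id x y).
  by rewrite qp_map.
by rewrite !E !E2 q0 q1 q2 q01 q02 q12 rmorphN rmorph0 rmorph1.
Qed.

Lemma hv_pt x : hv w i (pt x) = 0.
Proof.
by have [E0 E1 E2 _] := hv_e; rewrite !hvD !hvZ E0 E1 E2 !mulr0 !addr0.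
Qed.

Lemma hv_tg x : hv w i (tg x) = 0.
Proof. by have [E0 E1 E2 _] := hv_e; rewrite hvD hvZ E1 E2 mulr0 addr0. Qed.

Lemma qv_pt x : qv w i (pt x) = 0.
Proof.
have [E0 E1 E2 [E01 E02 E12]] := q_e.
by rewrite !qvD !qvZ !qpDl !qpZr !qpZl E0 E1 E2 E01 E02 E12; ring.
Qed.

Lemma qv_tg x : qv w i (tg x) = -1.
Proof.
have [E0 E1 E2 [E01 E02 E12]] := q_e.
by rewrite qvD qvZ qpZr E1 E2 E12; ring.
Qed.

Lemma qp_pt_tg x : qp w i (pt x) (tg x) = 0.
Proof.
have [E0 E1 E2 [E01 E02 E12]] := q_e.
rewrite !qpDl !qpZl !qpDr !qpZr !qpxx E01 E02 E12 E1 E2.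
by rewrite [qp w i (map_mx i e2) _]qpC E12; ring.
Qed.

Lemma qp_pt_e0 x : qp w i (pt x) (map_mx i e0) = x ^+ 2.
Proof.
have [E0 E1 E2 [E01 E02 E12]] := q_e.
rewrite !qpDl !qpZl qpxx (qpC _ _ (map_mx i e1)) (qpC _ _ (map_mx i e2)).
by rewrite E0 E01 E02; ring.
Qed.

Lemma qp_pt_e2 x : qp w i (pt x) (map_mx i e2) = 1.
Proof.
have [E0 E1 E2 [E01 E02 E12]] := q_e.
by rewrite !qpDl !qpZl qpxx E2 E02 E12; ring.
Qed.

End Points.

Local Notation I := (polyC : K -> {poly K}).

Definition gpt : 'rV[{poly K}]_4 := pt polyC 'X.
Definition gtg : 'rV[{poly K}]_4 := tg polyC 'X.
Definition ga := rv w I gpt.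
(** Tangency at the point is solved by [hv n = r (P)] and [qp P n = - c (P)]. The multiple [ga] of
    [e3] settles the first equation; [- gc] remains to be produced by [e0] and [e2], on which [qp P]
    is ['X ^+ 2] and 1. *)
Definition gc := cv w I gpt + ga * qp w I gpt (map_mx polyC e3).
(* Splitting off the part divisible by ['X^2] solves [qp gpt gnm = - cv gpt]
   with coefficients of degree 4. *)
Definition gA := - drop_poly 2 gc.
Definition gB := - take_poly 2 gc.
Definition gnm := gA *: map_mx polyC e0 + gB *: map_mx polyC e2
  + ga *: map_mx polyC e3.

Lemma hv_gpt : hv w I gpt = 0. Proof. exact: hv_pt. Qed.
Lemma hv_gtg : hv w I gtg = 0. Proof. exact: hv_tg. Qed.
Lemma qv_gpt : qv w I gpt = 0. Proof. exact: qv_pt. Qed.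
Lemma qv_gtg : qv w I gtg = -1. Proof. exact: qv_tg. Qed.
Lemma qp_gpt_gtg : qp w I gpt gtg = 0. Proof. exact: qp_pt_tg. Qed.

Lemma hv_gnm : hv w I gnm = ga.
Proof.
have [E0 E1 E2 E3] := hv_e (polyC : {rmorphism K -> {poly K}}).
by rewrite !hvD !hvZ E0 E2 E3 !mulr0 !add0r mulr1.
Qed.

Lemma qp_gpt_gnm : qp w I gpt gnm = - cv w I gpt.
Proof.
rewrite !qpDr !qpZr qp_pt_e0 qp_pt_e2 mulr1.
have -> : gA * 'X^2 + gB = - gc.
  by rewrite /gA /gB -{3}(poly_take_drop 2 gc); ring.
by rewrite /gc; ring.
Qed.

Lemma tangent : hv w I gnm * cv w I gpt + qp w I gpt gnm * rv w I gpt = 0.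
Proof. by rewrite hv_gnm qp_gpt_gnm /ga; ring. Qed.

Lemma gaE : ga = (rv w id e0)%:P + 'X * (rp w id e0 e1)%:P
  + 'X ^+ 2 * (rp w id e0 e2 + rv w id e1)%:P + 'X ^+ 3 * (rp w id e1 e2)%:P
  + 'X ^+ 4 * (rv w id e2)%:P.
Proof.
have E x : rv w I (map_mx polyC x) = (rv w id x)%:P by rewrite rv_map.
have E2 x y : rp w I (map_mx polyC x) (map_mx polyC y) = (rp w id x y)%:P.
  by rewrite rp_map.
rewrite /ga /gpt /pt !rvD !rvZ !rpDl !rpZr !rpZl !E !E2 polyCD; ring.
Qed.

Lemma size_ga : size ga = 5.
Proof.
have sX : size ('X^4 * (rv w id e2)%:P) = 5.
  by rewrite mulrC size_Mmonic ?monicXn ?polyC_eq0 // size_polyXn size_polyC r2.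
rewrite gaE addrC size_polyDl sX //.
have c (x : K) := @dleC K x.
apply: (@leq_ltn_trans 4) => //.
suff : dle ((rv w id e0)%:P + 'X * (rp w id e0 e1)%:P +
  'X^2 * (rp w id e0 e2 + rv w id e1)%:P + 'X^3 * (rp w id e1 e2)%:P) 3 by [].
have d1 := c (rv w id e0); have d2 := c (rp w id e0 e1).
have d3 := c (rp w id e0 e2 + rv w id e1); have d4 := c (rp w id e1 e2).
by dle_tac.
Qed.

Lemma vdle_gpt : vdle gpt 2.
Proof.
apply: vdleD; [apply: vdleD|].
- exact: vdleW (vdle_const e0) _.
- exact: vdleW (vdleZ (dleX1 K) (vdle_const e1)) _.
- exact: vdleW (vdleZ (dleX K 2) (vdle_const e2)) _.
Qed.

Lemma dle_ga : dle ga 4. Proof. by rewrite /dle size_ga. Qed.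

Lemma dle_gc : dle gc 6.
Proof.
apply: dleD; first exact: dle_cv vdle_gpt.
exact: dleM dle_ga (dle_qp w vdle_gpt (vdle_const e3)).
Qed.

Lemma vdle_gnm : vdle gnm 4.
Proof.
have hc := dle_gc.
apply: vdleD; [apply: vdleD|].
- apply: (@vdleW _ _ (4 + 0)) => //; apply: vdleZ (vdle_const e0).
  by apply: dleN; rewrite /dle size_drop_poly; move: hc; rewrite /dle; lia.
- apply: (@vdleW _ _ (1 + 0)) => //; apply: vdleZ (vdle_const e2).
  by apply: dleN; apply: size_take_poly.
- by apply: vdleZ dle_ga (vdle_const e3).
Qed.

Let n' := 'X *: gnm.
Let T' := 'X *: gtg + (- 2) *: gpt.

Lemma vdle_n' : vdle n' 5.
Proof. exact: vdleZ (dleX1 K) vdle_gnm. Qed.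

Lemma vdle_T' : vdle T' 1.
Proof.
have -> : T' = (- 2) *: map_mx polyC e0 + (- 'X) *: map_mx polyC e1.
  rewrite /T' /gtg /gpt /tg /pt.
  by apply/matrixP => i j; rewrite !mxE; ring.
apply: vdleD.
  apply: (@vdleW _ _ (0 + 0)) => //; apply: vdleZ (vdle_const e0).
  exact/dleN/dle_nat.
apply: (@vdleW _ _ (1 + 0)) => //; apply: vdleZ (vdle_const e1).
exact/dleN/dleX1.
Qed.

(** The degrees of [gpt], [n'], [T'] are 2, 5, 1, and each [n'] replaced by [T'] saves 4. *)
Lemma dle_twisted :
  [/\ dle (tan20 w I gpt n') 14, dle (tan21 w I gpt n' T') 10,
      dle (tan22 w I gpt T') 6 &
  [/\ dle (tan30 w I gpt n') 17, dle (tan31 w I gpt n' T') 13,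
      dle (tan32 w I gpt n' T') 9, dle (tan33 w I gpt T') 5 &
  [/\ dle (tan40 w I n') 20, dle (tan41 w I n' T') 16,
      dle (tan42 w I n' T') 12, dle (tan43 w I n' T') 8 &
      dle (tan44 w I T') 4]]].
Proof.
have hP := vdle_gpt; have hn := vdle_n'; have hT := vdle_T'.
have a1 := dle_hv w hn; have a2 := dle_rv w hP.
have a3 := dle_cp w hP hn; have a4 := dle_cp w hP hT.
have a5 := dle_cp w hn hP; have a6 := dle_cp w hT hP.
have a7 := dle_cp w hn hT; have a8 := dle_cp w hT hn.
have a9 := dle_cq w hn hT hP; have b1 := dle_cv w hn; have b2 := dle_cv w hT.
have b3 := dle_qp w hP hn; have b4 := dle_qp w hn hT.
have b5 := dle_qv w hn; have b6 := dle_qv w hT.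
have c3 := dle_rp w hP hn; have c4 := dle_rp w hn hT.
have c5 := dle_rv w hn; have c6 := dle_rv w hT.
have c7 := dle_rp w hP hT.
clear hP hn hT.
split; [..|split; [..|split]];
  rewrite /tan20 /tan21 /tan22 /tan30 /tan31 /tan32 /tan33 /tan40 /tan41
    /tan42 /tan43 /tan44; clearbody n' T'; dle_tac.
Qed.

Definition gf2 : {poly {poly K}} := (tan20 w I gpt gnm)%:P
  + (tan21 w I gpt gnm gtg)%:P * 'X + (tan22 w I gpt gtg)%:P * 'X ^+ 2.
Definition gf3 : {poly {poly K}} := (tan30 w I gpt gnm)%:P
  + (tan31 w I gpt gnm gtg)%:P * 'X + (tan32 w I gpt gnm gtg)%:P * 'X ^+ 2
  + (tan33 w I gpt gtg)%:P * 'X ^+ 3.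
Definition gf4 : {poly {poly K}} := (tan40 w I gnm)%:P
  + (tan41 w I gnm gtg)%:P * 'X + (tan42 w I gnm gtg)%:P * 'X ^+ 2
  + (tan43 w I gnm gtg)%:P * 'X ^+ 3 + (tan44 w I gtg)%:P * 'X ^+ 4.

Section Specialize.

Variables (S : comNzRingType) (f : {rmorphism {poly K} -> S}) (l u : S).

Lemma horner_map4 (a0 a1 a2 a3 a4 : {poly K}) :
  (map_poly f (a0%:P + a1%:P * 'X + a2%:P * 'X ^+ 2 + a3%:P * 'X ^+ 3
     + a4%:P * 'X ^+ 4)).[l] =
  f a0 + f a1 * l + f a2 * l ^+ 2 + f a3 * l ^+ 3 + f a4 * l ^+ 4.
Proof.
rewrite !mul_polyC !rmorphD /= !map_polyZ !map_polyXn map_polyX map_polyC.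
by rewrite !(hornerD, hornerZ, hornerXn, hornerX, hornerC).
Qed.

Lemma spec2 : (map_poly f gf2).[l] =
  tan2 w (f \o I) (map_mx f gpt) (map_mx f gnm) (map_mx f gtg) l.
Proof.
have := horner_map4 (tan20 w I gpt gnm) (tan21 w I gpt gnm gtg)
  (tan22 w I gpt gtg) 0 0.
by rewrite polyC0 rmorph0 !mul0r !addr0 => ->; exact: tan2_map.
Qed.

Lemma spec3 : (map_poly f gf3).[l] =
  tan3 w (f \o I) (map_mx f gpt) (map_mx f gnm) (map_mx f gtg) l.
Proof.
have := horner_map4 (tan30 w I gpt gnm) (tan31 w I gpt gnm gtg)
  (tan32 w I gpt gnm gtg) (tan33 w I gpt gtg) 0.
by rewrite polyC0 rmorph0 !mul0r !addr0 => ->; exact: tan3_map.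
Qed.

Lemma spec4 : (map_poly f gf4).[l] =
  tan4 w (f \o I) (map_mx f gnm) (map_mx f gtg) l.
Proof. by rewrite -[RHS]tan4_map -horner_map4. Qed.

Lemma Fv_spec : Fv w (f \o I) (map_mx f gpt + u *: (map_mx f gnm + l *: map_mx f gtg))
  = u ^+ 2 * (map_poly f gf2).[l] + u ^+ 3 * (map_poly f gf3).[l]
    + u ^+ 4 * (map_poly f gf4).[l].
Proof.
rewrite Fv_pencil ?spec2 ?spec3 ?spec4 // -?hv_map -?qv_map -?qp_map.
- by rewrite hv_gpt rmorph0.
- by rewrite hv_gtg rmorph0.
- by rewrite qv_gpt rmorph0.
- by rewrite qp_gpt_gtg rmorph0.
- by rewrite -cv_map -rv_map -!rmorphM -rmorphD tangent rmorph0.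
Qed.

End Specialize.

(** The first, third and last vectors span the plane of the conic for every [t], and the second has
    nonzero coordinate [ga] on [e3]. *)
Lemma moving_frame (L : fieldType) (j : {rmorphism K -> L}) (t : K) (l : L) :
  ga.[t] != 0 ->
  let f := j \o horner_eval t in
  frame (map_mx f gpt) (map_mx f gnm + l *: map_mx f gtg) (map_mx f gtg)
    (map_mx j e2).
Proof.
move=> at0 f.
have fI : f \o polyC = j.
  by apply: functional_extensionality => z; rewrite /f /= /horner_eval hornerC.
have fX : f 'X = j t by rewrite /f /= /horner_eval hornerX.
have fe e : map_mx f (map_mx polyC e) = map_mx j e :> 'rV_4.
  by rewrite -map_mx_comp fI.
have ja : f ga != 0 by rewrite /f /= fmorph_eq0.
have PE : map_mx f gpt = map_mx j e0 + j t *: map_mx j e1 + (j t) ^+ 2 *: map_mx j e2.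
  rewrite /gpt /pt !map_mxD !map_mxZ !fe; congr (_ + _ *: _ + _ *: _) => //.
  by rewrite /= /horner_eval hornerXn rmorphXn.
have TE : map_mx f gtg = map_mx j e1 + (2 * j t) *: map_mx j e2.
  have f2X : f (2 * 'X) = 2 * j t.
    by rewrite /f /= /horner_eval hornerM hornerX -polyC_natr hornerC rmorphM rmorph_nat.
  by rewrite /gtg /tg map_mxD map_mxZ !fe; congr (_ + _ *: _).
have NE : map_mx f gnm = f gA *: map_mx j e0 + f gB *: map_mx j e2
    + f ga *: map_mx j e3.
  by rewrite /gnm !map_mxD !map_mxZ !fe.
apply: frame_span => x; have [span _] := fr j.
have [y0 [y1 [y2 [y3 ->]]]] := span x.
rewrite NE PE TE; move: (f gA) (f gB) (f ga) ja (j t) => A B a anz u.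
pose v := y3 / a.
have vE : y3 = v * a by rewrite /v divfK.
exists (y0 - v * A), v, (y1 - v * l - u * (y0 - v * A)),
  (y2 - v * B + (y0 - v * A) * u ^+ 2 - 2 * u * y1).
rewrite vE; apply/matrixP => a' b'; rewrite !mxE; ring.
Qed.

(* At a zero [(t, l)] of [d], a tangent vector of [d = 0] deforms the line through
   [P(t)] in direction [n + l T] to first order on the surface. *)
Lemma no_ruling (d : {poly {poly K}}) :
  (forall p : {poly K}, p != 0 -> exists t, p.[t] != 0) ->
  d %| gf2 -> d %| gf3 -> d %| gf4 -> (size d <= 1)%N.
Proof.
move=> inf /Pdiv.Idomain.dvdpP [[c2 k2] /= c2nz E2].
move=> /Pdiv.Idomain.dvdpP [[c3 k3] /= c3nz E3].
move=> /Pdiv.Idomain.dvdpP [[c4 k4] /= c4nz E4].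
rewrite leqNgt; apply/negP => sd.
have dnz : d != 0 by rewrite -size_poly_gt0 ltnW.
have ganz : ga != 0 by rewrite -size_poly_gt0 size_ga.
(* A general [t]: the pseudo-divisions survive, the moving frame is a basis, and [d] keeps its
   degree in [l], hence has a zero over an extension. *)
have [t] : exists t, (c2 * c3 * c4 * ga * lead_coef d).[t] != 0.
  by apply: inf; rewrite !mulf_neq0 // lead_coef_eq0.
rewrite !hornerM !mulf_eq0 !negb_or => /andP [/andP [/andP [/andP [n2 n3] n4] na] nd].
have : (1 < size (map_poly (horner_eval t) d))%N by rewrite size_map_poly_id0.
move=> /root_in_extension [L [j [l /eqP rl]]].
have [a [b jd]] := jet2_coef j t l d.
(* A nonzero vector killed by the differential of [d]. It exists even where both partial derivatives
   vanish, so inseparability does no harm. *)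
have [y [z [yz nyz]]] : exists y z : L, y * a + z * b = 0 /\ ~ (y = 0 /\ z = 0).
  have [b0|bnz] := eqVneq b 0.
    exists 0, 1; rewrite b0 mulr0 mul0r addr0; split=> // -[_ /eqP].
    by rewrite oner_eq0.
  by exists b, (- a); split; [ring|move=> [/eqP]; rewrite (negbTE bnz)].
have [d0 d1] := jd y z; rewrite rl polyC0 in d0; rewrite yz polyC0 in d1.
(* [d] vanishes to first order along the jet, hence so does everything it divides up to [c]. *)
have van c k f : c.[t] != 0 -> c *: f = k * d ->
    ((map_poly (jet j t y) f).[jet_pt l z])`_0 = 0 /\
  ((map_poly (jet j t y) f).[jet_pt l z])`_1 = 0.
  move=> cnz; rewrite -mul_polyC => /(congr1 (fun p => (map_poly (jet j t y) p).[jet_pt l z])).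
  rewrite !rmorphM /= map_polyC !hornerM hornerC => E.
  have [j0 _] := jet_coef j t y c.
  apply: coef01_cancel E d0 d1.
  by rewrite j0 polyC_eq0 fmorph_eq0.
have [u0 u1] := van _ _ _ n2 E2; have [v0 v1] := van _ _ _ n3 E3.
have [w0 w1] := van _ _ _ n4 E4; clear van.
set psi := jet j t y in u0 u1 v0 v1 w0 w1.
set lam := jet_pt l z in u0 u1 v0 v1 w0 w1.
pose f : {rmorphism {poly K} -> L} := j \o horner_eval t.
pose D p := f p^`().
have := Fv_spec psi lam ('X)%:P.
have [rest [-> restE]] := jet_pencil j t l gpt gnm gtg y z.
have DP : map_mx D gpt = map_mx f gtg.
  have E a' k : (gpt a' k)^`() = gtg a' k.
    by rewrite !mxE !derivD !derivM !derivC derivX; ring.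
  by apply/matrixP => a' k; rewrite mxE [RHS]mxE /D E.
rewrite -/f -/D DP in restE *.
set P := map_mx f gpt; set T := map_mx f gtg in restE *.
set V := map_mx f gnm + l *: T; set x := map_mx polyC P + 'X *: map_mx polyC V.
set X := map_mx polyC x + _ => FX.
have [FX0 FX1] : (Fv w (psi \o I) X)`_0 = 0 /\ (Fv w (psi \o I) X)`_1 = 0.
  by rewrite FX -!polyC_exp; split; apply: coef_lincomb.
have psiI : psi \o I = polyC \o polyC \o j.
  by apply: functional_extensionality => c; apply: jetC.
rewrite psiI in FX0 FX1; clear FX.
pose ev0 : {rmorphism {poly {poly L}} -> {poly L}} := horner_eval 0.
have ev0C : ev0 \o (polyC \o polyC \o j) = polyC \o j.
  apply: functional_extensionality => c.
  by rewrite /= /horner_eval hornerC.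
have on_line : Fv w (polyC \o j) x = 0.
  move: FX0; rewrite Fv_line (coef01_line _ _ _ _ _).1.
  by rewrite -[polyC \o polyC \o j]/(polyC \o (polyC \o j)) -Fv_map coefC.
(* The first-order term of the equation: the velocity of the deformation is tangent to the surface
   along the whole line. *)
have tan0 : dFv w (polyC \o j) x (map_mx (horner_eval 0) rest) = 0.
  move: FX1; rewrite Fv_line (coef01_line _ _ _ _ _).2.
  rewrite -[polyC \o polyC \o j]/(polyC \o (polyC \o j)) -Fv_map on_line coefC add0r.
  rewrite -horner_coef0 -[_.[0]]/(ev0 _) dFv_map.
  have -> : ev0 \o (polyC \o (polyC \o j)) = polyC \o j by [].
  suff -> : map_mx ev0 (map_mx polyC x) = x by [].
  by apply/matrixP => a' k; rewrite !mxE /= /horner_eval hornerC.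
have frL : frame P V T (map_mx j e2) := moving_frame j l na.
clear FX0 FX1; clearbody V; clearbody P T.
have [span _] := frL L idfun.
have idm (v : 'rV[L]_4) : map_mx idfun v = v by apply/matrixP => a' k; rewrite mxE.
have [z0 [z1 [z2 [z3]]]] := span (map_mx D gnm + l *: map_mx D gtg).
rewrite !idm => mE.
(* Modulo [P] and [V] the velocity is [(y + X (y z2 + z)) T + X y z3 e2], a section of the normal
   bundle. It vanishes, so [y = 0] and then [z = 0]. *)
have [|y0 /eqP] := @rigid_line K L w j smooth P V T (map_mx j e2) frL on_line
  y (y * z2 + z) 0 (y * z3).
  move: tan0; rewrite restE mE.
  rewrite !(map_mxD, map_mxZ) !(dFvD, dFvZ).
  rewrite -[dFv _ _ _ (map_mx _ P)]/(dpoly w j P V P) dpolyP //.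
  rewrite -[dFv _ _ _ (map_mx _ V)]/(dpoly w j P V V) dpolyV //.
  rewrite -[dFv _ _ _ (map_mx _ T)]/(dpoly w j P V T).
  rewrite -[dFv _ _ _ (map_mx _ (map_mx _ e2))]/(dpoly w j P V (map_mx j e2)).
  by move=> E; rewrite -[RHS]E polyCD !polyCM polyC0; ring.
rewrite y0 mul0r add0r => /eqP z00 _ _.
by apply: nyz.
Qed.

Hypothesis inf : forall p : {poly K}, p != 0 -> exists t, p.[t] != 0.

(** As [qv gtg = - 1], the leading coefficients of [f2], [f3], [f4] are [- ga], [- rp gpt gtg] and
    [- rv gtg], which translates the hypothesis of the bound 46. *)
Lemma transversal_count (s : seq (K * K)) : uniq s ->
  (forall x, x \in s -> [/\ ga.[x.1] != 0,
     (map_poly (horner_eval x.1) gf2).[x.2] = 0,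
     (map_poly (horner_eval x.1) gf3).[x.2] = 0 &
     (map_poly (horner_eval x.1) gf4).[x.2] = 0]) ->
  (size s <= 48)%N /\
  ((ga %| rp w I gpt gtg -> rv w I gtg = 0) -> (size s <= 46)%N).
Proof.
move=> us hs.
have t22 : tan22 w I gpt gtg = - ga by rewrite /tan22 qv_gtg /ga; ring.
have t33 : tan33 w I gpt gtg = - rp w I gpt gtg.
  by rewrite /tan33 qv_gtg mulN1r.
have t44 : tan44 w I gtg = - rv w I gtg by rewrite /tan44 qv_gtg mulN1r.
have [b20 b21 _ [b30 b31 b32 b33 [b40 b41 b42 b43 b44]]] := dle_twisted.
have qP := qv_gpt; have qPT := qp_gpt_gtg; have tg0 := tangent.
rewrite /n' /T' in b20 b21 b30 b31 b32 b33 b40 b41 b42 b43 b44.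
rewrite twist20 // in b20; rewrite twist21 // in b21.
rewrite twist30 // in b30; rewrite twist31 // in b31; rewrite twist32 // in b32.
rewrite twist33 // in b33; rewrite twist40 // in b40; rewrite twist41 // in b41.
rewrite twist42 // in b42; rewrite twist43 // in b43; rewrite twist44 // in b44.
have sa : size (tan22 w I gpt gtg) = 5 by rewrite t22 size_polyN size_ga.
have d21 : dle (tan21 w I gpt gnm gtg) 8 by apply: (@dle_mulX _ _ _ 2).
have d20 : dle (tan20 w I gpt gnm) 12 by apply: (@dle_mulX _ _ _ 2).
have E (x : K * K) (a0 a1 a2 a3 a4 : {poly K}) :=
  horner_map4 (horner_eval x.1) x.2 a0 a1 a2 a3 a4.
have [] := @pencil_count K _ _ _ _ _ _ _ _ _ _ _ _ sa d21 d20 b30 b31 b32 b33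
  b40 b41 b42 b43 b44 (fun d => @no_ruling d inf) s us.
- by move=> x /hs [nz _ _ _]; rewrite t22 hornerN oppr_eq0.
- move=> x /hs [_ + _ _].
  have := E x (tan20 w I gpt gnm) (tan21 w I gpt gnm gtg) (tan22 w I gpt gtg) 0 0.
  by rewrite polyC0 rmorph0 !mul0r !addr0 -/gf2 => ->.
- move=> x /hs [_ _ + _].
  have := E x (tan30 w I gpt gnm) (tan31 w I gpt gnm gtg)
    (tan32 w I gpt gnm gtg) (tan33 w I gpt gtg) 0.
  by rewrite polyC0 rmorph0 !mul0r !addr0 -/gf3 => ->.
- by move=> x /hs [_ _ _ +]; rewrite /gf4 E.
move=> le48 le46; split=> // ext; apply: le46.
rewrite t22 t33 t44 dvdpNr dvdpNl => /ext ->; exact: oppr0.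
Qed.

(** * Lines of the surface in the plane of the conic *)

Section Residual.

Variable m : seq (K * K).
Hypothesis um : uniq m.
(* A line of the plane [h = 0] not through [e2] is spanned by [e0 + x.1 e2] and
   [e1 + x.2 e2] for a unique [x]. *)
Hypothesis hm : forall x, x \in m ->
  [/\ rv w id (e0 + x.1 *: e2) = 0, rp w id (e0 + x.1 *: e2) (e1 + x.2 *: e2) = 0
    & rv w id (e1 + x.2 *: e2) = 0].

(** All these lines are components of the residual conic. They are cut with a line through [e2] and
    [e0 + z e1], where [D.[z] != 0] keeps the intersection points distinct; on it [r] restricts to a
    quadratic polynomial, nonzero by [r2]. *)
Lemma residual_count : (size m <= 2)%N.
Proof.
pose D := \prod_(x <- m) \prod_(y <- m | y != x)
  ((x.1 - y.1)%:P + (x.2 - y.2)%:P * 'X).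
have [z Dz] : exists z, D.[z] != 0.
  apply: inf; rewrite /D prodf_seq_neq0; apply/allP => x _ /=.
  rewrite prodf_seq_neq0; apply/allP => y _; apply/implyP => yx.
  apply: contra yx => /eqP eq0; rewrite -pair_eqE /pair_eq.
  have := congr1 (fun p : {poly K} => p`_0) eq0.
  have := congr1 (fun p : {poly K} => p`_1) eq0.
  rewrite /= !coefD !coefCM !coefC !coefX /= mulr1 add0r mulr0 addr0.
  by move=> /subr0_eq -> /subr0_eq ->; rewrite !eqxx.
pose r := (rv w id (e0 + z *: e1))%:P + (rp w id (e0 + z *: e1) e2)%:P * 'X
  + (rv w id e2)%:P * 'X ^+ 2.
have r2E : r`_2 != 0.
  by rewrite /r !coefD !coefCM coefC coefX coefXn /= mulr0 !add0r mulr1.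
have rnz : r != 0 by apply: contraNneq r2E => ->; rewrite coef0.
have sr : (size r <= 3)%N.
  apply/leq_sizeP => k; rewrite /r !coefD !coefCM coefC coefX coefXn.
  by case: k => [|[|[|k]]] // _ /=; rewrite !mulr0 !addr0.
rewrite -ltnS -(size_map (fun x : K * K => x.1 + z * x.2)).
apply: leq_trans sr; apply: max_poly_roots => //.
  apply/allP => _ /mapP [x xm ->]; have [a1 a2 a3] := hm xm.
  have e : rv w id (e0 + x.1 *: e2) + z * rp w id (e0 + x.1 *: e2) (e1 + x.2 *: e2)
      + z ^+ 2 * rv w id (e1 + x.2 *: e2) = 0.
    by rewrite a1 a2 a3 !mulr0 !addr0.
  rewrite rootE /r -[X in _ == X]e; apply/eqP.
  rewrite !mul_polyC !hornerD !hornerZ hornerXn hornerX hornerC.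
  rewrite !(rvD, rvZ, rpDl, rpDr, rpZl, rpZr) rpxx (rpC _ _ e2 e1); ring.
rewrite map_inj_in_uniq // => x y xm ym xy; apply/eqP; apply: contraNT Dz => ne.
rewrite /D horner_prod prodf_seq_eq0; apply/hasP; exists x => //=.
rewrite horner_prod prodf_seq_eq0; apply/hasP; exists y => //=.
rewrite eq_sym ne /= !hornerE; apply/eqP.
by rewrite -[RHS](subrr (x.1 + z * x.2)) {2}xy; ring.
Qed.

Lemma rp_gpt_gtg : rp w I gpt gtg = (rp w id e0 e1)%:P
  + 'X * (2 * (rp w id e0 e2 + rv w id e1))%:P
  + 'X ^+ 2 * (3 * rp w id e1 e2)%:P + 'X ^+ 3 * (4 * rv w id e2)%:P.
Proof.
have E x : rv w I (map_mx polyC x) = (rv w id x)%:P by rewrite rv_map.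
have E2 x y : rp w I (map_mx polyC x) (map_mx polyC y) = (rp w id x y)%:P.
  by rewrite rp_map.
rewrite /gpt /gtg /pt /tg !(rpDl, rpDr, rpZl, rpZr) !rpxx.
rewrite [rp w I (map_mx polyC e2) _]rpC !E !E2 !polyCM !polyCD; ring.
Qed.

Lemma rv_gtg : rv w I gtg = (rv w id e1)%:P + 'X * (2 * rp w id e1 e2)%:P
  + 'X ^+ 2 * (4 * rv w id e2)%:P.
Proof.
have E x : rv w I (map_mx polyC x) = (rv w id x)%:P by rewrite rv_map.
have E2 x y : rp w I (map_mx polyC x) (map_mx polyC y) = (rp w id x y)%:P.
  by rewrite rp_map.
rewrite /gtg /tg !(rvD, rvZ, rpZr) !E !E2 !polyCM; ring.
Qed.

(* If [r] vanishes to order two on a line, the surface is singular where the line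
   meets the cubic [c + q d r (_, e3)]. *)
Lemma double_line_singular (u v : 'rV[K]_4) :
  hv w id u = 0 -> hv w id v = 0 ->
  (forall (L : fieldType) (j : {rmorphism K -> L}) (a b : L),
     a *: map_mx j u + b *: map_mx j v = 0 -> a = 0 /\ b = 0) ->
  rv w id u = 0 -> rv w id v = 0 -> rp w id u v = 0 ->
  (forall e, e \in [:: e0; e1; e2] -> rp w id u e = 0 /\ rp w id v e = 0) -> False.
Proof.
move=> hu hv' free ru rv' ruv re.
pose G (R : comNzRingType) (i : {rmorphism K -> R}) x :=
  cv w i x + qv w i x * rp w i x (map_mx i e3).
have sing (L : fieldType) (j : {rmorphism K -> L}) (a b : L) :
    a != 0 \/ b != 0 -> G L j (a *: map_mx j u + b *: map_mx j v) = 0 -> False.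
  move=> ab; set x := _ + _ => Gx.
  have Eh y : hv w j (map_mx j y) = j (hv w id y) by rewrite hv_map.
  have Er y : rv w j (map_mx j y) = j (rv w id y) by rewrite rv_map.
  have Erp y z : rp w j (map_mx j y) (map_mx j z) = j (rp w id y z).
    by rewrite rp_map.
  have hx : hv w j x = 0 by rewrite hvD !hvZ !Eh hu hv' rmorph0 !mulr0 addr0.
  have rx : rv w j x = 0.
    by rewrite rvD !rvZ rpZl rpZr !Er Erp ru rv' ruv rmorph0 !mulr0 !addr0.
  have rpx e : e \in [:: e0; e1; e2] -> rp w j x (map_mx j e) = 0.
    move=> /re [r1 r2']; rewrite rpDl !rpZl !Erp r1 r2' rmorph0.
    by rewrite !mulr0 addr0.
  apply: (@smooth L j x).
  - by apply/eqP => /free [a0 b0]; case: ab; rewrite ?a0 ?b0 eqxx.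
  - by rewrite /Fv hx rx mul0r mulr0 addr0.
  - move=> y; have [span _] := fr j; have [y0 [y1 [y2 [y3 ->]]]] := span y.
    have [E0 E1 E2 E3] := hv_e j.
    rewrite /dFv hx rx mul0r mulr0 !addr0 !hvD !hvZ E0 E1 E2 E3.
    rewrite !rpDr !rpZr (rpx e0) ?(rpx e1) ?(rpx e2) ?inE ?eqxx ?orbT //.
    rewrite !mulr0 !add0r mulr1.
    by rewrite mulrCA -mulrDr -/(G L j x) Gx mulr0.
pose g := G {poly K} polyC (1 *: map_mx polyC u + 'X *: map_mx polyC v).
(* A nonconstant [g] has a root over an extension. A constant [g] has no term of degree 3, so the
   cubic vanishes at [v], the point at infinity. *)
have [sg|sg] := ltnP 1 (size g).
  have [L [j [z /eqP rz]]] := root_in_extension sg.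
  apply: (@sing L j 1 z); first by left; exact: oner_neq0.
  pose ev : {rmorphism {poly K} -> L} := horner_eval z \o map_poly j.
  have evC : ev \o polyC = j.
    apply: functional_extensionality => c.
    by rewrite /ev /= map_polyC /horner_eval hornerC.
  have evl x : map_mx ev (map_mx polyC x) = map_mx j x :> 'rV_4.
    by rewrite -map_mx_comp evC.
  rewrite -[RHS]rz -[RHS]/(ev g) /g /G rmorphD rmorphM cv_map qv_map rp_map.
  rewrite evC map_mxD !map_mxZ !evl rmorph1.
  by congr (cv w j (_ + _ *: _) + qv w j (_ + _ *: _) * rp w j (_ + _ *: _) _);
    rewrite /ev /= map_polyX /horner_eval hornerX.
apply: (@sing K idfun 0 1); first by right; exact: oner_neq0.
have idm (z : 'rV[K]_4) : map_mx idfun z = z by apply/matrixP => a b; rewrite mxE.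
rewrite scale0r add0r scale1r idm.
have : g`_3 = 0 by apply/leq_sizeP; first exact: sg.
rewrite /g /G scale1r cvD cpZr cpZl cvZ qvD qpZr qvZ rpDl rpZl.
have Ec y : cv w polyC (map_mx polyC y) = (cv w id y)%:P by rewrite cv_map.
have Eq y : qv w polyC (map_mx polyC y) = (qv w id y)%:P by rewrite qv_map.
have Ecp y z : cp w polyC (map_mx polyC y) (map_mx polyC z) = (cp w id y z)%:P.
  by rewrite cp_map.
have Eqp y z : qp w polyC (map_mx polyC y) (map_mx polyC z) = (qp w id y z)%:P.
  by rewrite qp_map.
have Erp y z : rp w polyC (map_mx polyC y) (map_mx polyC z) = (rp w id y z)%:P.
  by rewrite rp_map.
by rewrite !Ec !Eq !Ecp !Eqp !Erp coef3_cubic !idm.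
Qed.

(** [rp gpt gtg] is the derivative of [ga], of degree at most 3, so divisibility forces it to be 0.
    Then [4 r (e2) = 0], the characteristic is 2, and [rv gtg] reduces to [r (e1)]. For a residual
    line [x], either [x.2 = 0] and [r (e1) = 0], or the polar form of [r] is zero on the plane and
    the line is double. *)
Lemma residual_line_ext : m != [::] -> ga %| rp w I gpt gtg -> rv w I gtg = 0.
Proof.
move=> mn dvd.
have rp0 : rp w I gpt gtg = 0.
  apply/eqP; apply: contraTT dvd => nz; rewrite gtNdvdp // size_ga rp_gpt_gtg.
  have c (x : K) := @dleC K x.
  have d1 := c (rp w id e0 e1); have d2 := c (2 * (rp w id e0 e2 + rv w id e1)).
  have d3 := c (3 * rp w id e1 e2); have d4 := c (4 * rv w id e2).
  rewrite ltnS -/(dle _ 3).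
  by dle_tac.
have cf (a b c d : K) : a%:P + 'X * b%:P + 'X ^+ 2 * c%:P + 'X ^+ 3 * d%:P = 0 ->
    [/\ a = 0, c = 0 & d = 0].
  move=> /polyP eq0; have := eq0 0; have := eq0 2; have := eq0 3.
  rewrite !coefD !coefXM !coefXnM !coefC /= !addr0 !add0r.
  by move=> -> -> ->.
have := rp0; rewrite rp_gpt_gtg => /cf [r01 r12 /eqP].
rewrite mulf_eq0 (negbTE r2) orbF => /eqP four0.
have two0 : 2 = 0 :> K.
  apply/eqP; have := mulf_eq0 (2 : K) 2; rewrite orbb => <-.
  by rewrite -natrM four0.
have {}r12 : rp w id e1 e2 = 0.
  have three : 3 = 1 :> K by rewrite -[RHS]add0r -two0; ring.
  by rewrite -r12 three mul1r.
have [x xm] : exists x, x \in m.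
  by case: m mn => [|x l] // _; exists x; rewrite mem_head.
have [a1 a2 a3] := hm xm.
rewrite !(rvD, rvZ, rpZr) in a1 a3.
rewrite !(rpDl, rpDr, rpZl, rpZr) rpxx r01 two0 mul0r (rpC _ _ e2 e1) r12 in a2.
rewrite !mulr0 !addr0 add0r in a2; rewrite r12 mulr0 addr0 in a3.
have [b0|bnz] := eqVneq x.2 0.
  have r11 : rv w id e1 = 0 by move: a3; rewrite b0 expr0n mul0r addr0.
  by rewrite rv_gtg r11 r12 four0 mul0r mulr0 !polyC0 !mulr0 !addr0.
have r02 : rp w id e0 e2 = 0 by apply: (mulfI bnz); rewrite a2 mulr0.
exfalso; have [b1 b2 b3] := hm xm.
apply: (@double_line_singular (e0 + x.1 *: e2) (e1 + x.2 *: e2)) => //.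
- by rewrite hvD hvZ h0 h2 mulr0 addr0.
- by rewrite hvD hvZ h1 h2 mulr0 addr0.
- move=> L j a b E; have [_ free] := fr j.
  have [|] := free a b (a * j x.1 + b * j x.2) 0; last by [].
  rewrite -[RHS]E !map_mxD !map_mxZ.
  by apply/matrixP => a' b'; rewrite !mxE; ring.
- have t0 z : 2 * z = 0 :> K by rewrite two0 mul0r.
  move=> e; rewrite !inE => /or3P [] /eqP ->;
  by rewrite !rpDl !rpZl ?rpxx ?t0 ?(rpC _ _ e2 e0) ?(rpC _ _ e2 e1)
    ?(rpC _ _ e1 e0) ?r01 ?r02 ?r12 !mulr0 ?addr0.
Qed.

End Residual.

Lemma conic_lines_count (s m : seq (K * K)) : uniq s -> uniq m ->
  (forall x, x \in s -> [/\ ga.[x.1] != 0,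
     (map_poly (horner_eval x.1) gf2).[x.2] = 0,
     (map_poly (horner_eval x.1) gf3).[x.2] = 0 &
     (map_poly (horner_eval x.1) gf4).[x.2] = 0]) ->
  (forall x, x \in m ->
     [/\ rv w id (e0 + x.1 *: e2) = 0,
         rp w id (e0 + x.1 *: e2) (e1 + x.2 *: e2) = 0 &
         rv w id (e1 + x.2 *: e2) = 0]) ->
  (size s + size m <= 48)%N.
Proof.
move=> us um hs hm; have [le48 le46] := transversal_count us hs.
have [->|mn] := eqVneq m [::]; first by rewrite addn0.
have le2 := residual_count um hm.
exact: leq_add (le46 (residual_line_ext hm mn)) le2.
Qed.

End Pencil.

(** * From polynomials to tensors *)

Section Tensors.

Variable k : fieldType.
Local Notation MP := {mpoly k[4]}.

(** The generic point: a form is its own value there, so evaluation and base change become instances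
    of naturality. *)
Definition genpt (R : nzRingType) : 'rV[{mpoly R[4]}]_4 := \row_i 'X_i.

Lemma dhomog_split (p : MP) d : p \is d.+1.-homog ->
  exists c : 'I_4 -> MP, (forall i, c i \is d.-homog) /\ p = \sum_i 'X_i * c i.
Proof.
move=> hp; rewrite (mpolyE p) big_seq.
elim/big_ind: _ => [|p1 p2 [c1 [h1 ->]] [c2 [h2 ->]]|m mp].
- exists (fun _ => 0); split=> [i|]; first exact: rpred0.
  by rewrite big1 // => i _; rewrite mulr0.
- exists (fun i => c1 i + c2 i); split=> [i|]; first by rewrite rpredD.
  by rewrite -big_split; apply: eq_bigr => i _; rewrite mulrDr.
have md : mdeg m = d.+1 := dhomog_mf hp mp.
have [i mi] : exists i, (0 < m i)%N.
  have [i mi|m0] := pickP (fun i : 'I_4 => 0 < m i)%N; first by exists i.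
  move: md; rewrite mdegE big1 // => i _; apply/eqP.
  by rewrite -leqn0 leqNgt m0.
have le : (U_(i) <= m)%MM.
  by apply/mnm_lepP => j; rewrite mnmE; case: eqP => [<-|].
exists (fun j => if j == i then p@_m *: 'X_[m - U_(i)] else 0); split=> [j|].
  case: ifP => _; last exact: rpred0.
  apply/rpredZ; rewrite dhomogX; apply/eqP.
  by have := congr1 mdeg (submK le); rewrite mdegD mdeg1 md addn1 => -[].
rewrite (bigD1 i) //= eqxx big1 ?addr0 => [|j /negbTE ->]; last by rewrite mulr0.
by rewrite -scalerAr -mpolyXD addmC submK.
Qed.

Lemma dhomog_const (p : MP) : p \is 0.-homog -> exists c, p = c%:MP.
Proof.
move=> hp; rewrite (mpolyE p) big_seq.
elim/big_ind: _ => [|p1 p2 [c1 ->] [c2 ->]|m mp].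
- by exists 0; rewrite mpolyC0.
- by exists (c1 + c2); rewrite mpolyCD.
have /eqP : mdeg m = 0%N := dhomog_mf hp mp.
rewrite mdeg_eq0 => /eqP ->; exists p@_0.
by rewrite mpolyX0 alg_mpolyC.
Qed.

Lemma tensor1 (p : MP) : p \is 1.-homog -> exists h, p = lin (@mpolyC 4 k) h (genpt k).
Proof.
move=> /dhomog_split [c [hc ->]].
have /fin_all_exists [h hE] : forall i, exists a, c i = a%:MP.
  by move=> i; apply: dhomog_const.
by exists h; apply: eq_bigr => i _; rewrite mxE hE mulrC.
Qed.

Lemma tensor2 (p : MP) : p \is 2.-homog ->
  exists q, p = bil (@mpolyC 4 k) q (genpt k) (genpt k).
Proof.
move=> /dhomog_split [c [hc ->]].
have /fin_all_exists [q qE] : forall i, exists a, c i = lin (@mpolyC 4 k) a (genpt k).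
  by move=> i; apply: tensor1.
by exists q; apply: eq_bigr => i _; rewrite mxE qE.
Qed.

Lemma tensor3 (p : MP) : p \is 3.-homog ->
  exists c, p = tri (@mpolyC 4 k) c (genpt k) (genpt k) (genpt k).
Proof.
move=> /dhomog_split [c [hc ->]].
have /fin_all_exists [q qE] : forall i,
    exists a, c i = bil (@mpolyC 4 k) a (genpt k) (genpt k).
  by move=> i; apply: tensor2.
by exists q; apply: eq_bigr => i _; rewrite mxE qE.
Qed.

Lemma pihomogM (a h : MP) d e : h \is e.-homog ->
  pihomog mdeg (d + e) (a * h) = pihomog mdeg d a * h.
Proof.
move=> hh; pose n := maxn (mmeasure mdeg a) d.+1.
rewrite {1}(pihomog_partitionE (mf := mdeg) (k := n) (p := a)) ?leq_maxl //.
rewrite mulr_suml raddf_sum /=.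
have dn : (d < n)%N by rewrite leq_max leqnn orbT.
rewrite (bigD1 (Ordinal dn)) //= big1 ?addr0 => [|i ne].
  by rewrite pihomog_dE //; apply: dhomogM => //; apply: pihomogP.
apply: (@pihomog_ne0 _ _ _ (i + e)%N); last first.
  by apply: dhomogM => //; apply: pihomogP.
by apply: contraNneq ne => E; apply/eqP/val_inj => /=; lia.
Qed.

(** The coefficients given by ideal membership may be inhomogeneous; the part of degree 4 replaces
    them by their components of degree 3 and 2. *)
Lemma conic_equation (h q f : MP) : f \is 4.-homog -> h \is 1.-homog ->
  q \is 2.-homog -> in_ideal [:: h; q] f ->
  exists w : forms k, [/\ h = hv w (@mpolyC 4 k) (genpt k),
    q = qv w (@mpolyC 4 k) (genpt k) & f = Fv w (@mpolyC 4 k) (genpt k)].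
Proof.
move=> hf hh hq [a fE].
rewrite big_ord_recl big_ord1 /= in fE.
have fE' : f = h * pihomog mdeg 3 (a ord0) + q * pihomog mdeg 2 (a (lift ord0 ord0)).
  rewrite -{1}(pihomog_dE hf) {1}fE raddfD /= -[4%N]/(3 + 1)%N (pihomogM _ _ hh).
  by rewrite -[(3 + 1)%N]/(2 + 2)%N (pihomogM _ _ hq) [h * _]mulrC [q * _]mulrC.
have [th hE] := tensor1 hh; have [tq qE] := tensor2 hq.
have [tr rE] := tensor2 (pihomogP mdeg 2 (a (lift ord0 ord0))).
have [tc cE] := tensor3 (pihomogP mdeg 3 (a ord0)).
by exists (Forms th tq tr tc); split=> //; rewrite fE' rE cE hE qE.
Qed.

End Tensors.

Section Values.

Variables (k K : fieldType) (phi : {rmorphism k -> K}) (w : forms k).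

Lemma map_genpt : map_mx (map_mpoly phi) (genpt k) = genpt K.
Proof. by apply/rowP => i; rewrite !mxE map_mpolyX. Qed.

Lemma meval_genpt (x : 'rV[K]_4) : map_mx (meval (x 0)) (genpt K) = x.
Proof. by apply/rowP => i; rewrite !mxE mevalXU. Qed.

Lemma map_mpolyC_comp : map_mpoly phi \o @mpolyC 4 k = @mpolyC 4 K \o phi.
Proof. by apply: functional_extensionality => c /=; rewrite map_mpolyC. Qed.

Lemma meval_mpolyC_comp (x : 'rV[K]_4) : meval (x 0) \o (@mpolyC 4 K \o phi) = phi.
Proof. by apply: functional_extensionality => c /=; rewrite mevalC. Qed.

Lemma hv_meval (x : 'rV[K]_4) :
  (map_mpoly phi (hv w (@mpolyC 4 k) (genpt k))).@[x 0] = hv w phi x.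
Proof. by rewrite !hv_map map_mpolyC_comp meval_mpolyC_comp map_genpt meval_genpt. Qed.

Lemma qv_meval (x : 'rV[K]_4) :
  (map_mpoly phi (qv w (@mpolyC 4 k) (genpt k))).@[x 0] = qv w phi x.
Proof. by rewrite !qv_map map_mpolyC_comp meval_mpolyC_comp map_genpt meval_genpt. Qed.

Lemma Fv_meval (x : 'rV[K]_4) :
  (map_mpoly phi (Fv w (@mpolyC 4 k) (genpt k))).@[x 0] = Fv w phi x.
Proof. by rewrite !Fv_map map_mpolyC_comp meval_mpolyC_comp map_genpt meval_genpt. Qed.

Local Notation I := (@mpolyC 4 K \o phi).
Local Notation X := (genpt K).

Section Derivative.

Variable i : 'I_4.
Let e : 'rV[{mpoly K[4]}]_4 := map_mx (@mpolyC 4 K) (delta_mx 0 i).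

Lemma mderiv_genpt j : mderiv i (X 0 j) = e 0 j.
Proof.
rewrite !mxE mderivX mnm1E /= eq_sym; case: eqP => [->|_] /=.
  by rewrite scale1r mpolyC1 -[RHS]mpolyX0; congr 'X_[_]; apply/mnmP => l;
     rewrite mnmBE subnn mnm0E.
by rewrite scale0r mpolyC0.
Qed.

Lemma mderiv_lin h : mderiv i (lin I h X) = lin I h e.
Proof.
rewrite raddf_sum; apply: eq_bigr => j _ /=.
by rewrite mderiv_mulC mderiv_genpt.
Qed.

Lemma mderiv_bil q : mderiv i (bil I q X X) = bil I q e X + bil I q X e.
Proof.
rewrite raddf_sum -big_split; apply: eq_bigr => j _ /=.
by rewrite mderivM mderiv_lin mderiv_genpt.
Qed.

Lemma mderiv_tri c : mderiv i (tri I c X X X) =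
  tri I c e X X + (tri I c X e X + tri I c X X e).
Proof.
rewrite raddf_sum -[X in _ + X]big_split -[RHS]big_split; apply: eq_bigr => j _ /=.
by rewrite mderivM mderiv_bil mderiv_genpt mulrDr.
Qed.

Lemma mderiv_Fv : mderiv i (Fv w I X) = dFv w I X e.
Proof.
have cE : mderiv i (cv w I X) = cp w I X e.
  by rewrite [LHS]mderiv_tri addrA -addrC addrA [RHS]addrAC.
have qE : mderiv i (qv w I X) = qp w I X e.
  exact: etrans (mderiv_bil _) (addrC _ _).
have rE : mderiv i (rv w I X) = rp w I X e.
  exact: etrans (mderiv_bil _) (addrC _ _).
have hE : mderiv i (hv w I X) = hv w I e by exact: mderiv_lin.
by rewrite /Fv mderivD !mderivM cE qE rE hE /dFv !addrA.
Qed.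

End Derivative.

Lemma mderiv_meval (x : 'rV[K]_4) i :
  (mderiv i (map_mpoly phi (Fv w (@mpolyC 4 k) (genpt k)))).@[x 0] =
  dFv w phi x (delta_mx 0 i).
Proof.
rewrite Fv_map map_mpolyC_comp map_genpt mderiv_Fv dFv_map meval_mpolyC_comp.
rewrite meval_genpt; congr dFv.
have E : meval (x 0) \o @mpolyC 4 K =1 id by move=> c; apply: mevalC.
by rewrite -map_mx_comp; apply/matrixP => a b; rewrite mxE E.
Qed.

End Values.

Lemma smooth_quartic_forms (k : fieldType) (w : forms k) :
  smooth_quartic (Fv w (@mpolyC 4 k) (genpt k)) -> smooth_forms w.
Proof.
move=> [_ sm] L j x xnz Fx dF.
have [|i] := sm L j x xnz; first by rewrite Fv_meval.
by rewrite mderiv_meval dF eqxx.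
Qed.

Lemma frame_dual (L : fieldType) (e0 e1 e2 e3 : 'rV[L]_4) :
  frame e0 e1 e2 e3 -> exists y0 y1 y2 y3 : 'I_4 -> L,
  (forall (R : comNzRingType) (i : {rmorphism L -> R}) (x : 'rV[R]_4),
     x = lin i y0 x *: map_mx i e0 + lin i y1 x *: map_mx i e1
       + lin i y2 x *: map_mx i e2 + lin i y3 x *: map_mx i e3) /\
  [/\ [/\ lin id y0 e0 = 1, lin id y1 e0 = 0 & lin id y2 e0 = 0],
      [/\ lin id y0 e1 = 0, lin id y1 e1 = 1 & lin id y2 e1 = 0] &
      [/\ lin id y0 e2 = 0, lin id y1 e2 = 0 & lin id y2 e2 = 1]].
Proof.
move=> fr; have [span free] := fr L idfun.
have idm (x : 'rV[L]_4) : map_mx idfun x = x by apply/matrixP => a b; rewrite mxE.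
rewrite !idm in span free.
have /fin_all_exists [y yE] : forall m : 'I_4, exists v : 'rV[L]_4,
    delta_mx 0 m = v 0 ord0 *: e0 + v 0 (lift ord0 ord0) *: e1
    + v 0 (lift ord0 (lift ord0 ord0)) *: e2
    + v 0 (lift ord0 (lift ord0 (lift ord0 ord0))) *: e3.
  move=> m; have [a [b [c [d ->]]]] := span (delta_mx 0 m).
  by exists (\row_j [:: a; b; c; d]`_j); rewrite !mxE.
pose yy j m := y m 0 j.
exists (yy ord0), (yy (lift ord0 ord0)), (yy (lift ord0 (lift ord0 ord0))),
  (yy (lift ord0 (lift ord0 (lift ord0 ord0)))).
have dual (R : comNzRingType) (i : {rmorphism L -> R}) (x : 'rV[R]_4) :
    x = lin i (yy ord0) x *: map_mx i e0 + lin i (yy (lift ord0 ord0)) x *: map_mx i e1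
       + lin i (yy (lift ord0 (lift ord0 ord0))) x *: map_mx i e2
       + lin i (yy (lift ord0 (lift ord0 (lift ord0 ord0)))) x *: map_mx i e3.
  rewrite {1}(row_sum_delta x) !scaler_suml -!big_split /=.
  apply: eq_bigr => m _; rewrite -(map_delta_mx i) yE !map_mxD !map_mxZ.
  by apply/matrixP => a b; rewrite !mxE /yy; ring.
split=> //.
have uniq_coef (x : 'rV[L]_4) a b c d :
    x = a *: e0 + b *: e1 + c *: e2 + d *: e3 ->
    [/\ lin id (yy ord0) x = a, lin id (yy (lift ord0 ord0)) x = b &
      lin id (yy (lift ord0 (lift ord0 ord0))) x = c].
  move=> xE; have := dual L idfun x; rewrite !idm; set u0 := lin _ _ _.
  set u1 := lin _ _ _; set u2 := lin _ _ _; set u3 := lin _ _ _ => xE'.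
  have [|/subr0_eq h0 /subr0_eq h1 /subr0_eq h2 _] :=
      free (u0 - a) (u1 - b) (u2 - c) (u3 - d).
    rewrite -(subrr x) {1}xE' xE.
    by apply/matrixP => i j; rewrite !mxE; ring.
  by split.
split.
- have [|-> -> -> //] := uniq_coef e0 1 0 0 0; first by rewrite ?scale1r ?scale0r ?addr0.
- have [|-> -> -> //] := uniq_coef e1 0 1 0 0; first by rewrite ?scale1r ?scale0r ?add0r ?addr0.
- have [|-> -> -> //] := uniq_coef e2 0 0 1 0; first by rewrite ?scale1r ?scale0r ?add0r ?addr0.
Qed.

Section Combinations.

Variables (K : Type) (w : forms K) (R : comNzRingType) (i : K -> R).

Lemma hv_comb (a b c d : R) x y z t :
  hv w i (a *: x + b *: y + c *: z + d *: t) =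
  a * hv w i x + b * hv w i y + c * hv w i z + d * hv w i t.
Proof. by rewrite !hvD !hvZ. Qed.

Lemma qv_comb (a b c d : R) x y z t :
  qv w i (a *: x + b *: y + c *: z + d *: t) =
  a ^+ 2 * qv w i x + b ^+ 2 * qv w i y + c ^+ 2 * qv w i z
  + a * b * qp w i x y + a * c * qp w i x z + b * c * qp w i y z
  + d * (a * qp w i x t + b * qp w i y t + c * qp w i z t + d * qv w i t).
Proof. by rewrite !qvD !qvZ !qpDl !qpZl !qpZr; ring. Qed.

Lemma qv_comb0 (a b c : R) x y z t :
  qv w i x = 0 -> qv w i y = 0 -> qv w i z = 0 -> qp w i x y = 0 ->
  qp w i x z = 0 -> qp w i y z = 0 ->
  qv w i (a *: x + b *: y + c *: z + 0 *: t) = 0.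
Proof.
by move=> h1 h2 h3 h4 h5 h6; rewrite qv_comb h1 h2 h3 h4 h5 h6 mul0r !mulr0 !addr0.
Qed.

End Combinations.

Lemma coef1_comb (L : fieldType) (f0 f1 f2 l0 l1 l2 q : L) (b : {poly L}) :
  f0%:P * ('X * l0%:P) + f1%:P * ('X * l1%:P) + f2%:P * ('X * l2%:P) =
  b * ('X ^+ 2 * q%:P) -> f0 * l0 + f1 * l1 + f2 * l2 = 0.
Proof.
move=> E; have : 'X * (f0 * l0 + f1 * l1 + f2 * l2)%:P = 'X ^+ 2 * (b * q%:P).
  by rewrite mulrCA -E !(polyCD, polyCM); ring.
move=> /(congr1 (fun p : {poly L} => p`_1)).
by rewrite coefXM coefXnM coefC.
Qed.

(* On the plane [h = 0], the form [q] is not a product of two linear forms. *)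
Definition irreducible_forms (K : fieldType) (w : forms K) :=
  forall (L : fieldType) (j : {rmorphism K -> L}) (e0 e1 e2 e3 : 'rV[L]_4)
    (f0 f1 f2 g0 g1 g2 : L), frame e0 e1 e2 e3 ->
    [/\ hv w j e0 = 0, hv w j e1 = 0 & hv w j e2 = 0] ->
    [/\ qv w j e0 = f0 * g0, qv w j e1 = f1 * g1 & qv w j e2 = f2 * g2] ->
    [/\ qp w j e0 e1 = f0 * g1 + f1 * g0, qp w j e0 e2 = f0 * g2 + f2 * g0 &
      qp w j e1 e2 = f1 * g2 + f2 * g1] -> False.

(** * From primality of the ideal of the conic to irreducibility of its restricted equation *)

Section Irreducible.

Variables (k : fieldType) (w : forms k).

Local Notation gh := (hv w (@mpolyC 4 k) (genpt k)).
Local Notation gq := (qv w (@mpolyC 4 k) (genpt k)).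

Hypothesis h_neq0 : exists x, hv w id x != 0.
Hypothesis q_notin : ~ in_ideal [:: gh] gq.
Hypothesis irr : geometrically_irreducible [:: gh; gq].

Section Extension.

Variables (L : fieldType) (j : {rmorphism k -> L}).
Variables e0 e1 e2 e3 : 'rV[L]_4.
Hypothesis fr : frame e0 e1 e2 e3.
Hypothesis h0 : hv w j e0 = 0.
Hypothesis h1 : hv w j e1 = 0.
Hypothesis h2 : hv w j e2 = 0.

Local Notation I := (@mpolyC 4 L \o j).
Local Notation X := (genpt L).

Lemma hv_e3 : hv w j e3 != 0.
Proof.
have [x nz] := h_neq0; have [span _] := fr idfun.
have [y0 [y1 [y2 [y3 xE]]]] := span (map_mx j x).
have idm (v : 'rV[L]_4) : map_mx idfun v = v by apply/matrixP => a b; rewrite mxE.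
rewrite !idm in xE.
apply: contra nz => /eqP h3; rewrite -(fmorph_eq0 j) hv_map xE.
by rewrite !hvD !hvZ h0 h1 h2 h3 !mulr0 !addr0.
Qed.

(** Project the generic point to [Z] in the plane, along a vector [c3] with [h (c3) = 1]. If [q]
    vanishes on the plane then [q (Z) = 0], and expanding [q (Z + h c3)] exhibits [q] as a multiple
    of [h]. Vanishing of [q (Z)] is checked over [L], as base change is injective. *)
Lemma q_not_zero_on_plane :
  [/\ qv w j e0 = 0, qv w j e1 = 0 & qv w j e2 = 0] ->
  [/\ qp w j e0 e1 = 0, qp w j e0 e2 = 0 & qp w j e1 e2 = 0] -> False.
Proof.
move=> [q0 q1 q2] [q01 q02 q12]; apply: q_notin.
have [x nz] := h_neq0; pose w3 := (hv w id x)^-1 *: x.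
have hw3 : hv w id w3 = 1 by rewrite hvZ mulVf.
pose c3 := map_mx (@mpolyC 4 k) w3; pose Z := genpt k - gh *: c3.
have hc3 : hv w (@mpolyC 4 k) c3 = 1.
  have -> : hv w (@mpolyC 4 k) c3 = (hv w id w3)%:MP by rewrite hv_map.
  by rewrite hw3 mpolyC1.
have hZ : hv w (@mpolyC 4 k) Z = 0.
  by rewrite /Z -scaleNr hvD hvZ hc3 mulr1 subrr.
suff qZ : qv w (@mpolyC 4 k) Z = 0.
  exists (fun _ => qp w (@mpolyC 4 k) Z c3 + gh * qv w (@mpolyC 4 k) c3).
  rewrite big_ord1 /=.
  have {1}-> : genpt k = Z + gh *: c3 by rewrite /Z subrK.
  by rewrite qvD qvZ qpZr qZ; ring.
have inj (p : {mpoly k[4]}) : map_mpoly j p = 0 -> p = 0.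
  move=> p0; apply/mpolyP => m; apply: (fmorph_inj j).
  by rewrite -mcoeff_map_mpoly p0 !mcoeff0 rmorph0.
apply: inj; rewrite qv_map map_mpolyC_comp.
have := congr1 (map_mpoly j) hZ; rewrite hv_map map_mpolyC_comp rmorph0.
set V := map_mx _ Z => hV.
have [y0 [y1 [y2 [y3 [dual _]]]]] := frame_dual fr.
have := dual {mpoly L[4]} (@mpolyC 4 L) V.
have Eh e : hv w I (map_mx (@mpolyC 4 L) e) = (hv w j e)%:MP by rewrite hv_map.
have Eq e : qv w I (map_mx (@mpolyC 4 L) e) = (qv w j e)%:MP by rewrite qv_map.
have Eqp e e' : qp w I (map_mx (@mpolyC 4 L) e) (map_mx (@mpolyC 4 L) e')
  = (qp w j e e')%:MP by rewrite qp_map.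
move=> VE; have y30 : lin (@mpolyC 4 L) y3 V = 0.
  move: hV; rewrite VE hv_comb !Eh h0 h1 h2 -VE => E; apply/eqP.
  move/eqP: E; rewrite !mulr0 !add0r mulf_eq0 mpolyC_eq0 (negbTE hv_e3) orbF.
  by [].
by rewrite VE y30 qv_comb0 // ?Eq ?Eqp ?q0 ?q1 ?q2 ?q01 ?q02 ?q12 mpolyC0.
Qed.

(** Substitute ['X *: x] with [hv x = 0]: elements of the ideal become multiples of ['X ^+ 2], a
    linear form becomes ['X] times its value at [x]. So a linear form in the ideal vanishes on the
    plane. *)
Lemma linear_not_in_ideal (y0 y1 y2 : 'I_4 -> L) (f0 f1 f2 : L) :
  [/\ [/\ lin id y0 e0 = 1, lin id y1 e0 = 0 & lin id y2 e0 = 0],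
      [/\ lin id y0 e1 = 0, lin id y1 e1 = 1 & lin id y2 e1 = 0] &
      [/\ lin id y0 e2 = 0, lin id y1 e2 = 0 & lin id y2 e2 = 1]] ->
  in_ideal [:: map_mpoly j gh; map_mpoly j gq]
    (f0%:MP * lin (@mpolyC 4 L) y0 X + f1%:MP * lin (@mpolyC 4 L) y1 X
     + f2%:MP * lin (@mpolyC 4 L) y2 X) ->
  [/\ f0 = 0, f1 = 0 & f2 = 0].
Proof.
move=> dual [a]; rewrite big_ord_recl big_ord1 /= => aE.
have on_h (x : 'rV[L]_4) : hv w j x = 0 ->
    f0 * lin id y0 x + f1 * lin id y1 x + f2 * lin id y2 x = 0.
  move=> hx.
  pose ev : {rmorphism {mpoly L[4]} -> {poly L}} :=
    mmap polyC (fun l => 'X * (x 0 l)%:P).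
  have evC : ev \o @mpolyC 4 L = polyC.
    by apply: functional_extensionality => c; rewrite /= mmapC.
  have evX : map_mx ev X = 'X *: map_mx polyC x.
    by apply/rowP => l; rewrite !mxE /= mmapX mmap1U.
  have evI : ev \o (map_mpoly j \o @mpolyC 4 k) = polyC \o j.
    by rewrite map_mpolyC_comp compA evC.
  have El h : ev (lin (@mpolyC 4 L) h X) = 'X * (lin id h x)%:P.
    rewrite lin_map evC evX linZ; congr (_ * _).
    by rewrite [RHS](lin_map id (polyC : {rmorphism L -> {poly L}})).
  have := congr1 ev aE; rewrite !rmorphD !rmorphM !El.
  have evfC c : ev c%:MP = c%:P by rewrite /= mmapC.
  rewrite !evfC.
  have -> : ev (map_mpoly j gh) = 0.
    rewrite !hv_map evI map_genpt evX hvZ.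
    have -> : hv w (polyC \o j) (map_mx polyC x) = (hv w j x)%:P by rewrite hv_map.
    by rewrite hx mulr0.
  have -> : ev (map_mpoly j gq) = 'X ^+ 2 * (qv w j x)%:P.
    by rewrite !qv_map evI map_genpt evX qvZ.
  by rewrite mulr0 add0r => /coef1_comb.
case: dual => [[d00 d01 d02] [d10 d11 d12] [d20 d21 d22]].
split.
- by have := on_h _ h0; rewrite d00 d01 d02 mulr1 !mulr0 !addr0.
- by have := on_h _ h1; rewrite d10 d11 d12 mulr1 !mulr0 addr0 add0r.
- by have := on_h _ h2; rewrite d20 d21 d22 mulr1 !mulr0 !add0r.
Qed.

End Extension.

(** A factorization on the plane puts [F * G] in the ideal, hence one of these linear forms; its
    coefficients are then 0 and [q] vanishes on the plane. *)
Lemma irreducible_formsP : irreducible_forms w.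
Proof.
move=> L j e0 e1 e2 e3 f0 f1 f2 g0 g1 g2 fr [h0 h1 h2] [q0 q1 q2] [q01 q02 q12].
have h3 := hv_e3 fr h0 h1 h2.
have [y0 [y1 [y2 [y3 [dual d]]]]] := frame_dual fr.
pose Y y := lin (@mpolyC 4 L) y (genpt L).
pose F := f0%:MP * Y y0 + f1%:MP * Y y1 + f2%:MP * Y y2.
pose G := g0%:MP * Y y0 + g1%:MP * Y y1 + g2%:MP * Y y2.
pose I := @mpolyC 4 L \o j.
have XE := dual {mpoly L[4]} (@mpolyC 4 L) (genpt L).
rewrite -!/(Y _) in XE.
have Eh e : hv w I (map_mx (@mpolyC 4 L) e) = (hv w j e)%:MP by rewrite hv_map.
have Eq e : qv w I (map_mx (@mpolyC 4 L) e) = (qv w j e)%:MP by rewrite qv_map.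
have Eqp e e' : qp w I (map_mx (@mpolyC 4 L) e) (map_mx (@mpolyC 4 L) e')
  = (qp w j e e')%:MP by rewrite qp_map.
have hE : map_mpoly j gh = Y y3 * (hv w j e3)%:MP.
  rewrite hv_map map_mpolyC_comp map_genpt XE hv_comb !Eh h0 h1 h2.
  by rewrite !mulr0 !add0r.
pose R := Y y0 * (qp w j e0 e3)%:MP + Y y1 * (qp w j e1 e3)%:MP
  + Y y2 * (qp w j e2 e3)%:MP + Y y3 * (qv w j e3)%:MP.
have qE : map_mpoly j gq = F * G + Y y3 * R.
  rewrite qv_map map_mpolyC_comp map_genpt XE qv_comb !Eq !Eqp.
  rewrite q0 q1 q2 q01 q02 q12 /F /G /R.
  move: (qp w j e0 e3) (qp w j e1 e3) (qp w j e2 e3) (qv w j e3) => r0 r1 r2 r3.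
  by move: (Y y0) (Y y1) (Y y2) (Y y3) => *; rewrite !(mpolyCD, mpolyCM); ring.
have Y3E : Y y3 = ((hv w j e3)^-1)%:MP * map_mpoly j gh.
  by rewrite hE mulrCA -mpolyCM mulVf // mulr1.
have FG : in_ideal [:: map_mpoly j gh; map_mpoly j gq] (F * G).
  exists (fun i => if i == ord0 then - (((hv w j e3)^-1)%:MP * R) else 1).
  rewrite big_ord_recl big_ord1 /= mul1r qE {1}Y3E.
  by move: (_^-1%:MP) => *; ring.
have [_ /(_ _ _ FG)] := irr j.
have lin0 a b c := linear_not_in_ideal (f0 := a) (f1 := b) (f2 := c) h0 h1 h2 d.
case=> /lin0 [z0 z1 z2]; apply: (q_not_zero_on_plane fr h0 h1 h2);
  by rewrite ?q0 ?q1 ?q2 ?q01 ?q02 ?q12 z0 z1 z2 ?mul0r ?mulr0 ?addr0.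
Qed.

End Irreducible.

(** * Normal form of a conic *)

Definition map_forms (k K : Type) (f : k -> K) (w : forms k) : forms K :=
  Forms (fun a => f (th w a)) (fun a b => f (tq w a b))
    (fun a b => f (tr w a b)) (fun a b c => f (tc w a b c)).

(** The conic is first brought to the form [c (x0 x2 - x1^2)]; moving the constant from [q] to [r]
    leaves the surface unchanged. *)
Definition scale_forms (K : fieldType) (c : K) (w : forms K) : forms K :=
  Forms (th w) (fun a b => c^-1 * tq w a b) (fun a b => c * tr w a b) (tc w).

Section Scale.

Variables (K : fieldType) (c : K) (w : forms K) (R : comNzRingType).
Variable i : {rmorphism K -> R}.
Local Notation w' := (scale_forms c w).

Lemma bil_scale (a : K) q (x y : 'rV[R]_4) :
  bil i (fun m n => a * q m n) x y = i a * bil i q x y.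
Proof.
rewrite [RHS]mulr_sumr; apply: eq_bigr => m _.
rewrite mulrCA; congr (_ * _); rewrite [RHS]mulr_sumr; apply: eq_bigr => n _.
by rewrite rmorphM mulrA.
Qed.

Lemma qv_scale x : qv w' i x = i c^-1 * qv w i x.
Proof. exact: bil_scale. Qed.
Lemma rv_scale x : rv w' i x = i c * rv w i x.
Proof. exact: bil_scale. Qed.
Lemma qp_scale x y : qp w' i x y = i c^-1 * qp w i x y.
Proof. by rewrite /qp !bil_scale mulrDr. Qed.
Lemma rp_scale x y : rp w' i x y = i c * rp w i x y.
Proof. by rewrite /rp !bil_scale mulrDr. Qed.

Hypothesis cnz : c != 0.

Lemma Fv_scale x : Fv w' i x = Fv w i x.
Proof.
by rewrite /Fv qv_scale rv_scale mulrACA -rmorphM mulVf // rmorph1 mul1r.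
Qed.

Lemma dFv_scale x y : dFv w' i x y = dFv w i x y.
Proof.
have E a b : (i c^-1 * a) * (i c * b) = a * b.
  by rewrite mulrACA -rmorphM mulVf // rmorph1 mul1r.
by rewrite /dFv qv_scale rv_scale qp_scale rp_scale !E.
Qed.

End Scale.

Lemma smooth_scale (K : fieldType) (c : K) (w : forms K) :
  c != 0 -> smooth_forms w -> smooth_forms (scale_forms c w).
Proof.
move=> cnz sm L j x xnz Fx dF; apply: (sm L j x xnz).
  by rewrite -(Fv_scale w j cnz).
by move=> y; rewrite -(dFv_scale w j cnz).
Qed.

Lemma smooth_map (k K : fieldType) (f : {rmorphism k -> K}) (w : forms k) :
  smooth_forms w -> smooth_forms (map_forms f w).
Proof. by move=> sm L j x; apply: (sm L (j \o f) x). Qed.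

Lemma irreducible_map (k K : fieldType) (f : {rmorphism k -> K}) (w : forms k) :
  irreducible_forms w -> irreducible_forms (map_forms f w).
Proof. by move=> irr L j; apply: (irr L (j \o f)). Qed.

Lemma frame_map (K L : fieldType) (j : {rmorphism K -> L}) (e0 e1 e2 e3 : 'rV[K]_4) :
  frame e0 e1 e2 e3 -> frame (map_mx j e0) (map_mx j e1) (map_mx j e2) (map_mx j e3).
Proof. by move=> fr M l; rewrite -!map_mx_comp; apply: (fr M (l \o j)). Qed.

Section NormalForm.

Variables (K : fieldType) (w : forms K).
Hypothesis h_neq0 : exists x, hv w id x != 0.
Hypothesis irr : irreducible_forms w.
Variable P : 'rV[K]_4.
Hypothesis Pnz : P != 0.
Hypothesis hP : hv w id P = 0.
Hypothesis qP : qv w id P = 0.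

Local Notation span e0 e1 e2 e3 := (forall x : 'rV[K]_4, exists y0 y1 y2 y3,
  x = y0 *: e0 + y1 *: e1 + y2 *: e2 + y3 *: e3).

Lemma hv_sum (F : 'I_4 -> 'rV[K]_4) :
  hv w id (\sum_m F m) = \sum_m hv w id (F m).
Proof.
apply: (big_morph _ (hvD w id)).
by rewrite -(scale0r (0 : 'rV[K]_4)) hvZ mul0r.
Qed.

(** The standard basis is projected to the plane along [w3], a multiple of [d j]; this kills index
    [j]. An index [i] where [P] has a nonzero coordinate is exchanged for [P]. *)
Lemma frame_through : exists w0 w1 w3,
  [/\ hv w id w0 = 0, hv w id w1 = 0, hv w id w3 = 1 & span w0 w1 P w3].
Proof.
pose d m : 'rV[K]_4 := delta_mx 0 m.
have [j hj] : exists j, hv w id (d j) != 0.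
  have [x nz] := h_neq0; apply: NNPP => none; case/eqP: nz.
  rewrite (row_sum_delta x) hv_sum big1 // => m _; rewrite hvZ.
  have [->|nz'] := eqVneq (hv w id (d m)) 0; first by rewrite mulr0.
  by case: none; exists m.
pose w3 := (hv w id (d j))^-1 *: d j.
have hw3 : hv w id w3 = 1 by rewrite hvZ mulVf.
pose e m := d m - hv w id (d m) *: w3.
have he m : hv w id (e m) = 0.
  by rewrite /e -scaleNr hvD hvZ hw3 mulr1 subrr.
have ej : e j = 0 by rewrite /e /w3 scalerA divff // scale1r subrr.
have xE (x : 'rV[K]_4) : x = \sum_m x 0 m *: e m + hv w id x *: w3.
  have hx : hv w id x = \sum_m x 0 m * hv w id (d m).
    rewrite {1}(row_sum_delta x) hv_sum; apply: eq_bigr => m _.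
    by rewrite hvZ.
  have -> : \sum_m x 0 m *: e m = x - hv w id x *: w3.
    rewrite {2}(row_sum_delta x) hx scaler_suml -sumrB; apply: eq_bigr => m _.
    by rewrite scalerBr scalerA.
  by rewrite subrK.
have [i [Pi ij]] : exists i, P 0 i != 0 /\ i != j.
  apply: NNPP => none; case/eqP: Pnz; rewrite (xE P) hP scale0r addr0.
  rewrite big1 // => m _; have [->|mj] := eqVneq m j; first by rewrite ej scaler0.
  have [->|nz] := eqVneq (P 0 m) 0; first by rewrite scale0r.
  by case: none; exists m.
have /cards2P [a [b [ab AE]]] : #|~: [set i; j]| == 2.
  by rewrite -(eqn_add2l #|[set i; j]|) cardsC cards2 ij card_ord.
have mab m : (m == a) || (m == b) = ~~ ((m == i) || (m == j)).
  by have := congr1 (fun A : {set 'I_4} => m \in A) AE; rewrite !inE => <-.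
have sum4 (F : 'I_4 -> 'rV[K]_4) : \sum_m F m = F a + F b + F i + F j.
  rewrite (bigD1 a) //= (bigD1 b) 1?eq_sym //= (bigD1 i) /=; last first.
    have := mab i; rewrite eqxx /= => /norP [ia ib]; by rewrite ia ib.
  rewrite (bigD1 j) /=; last first.
    have := mab j; rewrite eqxx orbT /= => /norP [ia ib].
    by rewrite ia ib eq_sym ij.
  rewrite big1 ?addr0 ?addrA // => m /andP [/andP [/andP [ma mb] mi] mj].
  by have := mab m; rewrite (negbTE ma) (negbTE mb) (negbTE mi) (negbTE mj).
exists (e a), (e b), w3; split=> // x.
have PE : P = P 0 a *: e a + P 0 b *: e b + P 0 i *: e i.
  by rewrite {1}(xE P) hP scale0r addr0 sum4 ej scaler0 addr0.
have eiE : e i = (P 0 i)^-1 *: (P - P 0 a *: e a - P 0 b *: e b).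
  have -> : P - P 0 a *: e a - P 0 b *: e b = P 0 i *: e i.
    by rewrite {1}PE; apply/matrixP => u v; rewrite !mxE; ring.
  by rewrite scalerA mulVf // scale1r.
exists (x 0 a - x 0 i * (P 0 i)^-1 * P 0 a), (x 0 b - x 0 i * (P 0 i)^-1 * P 0 b),
  (x 0 i * (P 0 i)^-1), (hv w id x).
rewrite {1}(xE x) sum4 ej scaler0 addr0 eiE.
move: (x 0 a) (x 0 b) (x 0 i) (P 0 a) (P 0 b) (P 0 i)^-1 => *.
by apply/matrixP => u v; rewrite !mxE; ring.
Qed.

Definition normal_frame (e0 e1 e2 e3 : 'rV[K]_4) (c : K) :=
  [/\ frame e0 e1 e2 e3,
      [/\ hv w id e0 = 0, hv w id e1 = 0, hv w id e2 = 0 & hv w id e3 = 1],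
      [/\ qv w id e0 = 0, qv w id e1 = - c & qv w id e2 = 0],
      [/\ qp w id e0 e1 = 0, qp w id e0 e2 = c & qp w id e1 e2 = 0] &
      c != 0].

(** Gram-Schmidt without halving: since [P] is isotropic, subtracting multiples of [P] makes [u]
    isotropic, and [v] is made orthogonal to this hyperbolic pair. The remaining value [q (e1)] is
    nonzero, or else [q] would be the product of two coordinates. *)
Lemma normal_frame_through_aux (u v w3 : 'rV[K]_4) :
  hv w id u = 0 -> hv w id v = 0 -> hv w id w3 = 1 -> span u v P w3 ->
  qp w id P u != 0 -> exists e0 e1 e3 c, normal_frame e0 e1 P e3 c.
Proof.
move=> hu hv' hw3 sp nz.
set a := qp w id P u in nz; pose b := qp w id P v.
have PP : qp w id P P = 0 by rewrite qpxx qP mulr0.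
have [u1 uE] : exists u1, u = a *: u1.
  by exists (a^-1 *: u); rewrite scalerA divff // scale1r.
have hu1 : hv w id u1 = 0 by apply: (mulfI nz); rewrite -hvZ -uE hu mulr0.
have Pu1 : qp w id P u1 = 1 by apply: (mulfI nz); rewrite -qpZr -uE mulr1.
have [v1 vE] : exists v1, v = v1 + b *: u1 by exists (v - b *: u1); rewrite subrK.
have hv1 : hv w id v1 = 0 by move: hv'; rewrite vE hvD hvZ hu1 mulr0 addr0.
have Pv1 : qp w id P v1 = 0.
  have : qp w id P v = b by [].
  by rewrite {1}vE qpDr qpZr Pu1 mulr1 -[RHS]add0r => /addIr.
pose q1 := qv w id u1.
have [u2 u1E] : exists u2, u1 = u2 + q1 *: P by exists (u1 - q1 *: P); rewrite subrK.
have hu2 : hv w id u2 = 0 by move: hu1; rewrite u1E hvD hvZ hP mulr0 addr0.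
have u2P : qp w id u2 P = 1.
  by move: Pu1; rewrite u1E qpDr qpZr PP mulr0 addr0 qpC.
have qu2 : qv w id u2 = 0.
  have : qv w id u1 = q1 by [].
  rewrite {1}u1E qvD qvZ qpZr qP u2P mulr0 addr0 mulr1 -[RHS]add0r.
  exact: addIr.
pose s := qp w id u2 v1.
have [e1 v1E] : exists e1, v1 = e1 + s *: P by exists (v1 - s *: P); rewrite subrK.
have he1 : hv w id e1 = 0 by move: hv1; rewrite v1E hvD hvZ hP mulr0 addr0.
have qe1P : qp w id e1 P = 0.
  by move: Pv1; rewrite v1E qpDr qpZr PP mulr0 addr0 qpC.
have u2e1 : qp w id u2 e1 = 0.
  have : qp w id u2 v1 = s by [].
  by rewrite {1}v1E qpDr qpZr u2P mulr1 -[RHS]add0r => /addIr.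
have spE x : exists y0 y1 y2 y3, x = y0 *: u2 + y1 *: e1 + y2 *: P + y3 *: w3.
  have [y0 [y1 [y2 [y3 ->]]]] := sp x.
  exists (y0 * a + y1 * b), y1, (y2 + (y0 * a + y1 * b) * q1 + y1 * s), y3.
  rewrite vE v1E uE u1E; move: a b q1 s {nz uE vE u1E v1E sp} => *.
  by apply/matrixP => m n; rewrite !mxE; ring.
pose c := - qv w id e1.
have cnz : c != 0.
  rewrite oppr_eq0; apply/eqP => qe1.
  have fr : frame u2 e1 P w3 := frame_span spE.
  have idm (x : 'rV[K]_4) : map_mx idfun x = x by apply/matrixP => ? ?; rewrite mxE.
  apply: (@irr K idfun u2 e1 P w3 1 0 0 0 0 1 fr); split=> //.
  - by rewrite mulr0.
  - by rewrite mul0r.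
  - by rewrite mul0r.
  - by rewrite mulr0 mul0r addr0.
  - by rewrite mulr1 mul0r addr0.
  - by rewrite mul0r mulr0 addr0.
exists (c *: u2), e1, w3, c; split=> //; last 1 first.
- by split=> //; rewrite qpZl ?u2e1 ?u2P ?mulr0 ?mulr1.
- apply: frame_span => x; have [y0 [y1 [y2 [y3 ->]]]] := spE x.
  by exists (y0 * c^-1), y1, y2, y3; rewrite scalerA mulfVK.
- by split=> //; rewrite hvZ hu2 mulr0.
- by split=> //; [rewrite qvZ qu2 mulr0|rewrite opprK].
Qed.

(** If [P] were orthogonal to both [u] and [v], then [q] would be a binary form in their
    coordinates, which splits over an extension. *)
Lemma normal_frame_through : exists e0 e1 e3 c, normal_frame e0 e1 P e3 c.
Proof.
have [u [v [w3 [hu hv' hw3 sp]]]] := frame_through.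
have [Pu|nz] := eqVneq (qp w id P u) 0; last first.
  exact: (normal_frame_through_aux hu hv' hw3 sp nz).
have [Pv|nz] := eqVneq (qp w id P v) 0; last first.
  apply: (normal_frame_through_aux hv' hu hw3 _ nz) => x.
  have [y0 [y1 [y2 [y3 ->]]]] := sp x; exists y1, y0, y2, y3.
  by rewrite [y0 *: u + _]addrC.
exfalso; have fr := frame_span sp.
pose a := qv w id u; pose b := qp w id u v; pose c := qv w id v.
have fact (L : fieldType) (j : {rmorphism K -> L}) f0 f1 g0 g1 :
    j a = f0 * g0 -> j c = f1 * g1 -> j b = f0 * g1 + f1 * g0 -> False.
  move=> aE cE bE.
  have Eh x : hv w j (map_mx j x) = j (hv w id x) by rewrite hv_map.
  have Eq x : qv w j (map_mx j x) = j (qv w id x) by rewrite qv_map.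
  have Eqp x y : qp w j (map_mx j x) (map_mx j y) = j (qp w id x y) by rewrite qp_map.
  apply: (@irr L j _ _ _ _ f0 f1 0 g0 g1 0 (frame_map j fr)).
  - by rewrite !Eh hu hv' hP rmorph0.
  - by rewrite !Eq -/a -/c aE cE qP rmorph0 mulr0.
  - by rewrite !Eqp -/b bE (qpC _ _ u P) (qpC _ _ v P) Pu Pv rmorph0 !mulr0 !mul0r !addr0.
clearbody a b c; have [a0|anz] := eqVneq a 0.
  by apply: (@fact K idfun 0 1 b c); rewrite /= ?a0; ring.
pose p := c%:P + b%:P * 'X + a%:P * 'X ^+ 2.
have sp3 : (1 < size p)%N.
  have : p`_2 != 0.
    by rewrite /p !coefD !coefCM coefC coefX coefXn /= mulr0 !add0r mulr1.
  by apply: contraNT; rewrite -leqNgt => le; rewrite nth_default // (leq_trans le).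
have [L [j [r /eqP rr]]] := root_in_extension sp3.
apply: (@fact L j 1 (- r) (j a) (j b + j a * r)); rewrite ?mul1r //; last by ring.
rewrite -[LHS]subr0 -rr /p !mul_polyC !rmorphD /= !map_polyZ map_polyXn map_polyX.
by rewrite map_polyC !hornerD !hornerZ hornerXn hornerX hornerC; ring.
Qed.

End NormalForm.

Section ResidualConic.

Variables (K : fieldType) (w : forms K) (e0 e1 e2 e3 : 'rV[K]_4) (c : K).
Hypothesis smooth : smooth_forms w.
Hypothesis nf : normal_frame w e0 e1 e2 e3 c.

Lemma singular_on_conic (L : fieldType) (j : {rmorphism K -> L}) (x : 'rV[L]_4) :
  x != 0 -> hv w j x = 0 -> qv w j x = 0 -> rv w j x = 0 -> cv w j x = 0 -> False.
Proof.
move=> xnz hx qx rx cx; apply: (@smooth L j x xnz).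
  by rewrite /Fv hx qx !mul0r addr0.
by move=> y; rewrite /dFv hx qx rx cx !mul0r !mulr0 !addr0.
Qed.

Lemma normal_frame_scale : [/\ qv (scale_forms c w) id e0 = 0,
  qv (scale_forms c w) id e1 = -1 & qv (scale_forms c w) id e2 = 0] /\
  [/\ qp (scale_forms c w) id e0 e1 = 0, qp (scale_forms c w) id e0 e2 = 1
  & qp (scale_forms c w) id e1 e2 = 0].
Proof.
have [_ _ [q0 q1 q2] [q01 q02 q12] cnz] := nf.
rewrite -![scale_forms c w]/(scale_forms c w).
have E x : qv (scale_forms c w) id x = c^-1 * qv w id x.
  exact: (qv_scale c w (idfun : {rmorphism K -> K})).
have E2 x y : qp (scale_forms c w) id x y = c^-1 * qp w id x y.
  exact: (qp_scale c w (idfun : {rmorphism K -> K})).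
by rewrite !E !E2 q0 q1 q2 q01 q02 q12 !mulr0 mulrN mulVf.
Qed.

Lemma cv_pt_coef6 : (cv w polyC (pt e0 e1 e2 polyC 'X))`_6 = cv w id e2.
Proof.
have E x : cv w polyC (map_mx polyC x) = (cv w id x)%:P by rewrite cv_map.
have E2 x y : cp w polyC (map_mx polyC x) (map_mx polyC y) = (cp w id x y)%:P.
  by rewrite cp_map.
have E3 x y z : cq w polyC (map_mx polyC x) (map_mx polyC y) (map_mx polyC z)
  = (cq w id x y z)%:P by rewrite cq_map.
rewrite /pt !cvD !cpDl !cpDr !cpZl !cpZr !cvZ !cqZ2 !cqZ3 !E !E2 !E3.
move: (cv w id e0) (cv w id e1) (cv w id e2) (cq w id e0 e1 e2) => c0 c1 c2 c012.
move: (cp w id e0 e1) (cp w id e0 e2) (cp w id e1 e0) (cp w id e1 e2)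
  (cp w id e2 e0) (cp w id e2 e1) => c01 c02 c10 c12 c20 c21.
set p : {poly K} := _ + _.
have -> : p = c0%:P + 'X * c01%:P + 'X ^+ 2 * (c02 + c10)%:P
    + 'X ^+ 3 * (c1 + c012)%:P + 'X ^+ 4 * (c12 + c20)%:P + 'X ^+ 5 * c21%:P
    + 'X ^+ 6 * c2%:P.
  by rewrite /p !polyCD; ring.
by rewrite !coefD coefC coefXM !coefXnM !coefC /= !add0r.
Qed.

Lemma rv_pt_coef4 : (rv w polyC (pt e0 e1 e2 polyC 'X))`_4 = rv w id e2.
Proof.
rewrite -[rv w _ _]/(ga w e0 e1 e2) gaE.
by rewrite !coefD coefC coefXM !coefXnM !coefC /= !add0r.
Qed.

(** Otherwise [r] vanishes on the whole conic and each zero of the cubic on the conic is singular.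
    One exists: a root of the sextic [c (pt 'X)] or, if that is constant, the point [e2]. *)
Lemma residual_conic_neq : rv w polyC (pt e0 e1 e2 polyC 'X) != 0.
Proof.
have [fr [h0 h1 h2 h3] [q0 q1 q2] [q01 q02 q12] cnz] := nf.
apply/eqP => r0.
have hpt (R : comNzRingType) (i : {rmorphism K -> R}) t : hv w i (pt e0 e1 e2 i t) = 0.
  exact: (hv_pt h0 h1 h2 h3).
have qpt (R : comNzRingType) (i : {rmorphism K -> R}) t : qv w i (pt e0 e1 e2 i t) = 0.
  have [[s0 s1 s2] [s01 s02 s12]] := normal_frame_scale.
  have := qv_pt s0 s1 s2 s01 s02 s12 i t; rewrite qv_scale => E.
  have jc : i c * i c^-1 = 1 by rewrite -rmorphM divff // rmorph1.
  by rewrite -[LHS]mul1r -jc -mulrA E mulr0.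
have pnz (L : fieldType) (j : {rmorphism K -> L}) t : pt e0 e1 e2 j t != 0.
  apply/eqP => pt0; have [_ free] := fr L j.
  have [|/eqP] := free 1 t (t ^+ 2) 0; last by rewrite oner_eq0.
  by rewrite scale0r addr0 scale1r.
have spec (L : fieldType) (j : {rmorphism K -> L}) t :
    let ev := horner_eval t \o map_poly j in
    ev \o polyC = j /\ map_mx ev (pt e0 e1 e2 polyC 'X) = pt e0 e1 e2 j t.
  move=> ev; have evC : ev \o polyC = j.
    apply: functional_extensionality => z.
    by rewrite /ev /= map_polyC /horner_eval hornerC.
  split=> //; rewrite /pt !map_mxD !map_mxZ -!map_mx_comp.
  have eX : ev 'X = t by rewrite /ev /= map_polyX /horner_eval hornerX.
  have eXn : ev 'X^2 = t ^+ 2 by rewrite /ev /= map_polyXn /horner_eval hornerXn.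
  by rewrite -[X in _ = _ + X *: _ + _]eX -[X in _ = _ + X *: _]eXn -evC.
pose C := cv w polyC (pt e0 e1 e2 polyC 'X).
have [sC|sC] := ltnP 1 (size C).
  have [L [j [t /eqP rt]]] := root_in_extension sC.
  have [evC evP] := spec L j t.
  apply: (singular_on_conic (pnz L j t) (hpt L j t) (qpt L j t)).
    transitivity ((horner_eval t \o map_poly j) (rv w polyC (pt e0 e1 e2 polyC 'X))).
      by rewrite rv_map evC evP.
    by rewrite r0 rmorph0.
  transitivity ((horner_eval t \o map_poly j) C); last exact: rt.
  by rewrite cv_map evC evP.
have idm (x : 'rV[K]_4) : map_mx idfun x = x by apply/matrixP => ? ?; rewrite mxE.
apply: (@singular_on_conic K idfun e2).
- apply/eqP => e20; have [_ free] := fr K idfun.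
  have [|_ _ /eqP] := free 0 0 1 0; last by rewrite oner_eq0.
  by rewrite !scale0r !add0r addr0 scale1r idm.
- exact: h2.
- exact: q2.
- by rewrite -[LHS]rv_pt_coef4 r0 coef0.
- by rewrite -[LHS]cv_pt_coef6 nth_default // (leq_trans sC).
Qed.

End ResidualConic.

(** * From lines to points *)

Local Notation onB B x := (submx (x%R : 'rV_4) B).

Section LinesToPoints.

Variables (K : fieldType) (w : forms K).
Variables e0 e1 e2 e3 : 'rV[K]_4.

Hypothesis inf : forall p : {poly K}, p != 0 -> exists t, p.[t] != 0.
Hypothesis fr : frame e0 e1 e2 e3.
Hypothesis smooth : smooth_forms w.
Hypothesis h0 : hv w id e0 = 0.
Hypothesis h1 : hv w id e1 = 0.
Hypothesis h2 : hv w id e2 = 0.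
Hypothesis h3 : hv w id e3 = 1.
Hypothesis q0 : qv w id e0 = 0.
Hypothesis q1 : qv w id e1 = -1.
Hypothesis q2 : qv w id e2 = 0.
Hypothesis q01 : qp w id e0 e1 = 0.
Hypothesis q02 : qp w id e0 e2 = 1.
Hypothesis q12 : qp w id e1 e2 = 0.
Hypothesis r2 : rv w id e2 != 0.

Lemma poly_eq0 (p : {poly K}) : (forall u, p.[u] = 0) -> p = 0.
Proof.
move=> p0; apply/eqP; apply: contraT => /inf [t]; by rewrite p0 eqxx.
Qed.

Lemma quartic_coefs (a0 a1 a2 a3 a4 : K) :
  (forall u, a0 + u * a1 + u ^+ 2 * a2 + u ^+ 3 * a3 + u ^+ 4 * a4 = 0) ->
  [/\ a0 = 0, a1 = 0, a2 = 0, a3 = 0 & a4 = 0].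
Proof.
move=> E; have /polyP p0 : a0%:P + 'X * a1%:P + 'X ^+ 2 * a2%:P
    + 'X ^+ 3 * a3%:P + 'X ^+ 4 * a4%:P = 0.
  apply: poly_eq0 => u; rewrite -(E u) !hornerD !hornerM !hornerX !hornerC; ring.
have := p0 0; have := p0 1%N; have := p0 2; have := p0 3; have := p0 4.
rewrite !coefD !coefC !coefXM !coefXnM !coefC /= !addr0 !add0r.
by move=> -> -> -> -> ->.
Qed.

Lemma plane_coords (x : 'rV[K]_4) : hv w id x = 0 ->
  exists y0 y1 y2, x = y0 *: e0 + y1 *: e1 + y2 *: e2.
Proof.
have idm (z : 'rV[K]_4) : map_mx idfun z = z by apply/matrixP => ? ?; rewrite mxE.
have [span _] := fr idfun; have [y0 [y1 [y2 [y3]]]] := span x.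
rewrite !idm => -> ; rewrite !hvD !hvZ h0 h1 h2 h3 !mulr0 !add0r mulr1 => ->.
by exists y0, y1, y2; rewrite scale0r addr0.
Qed.

Lemma plane_free (y0 y1 y2 : K) : y0 *: e0 + y1 *: e1 + y2 *: e2 = 0 ->
  [/\ y0 = 0, y1 = 0 & y2 = 0].
Proof.
have idm (z : 'rV[K]_4) : map_mx idfun z = z by apply/matrixP => ? ?; rewrite mxE.
have [_ free] := fr idfun => E; have [|-> -> -> _ //] := free y0 y1 y2 0.
by rewrite !idm scale0r addr0.
Qed.

Lemma plane_qv y0 y1 y2 :
  qv w id (y0 *: e0 + y1 *: e1 + y2 *: e2) = y0 * y2 - y1 ^+ 2.
Proof.
by rewrite !qvD !qvZ !qpDl !qpZl !qpZr q0 q1 q2 q01 q02 q12; ring.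
Qed.

Lemma pt_neq0 t : pt e0 e1 e2 (idfun : {rmorphism K -> K}) t != 0.
Proof.
have idm (z : 'rV[K]_4) : map_mx idfun z = z by apply/matrixP => ? ?; rewrite mxE.
apply/eqP; rewrite /pt !idm -[e0]scale1r => /plane_free [/eqP].
by rewrite oner_eq0.
Qed.

Local Notation ga := (ga w e0 e1 e2).
Local Notation gnm := (gnm w e0 e1 e2 e3).

Definition dir (t l : K) : 'rV[K]_4 :=
  map_mx (horner_eval t) gnm + l *: map_mx (horner_eval t) (gtg e1 e2).

Lemma horner_eval_polyC t : horner_eval t \o polyC = id :> (K -> K).
Proof. by apply: functional_extensionality => c; rewrite /= /horner_eval hornerC. Qed.

Lemma horner_polyC (x : 'rV[K]_4) t : map_mx (horner_eval t) (map_mx polyC x) = x.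
Proof. by rewrite -map_mx_comp horner_eval_polyC; apply/matrixP => ? ?; rewrite mxE. Qed.

Lemma horner_gpt t : map_mx (horner_eval t) (gpt e0 e1 e2) = e0 + t *: e1 + t ^+ 2 *: e2.
Proof.
rewrite /gpt /pt !map_mxD !map_mxZ !horner_polyC; congr (_ + _ *: _ + _ *: _).
  exact: hornerX.
exact: hornerXn.
Qed.

Lemma horner_gtg t : map_mx (horner_eval t) (gtg e1 e2) = e1 + (2 * t) *: e2.
Proof.
rewrite /gtg /tg map_mxD map_mxZ !horner_polyC; congr (_ + _ *: _).
by rewrite /= /horner_eval hornerM hornerX -polyC_natr hornerC.
Qed.

Lemma hv_dir t l : hv w id (dir t l) = ga.[t].
Proof.
have := hv_gnm h0 h1 h2 h3; have := hv_gtg h0 h1 h2 h3.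
move=> /(congr1 (horner_eval t)) T /(congr1 (horner_eval t)) N.
rewrite !hv_map horner_eval_polyC in T N.
by rewrite /dir hvD hvZ T N rmorph0 mulr0 addr0.
Qed.

Lemma horner_ga t : ga.[t] = rv w id (e0 + t *: e1 + t ^+ 2 *: e2).
Proof.
by rewrite -[LHS]/(horner_eval t ga) rv_map horner_eval_polyC horner_gpt.
Qed.

Variable B : 'M[K]_(2, 4).
Hypothesis in_surface : forall x : 'rV_4, (x <= B)%MS -> Fv w id x = 0.

(** The line has a direction [v1] normalized by [hv v1 = ga.[t]]. It satisfies the same tangency
    equations as [n], so [v1 - n] is a combination of [P (t)] and [T], and the coefficient of [T] is
    [l]. *)
Lemma transversal_point (P v : 'rV[K]_4) :
  P != 0 -> (P <= B)%MS -> hv w id P = 0 -> qv w id P = 0 ->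
  (v <= B)%MS -> hv w id v != 0 -> ~~ (e2 <= B)%MS ->
  exists t l, [/\ ga.[t] != 0,
    (map_poly (horner_eval t) (gf2 w e0 e1 e2 e3)).[l] = 0,
    (map_poly (horner_eval t) (gf3 w e0 e1 e2 e3)).[l] = 0 &
    (map_poly (horner_eval t) (gf4 w e0 e1 e2 e3)).[l] = 0] /\
    onB B (e0 + t *: e1 + t ^+ 2 *: e2) /\ (dir t l <= B)%MS.
Proof.
move=> Pnz PB hP qP vB hvnz e2B.
have [y0 [y1 [y2 PE]]] := plane_coords hP.
have qE : y0 * y2 = y1 ^+ 2.
  by apply/eqP; rewrite -subr_eq0 -plane_qv -PE qP.
have y0nz : y0 != 0.
  apply: contra e2B => /eqP y00.
  have y10 : y1 = 0.
    by apply/eqP; have := qE; rewrite y00 mul0r => /esym/eqP; rewrite expf_eq0.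
  have PE' : P = y2 *: e2 by rewrite PE y00 y10 !scale0r !add0r.
  have y2nz : y2 != 0 by apply: contraNneq Pnz => y20; rewrite PE' y20 scale0r.
  have -> : e2 = y2^-1 *: P by rewrite PE' scalerA mulVf // scale1r.
  exact: scalemx_sub.
pose t := y1 / y0; exists t.
set Q := e0 + t *: e1 + t ^+ 2 *: e2.
have QE : Q = y0^-1 *: P.
  have y1E : y1 = t * y0 by rewrite /t divfK.
  have y2E : y2 = t ^+ 2 * y0.
    by apply: (mulfI y0nz); rewrite qE y1E; ring.
  rewrite PE y1E y2E !scalerDr !scalerA mulVf // scale1r /Q.
  by rewrite mulrC mulfK // [y0^-1 * _]mulrC mulfK.
have QB : (Q <= B)%MS by rewrite QE scalemx_sub.
have hQ : hv w id Q = 0 by rewrite QE hvZ hP mulr0.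
have qQ : qv w id Q = 0 by rewrite QE qvZ qP mulr0.
have ptE : pt e0 e1 e2 (idfun : {rmorphism K -> K}) t = Q.
  have idm (z : 'rV[K]_4) : map_mx idfun z = z by apply/matrixP => ? ?; rewrite mxE.
  by rewrite /pt !idm.
have Qnz : Q != 0 by rewrite -ptE pt_neq0.
have tan0 (u : 'rV[K]_4) : (u <= B)%MS -> dFv w id Q u = 0.
  move=> uB; have [|_ -> //] := @quartic_coefs (Fv w id Q) (dFv w id Q u)
    (Fmid w id Q u) (dFv w id u Q) (Fv w id u).
  by move=> a; rewrite -Fv_line in_surface // addmx_sub ?scalemx_sub.
have tanE (u : 'rV[K]_4) : (u <= B)%MS ->
    hv w id u * cv w id Q + qp w id Q u * rv w id Q = 0.
  by move=> /tan0; rewrite /dFv hQ qQ !mul0r !addr0.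
have gaE : ga.[t] = rv w id Q by rewrite horner_ga.
have ganz : ga.[t] != 0.
  (* If [r] vanished at [Q], tangency of a direction outside the plane would give [c (Q) = 0], a
     singular point. *)
  rewrite gaE; apply/eqP => rQ.
  have cQ : cv w id Q = 0.
    by have := tanE v vB; rewrite rQ mulr0 addr0 => /eqP;
       rewrite mulf_eq0 (negbTE hvnz) => /eqP.
  exact: (@singular_on_conic K w smooth K idfun Q).
pose v1 := (ga.[t] / hv w id v) *: v.
have v1B : (v1 <= B)%MS by rewrite scalemx_sub.
have hv1 : hv w id v1 = ga.[t] by rewrite hvZ divfK.
have qv1 : qp w id Q v1 = - cv w id Q.
  have := tanE v1 v1B; rewrite hv1 gaE (mulrC (qp _ _ _ _)) -mulrDr => /eqP.
  by rewrite -gaE mulf_eq0 (negbTE ganz) /= addrC addr_eq0 => /eqP.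
clearbody v1; pose n := map_mx (horner_eval t) gnm.
have hn : hv w id n = ga.[t] by have := hv_dir t 0; rewrite /dir scale0r addr0.
have qn : qp w id Q n = - cv w id Q.
  have : qp w polyC (gpt e0 e1 e2) gnm = - cv w polyC (gpt e0 e1 e2).
    exact: qp_gpt_gnm.
  move=> /(congr1 (horner_eval t)); rewrite rmorphN qp_map cv_map.
  by rewrite horner_eval_polyC horner_gpt.
have [|z0 [z1 [z2 dE]]] := @plane_coords (v1 - n).
  by rewrite -scaleN1r hvD hvZ hv1 hn; ring.
have qd : qp w id Q (v1 - n) = 0.
  by rewrite -scaleN1r qpDr qpZr qv1 qn; ring.
have z2E : z2 = 2 * t * z1 - t ^+ 2 * z0.
  move: qd; rewrite dE /Q !qpDl !qpZl !qpDr !qpZr !qpxx (qpC _ _ e1 e0).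
  rewrite (qpC _ _ e2 e0) (qpC _ _ e2 e1) q0 q1 q2 q01 q02 q12 => E.
  by rewrite -[RHS]addr0 -E; ring.
(* [v1 - n = z0 Q + l T]; compare the coordinates on [e0] and [e1]. *)
pose l := z1 - t * z0; exists l.
have dirE : dir t l = v1 - z0 *: Q.
  rewrite /dir -/n horner_gtg.
  have -> : v1 = n + (z0 *: e0 + z1 *: e1 + z2 *: e2) by rewrite -dE addrC subrK.
  rewrite z2E /Q /l; clearbody n; clear.
  by apply/matrixP => a b; rewrite !mxE; ring.
have dirB : (dir t l <= B)%MS by rewrite dirE -scaleNr addmx_sub ?scalemx_sub.
split; last by split.
have spec u : Fv w (horner_eval t \o polyC)
    (map_mx (horner_eval t) (gpt e0 e1 e2) + u *: dir t l) =
    u ^+ 2 * (map_poly (horner_eval t) (gf2 w e0 e1 e2 e3)).[l]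
    + u ^+ 3 * (map_poly (horner_eval t) (gf3 w e0 e1 e2 e3)).[l]
    + u ^+ 4 * (map_poly (horner_eval t) (gf4 w e0 e1 e2 e3)).[l].
  exact: Fv_spec.
have [|_ _ f2 f3 f4] := @quartic_coefs 0 0
  (map_poly (horner_eval t) (gf2 w e0 e1 e2 e3)).[l]
  (map_poly (horner_eval t) (gf3 w e0 e1 e2 e3)).[l]
  (map_poly (horner_eval t) (gf4 w e0 e1 e2 e3)).[l]; last by split.
move=> u; rewrite mulr0 !add0r -spec horner_eval_polyC horner_gpt.
by apply: in_surface; rewrite addmx_sub ?scalemx_sub.
Qed.

(** On the plane the quartic is [q r], so the line is contained in the conic or in the residual
    conic. The first is excluded, and by [r2] the line avoids [e2], so it projects onto the span of
    [e0] and [e1]; Cramer's rule gives [a] and [b]. *)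
Lemma residual_point (x y : 'rV[K]_4) :
  (forall z : 'rV_4, (z <= B)%MS -> hv w id z = 0) ->
  (x <= B)%MS -> (y <= B)%MS ->
  (forall a b, a *: x + b *: y = 0 -> a = 0 /\ b = 0) ->
  exists a b, [/\ rv w id (e0 + a *: e2) = 0,
     rp w id (e0 + a *: e2) (e1 + b *: e2) = 0 & rv w id (e1 + b *: e2) = 0] /\
     onB B (e0 + a *: e2) /\ onB B (e1 + b *: e2).
Proof.
move=> hB xB yB free.
have [a0 [a1 [a2 xE]]] := plane_coords (hB _ xB).
have [b0 [b1 [b2 yE]]] := plane_coords (hB _ yB).
have combE s t : s *: x + t *: y =
    (s * a0 + t * b0) *: e0 + (s * a1 + t * b1) *: e1 + (s * a2 + t * b2) *: e2.
  by rewrite xE yE; apply/matrixP => u v; rewrite !mxE; ring.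
have free1 : ~ [/\ a0 = 0, a1 = 0 & a2 = 0].
  case=> a00 a10 a20; have [|/eqP] := free 1 0; last by rewrite oner_eq0.
  by rewrite combE a00 a10 a20 !mulr0 !mul0r !addr0 !scale0r !addr0.
have free2 : ~ [/\ b0 = 0, b1 = 0 & b2 = 0].
  case=> b00 b10 b20; have [|_ /eqP] := free 0 1; last by rewrite oner_eq0.
  by rewrite combE b00 b10 b20 !mulr0 !mul0r !addr0 !scale0r !addr0.
pose quad (c d e : K) : {poly K} := c%:P + 'X * d%:P + 'X ^+ 2 * e%:P.
have quadE c d e u : (quad c d e).[u] = c + u * d + u ^+ 2 * e.
  by rewrite /quad !hornerD !hornerM !hornerX !hornerC; ring.
have quad0 c d e : quad c d e = 0 -> [/\ c = 0, d = 0 & e = 0].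
  move=> E; have [|-> -> -> _ _ //] := @quartic_coefs c d e 0 0.
  by move=> u; rewrite !mulr0 !addr0 -quadE E horner0.
have : quad (qv w id x) (qp w id x y) (qv w id y) *
       quad (rv w id x) (rp w id x y) (rv w id y) = 0.
  apply: poly_eq0 => u; rewrite hornerM !quadE.
  have xyB : onB B (x + u *: y) by rewrite addmx_sub ?scalemx_sub.
  have := in_surface xyB; rewrite /Fv (hB _ xyB) mul0r add0r qvD qvZ qpZr.
  by rewrite rvD rvZ rpZr.
move/eqP; rewrite mulf_eq0 => /orP [] /eqP /quad0 [].
  rewrite {1}xE {2}yE !plane_qv => /subr0_eq qx qxy /subr0_eq qy.
  have {}qxy : a0 * b2 + a2 * b0 = 2 * a1 * b1.
    apply/eqP; rewrite -subr_eq0 -qxy xE yE !qpDl !qpZl !qpDr !qpZr !qpxx.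
    rewrite (qpC _ _ e1 e0) (qpC _ _ e2 e0) (qpC _ _ e2 e1) q0 q1 q2 q01 q02 q12.
    by apply/eqP; ring.
  (* On a line in the conic the minors of the coordinates vanish: this one because its square
     does. *)
  have z1 : b0 * a1 - a0 * b1 = 0.
    have : (b0 * a1 - a0 * b1) ^+ 2 = 0.
      transitivity (b0 ^+ 2 * a1 ^+ 2 + a0 ^+ 2 * b1 ^+ 2 - a0 * b0 * (2 * a1 * b1)).
        by ring.
      by rewrite -qx -qy -qxy; ring.
    by move/eqP; rewrite expf_eq0 => /eqP.
  exfalso; have [a00|a0nz] := eqVneq a0 0.
    have a10 : a1 = 0.
      by apply/eqP; move: qx; rewrite a00 mul0r => /esym/eqP; rewrite expf_eq0.
    have [b00|b0nz] := eqVneq b0 0.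
      have b10 : b1 = 0.
        by apply/eqP; move: qy; rewrite b00 mul0r => /esym/eqP; rewrite expf_eq0.
      have [|_ a20] := free b2 (- a2).
        rewrite combE a00 b00 a10 b10 !mulr0 !addr0 !scale0r !add0r.
        by rewrite mulrC mulNr subrr scale0r.
      by apply: free1; split=> //; apply: oppr_inj; rewrite a20 oppr0.
    apply: free1; split=> //; apply: (mulIf b0nz).
    by rewrite mul0r -[LHS]add0r -(mul0r b2) -{1}a00 qxy a10; ring.
  have z2 : b0 * a2 - a0 * b2 = 0.
    apply: (mulfI a0nz); rewrite mulr0.
    transitivity (2 * b0 * (a0 * a2) - a0 * (a0 * b2 + a2 * b0)); first by ring.
    rewrite qx qxy; transitivity (2 * a1 * (b0 * a1 - a0 * b1)); first by ring.
    by rewrite z1 mulr0.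
  have [|_ /eqP] := free b0 (- a0); last by rewrite oppr_eq0 (negbTE a0nz).
  by rewrite combE !mulNr z1 z2 mulrC subrr !scale0r !addr0.
move=> rx rxy ry.
have rcomb s t : rv w id (s *: x + t *: y) = 0.
  by rewrite rvD !rvZ rpZl rpZr rx rxy ry !mulr0 !addr0.
(* Such a combination is a multiple of [e2] on which [r] vanishes, hence 0. *)
have e2c s t : s * a0 + t * b0 = 0 -> s * a1 + t * b1 = 0 -> s = 0 /\ t = 0.
  move=> c0 c1; apply: free; rewrite combE c0 c1 !scale0r !add0r.
  have := rcomb s t; rewrite combE c0 c1 !scale0r !add0r rvZ => /eqP.
  by rewrite mulf_eq0 (negbTE r2) orbF expf_eq0 => /eqP ->; rewrite scale0r.
have Dnz : a0 * b1 - a1 * b0 != 0.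
  apply/eqP => D0.
  have [||b00 a00] := e2c b0 (- a0); first by ring.
    by rewrite -[RHS]oppr0 -D0; ring.
  have {}a00 : a0 = 0 by apply: oppr_inj; rewrite a00 oppr0.
  have [||b10 a10] := e2c b1 (- a1); [by rewrite a00 b00; ring|by ring|].
  have {}a10 : a1 = 0 by apply: oppr_inj; rewrite a10 oppr0.
  have [||/eqP] := e2c 1 0; [by rewrite a00 b00; ring|by rewrite a10 b10; ring|].
  by rewrite oner_eq0.
set D := a0 * b1 - a1 * b0 in Dnz.
exists ((b1 * a2 - a1 * b2) / D), ((a0 * b2 - b0 * a2) / D).
have uE : e0 + ((b1 * a2 - a1 * b2) / D) *: e2 = (b1 / D) *: x + (- a1 / D) *: y.
  rewrite combE; have -> : b1 / D * a0 + - a1 / D * b0 = D / D.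
    by rewrite {3}/D; ring.
  have -> : b1 / D * a1 + - a1 / D * b1 = 0 by ring.
  by rewrite divff // scale1r scale0r addr0; congr (_ + _ *: _); ring.
have vE : e1 + ((a0 * b2 - b0 * a2) / D) *: e2 = (- b0 / D) *: x + (a0 / D) *: y.
  rewrite combE; have -> : - b0 / D * a1 + a0 / D * b1 = D / D.
    by rewrite {3}/D; ring.
  have -> : - b0 / D * a0 + a0 / D * b0 = 0 by ring.
  by rewrite divff // scale1r scale0r add0r; congr (_ + _ *: _); ring.
split; last by rewrite uE vE !addmx_sub ?scalemx_sub.
split; rewrite ?uE ?vE ?rcomb //.
by rewrite !rpDl !rpDr !rpZl !rpZr !rpxx (rpC _ _ y x) rx rxy ry; ring.
Qed.

End LinesToPoints.

(** * Lines as row spaces, and their base change *)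

Section TwoRows.

Variable K : fieldType.
Implicit Types x y z u v : 'rV[K]_4.

Definition free2 x y := forall a b, a *: x + b *: y = 0 -> a = 0 /\ b = 0.

Definition two_rows x y : 'M[K]_(2, 4) := \matrix_i [:: x; y]`_i.

Lemma mul_two_rows (c : 'rV[K]_2) x y :
  c *m two_rows x y = c 0 ord0 *: x + c 0 (lift ord0 ord0) *: y.
Proof. by rewrite mulmx_sum_row !big_ord_recl big_ord0 addr0 !rowK. Qed.

Lemma two_rowsP x y z : reflect (exists a b, z = a *: x + b *: y) (onB (two_rows x y) z).
Proof.
apply: (iffP submxP) => [[c ->]|[a [b ->]]].
  by rewrite mul_two_rows; do 2!eexists.
by exists (\row_j [:: a; b]`_j); rewrite mul_two_rows !mxE.
Qed.

Lemma two_rows_free x y : free2 x y <-> row_free (two_rows x y).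
Proof.
split=> [fr|fr a b E].
  rewrite -kermx_eq0; apply/rowV0P => c /sub_kermxP.
  rewrite mul_two_rows => /fr [c0 c1]; apply/rowP => j; rewrite mxE.
  case: (unliftP ord0 j) => [i ->|->] //.
  by rewrite (ord1 i).
have : \row_j [:: a; b]`_j *m two_rows x y = 0 *m two_rows x y.
  by rewrite mul0mx mul_two_rows !mxE.
move/(row_free_inj fr) => ab.
have := congr1 (fun r : 'rV_2 => r 0 ord0) ab.
have := congr1 (fun r : 'rV_2 => r 0 (lift ord0 ord0)) ab.
by rewrite !mxE.
Qed.

Lemma two_rows_span (B : 'M[K]_(2, 4)) u v : \rank B = 2 -> onB B u -> onB B v ->
  free2 u v -> (B <= two_rows u v)%MS && (two_rows u v <= B)%MS.
Proof.
move=> rB uB vB /two_rows_free fr.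
have le : (two_rows u v <= B)%MS.
  by apply/row_subP => i; rewrite rowK; case: (unliftP ord0 i) => [j ->|->] //;
    rewrite (ord1 j).
by rewrite le andbT -(geq_leqif (mxrank_leqif_sup le)) rB; move: fr; rewrite /row_free => /eqP ->.
Qed.

Lemma mem_span2 x y z : reflect (exists a b, z = a *: x + b *: y) (z \in <<[:: x; y]>>%VS).
Proof.
rewrite span_cons span_seq1; apply: (iffP memv_addP) => [[u /vlineP [a ->]]|].
  by case=> v /vlineP [b ->] ->; exists a, b.
case=> a [b ->]; exists (a *: x); first by rewrite memvZ // memv_line.
by exists (b *: y) => //; rewrite memvZ // memv_line.
Qed.

End TwoRows.

Lemma map_two_rows (k K : fieldType) (f : {rmorphism k -> K}) (x y : 'rV[k]_4) :
  map_mx f (two_rows x y) = two_rows (map_mx f x) (map_mx f y).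
Proof.
apply/row_matrixP => i; rewrite -map_row !rowK.
by case: (unliftP ord0 i) => [j ->|->] //; rewrite (ord1 j).
Qed.

Lemma line_basis (k : fieldType) (l : {vspace 'rV[k]_4}) : line l ->
  exists x y, [/\ free2 x y, forall z, (z \in l) = onB (two_rows x y) z &
    forall (K : fieldType) (f : {rmorphism k -> K}) z,
      (z \in base_change f l) = onB (map_mx f (two_rows x y)) z].
Proof.
rewrite /line => dl.
have [x [y E]] : exists x y, vbasis l = [:: x; y] :> seq _.
  have : size (vbasis l) = 2%N := etrans (size_tuple _) dl.
  by case: (tval (vbasis l)) => [|x [|y [|]]] //; exists x, y.
have bl := vbasisP l; rewrite E in bl.
exists x, y; split.
- have := basis_free bl; rewrite free_cons span_seq1 seq1_free => /andP [xy ynz] a b E0.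
  have a0 : a = 0.
    apply/eqP; apply: contraT => anz; case/negP: xy.
    have -> : x = (- a^-1 * b) *: y.
      move/eqP: E0; rewrite addr_eq0 => /eqP ax.
      transitivity (a^-1 *: (a *: x)); first by rewrite scalerA mulVf // scale1r.
      by rewrite ax scalerN scalerA mulNr scaleNr.
    by rewrite memvZ // memv_line.
  split=> //; move/eqP: E0; rewrite a0 scale0r add0r scaler_eq0 (negbTE ynz) orbF.
  by move/eqP.
- move=> z; rewrite -(span_basis bl).
  by apply/mem_span2/two_rowsP.
- move=> K f z; rewrite /base_change E /= map_two_rows.
  by apply/mem_span2/two_rowsP.
Qed.

(** Two common independent vectors make the base changes equal, and inclusion of row spaces descends
    to [k]. *)
Lemma line_eq (k K : fieldType) (f : {rmorphism k -> K}) (l l' : {vspace 'rV[k]_4})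
  (u v : 'rV[K]_4) : line l -> line l' -> free2 u v ->
  u \in base_change f l -> v \in base_change f l ->
  u \in base_change f l' -> v \in base_change f l' -> l = l'.
Proof.
move=> /line_basis [x [y [fr lE bE]]] /line_basis [x' [y' [fr' lE' bE']]] uv.
rewrite !bE !bE' => ul vl ul' vl'.
have rk (a b : 'rV[k]_4) : free2 a b -> \rank (map_mx f (two_rows a b)) = 2.
  by move/two_rows_free; rewrite mxrank_map => /eqP.
have /andP [s1 s2] := two_rows_span (rk _ _ fr) ul vl uv.
have /andP [s1' s2'] := two_rows_span (rk _ _ fr') ul' vl' uv.
have le : (two_rows x y <= two_rows x' y')%MS.
  by rewrite -(map_submx f); apply: submx_trans s1 s2'.
have le' : (two_rows x' y' <= two_rows x y)%MS.
  by rewrite -(map_submx f); apply: submx_trans s1' s2.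
apply/vspaceP => z; rewrite lE lE'.
by apply/idP/idP => zl; [apply: submx_trans zl le|apply: submx_trans zl le'].
Qed.

(** A line outside the plane meets it in a single point, rational over [k]. So [z] is proportional
    to [p], and a meeting point given over any field is available over every extension of [k]. *)
Lemma meet_point (k : fieldType) (w : forms k) (x y : 'rV[k]_4)
  (K : fieldType) (f : {rmorphism k -> K}) (z : 'rV[K]_4) :
  let p := hv w id y *: x + (- hv w id x) *: y in
  free2 x y -> (hv w id x != 0) || (hv w id y != 0) ->
  z != 0 -> onB (two_rows (map_mx f x) (map_mx f y)) z ->
  hv w f z = 0 -> qv w f z = 0 ->
  [/\ p != 0, onB (two_rows x y) p, hv w id p = 0 & qv w id p = 0].
Proof.
move=> p fr nz znz /two_rowsP [a [b zE]] hz qz.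
have Eh e : hv w f (map_mx f e) = f (hv w id e) by rewrite hv_map.
have Eq e : qv w f (map_mx f e) = f (qv w id e) by rewrite qv_map.
have ab : a * f (hv w id x) + b * f (hv w id y) = 0.
  by rewrite -!Eh -!hvZ -hvD -zE.
have pE : map_mx f p = f (hv w id y) *: map_mx f x + (- f (hv w id x)) *: map_mx f y.
  by rewrite map_mxD !map_mxZ rmorphN.
split.
- apply: contraTneq nz => /fr [y0 /eqP]; rewrite oppr_eq0 => /eqP x0.
  by rewrite x0 y0 eqxx.
- by apply/two_rowsP; do 2!eexists.
- by rewrite hvD !hvZ; ring.
have yp : f (hv w id y) *: z = a *: map_mx f p.
  rewrite zE pE !scalerDr !scalerA [f _ * a]mulrC; congr (_ + _ *: _).
  by apply/eqP; rewrite -subr_eq0 -ab; apply/eqP; ring.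
have xp : f (hv w id x) *: z = (- b) *: map_mx f p.
  rewrite zE pE !scalerDr !scalerA; congr (_ *: _ + _ *: _); last by ring.
  by apply/eqP; rewrite -subr_eq0 -ab; apply/eqP; ring.
have fin (c d : K) : c != 0 -> c *: z = d *: map_mx f p -> qv w id p = 0.
  move=> cnz E; have dnz : d != 0.
    apply/eqP => d0; move/eqP: E; rewrite d0 scale0r scaler_eq0.
    by rewrite (negbTE cnz) (negbTE znz).
  apply: (fmorph_inj f); rewrite rmorph0 -Eq.
  apply: (mulfI (expf_neq0 2 dnz)); rewrite mulr0 -qvZ -E qvZ qz mulr0.
  by [].
case/orP: nz => nz; first by apply: fin xp; rewrite fmorph_eq0.
by apply: fin yp; rewrite fmorph_eq0.
Qed.

Lemma choose_seq (T U : eqType) (R : T -> U -> Prop) (s : seq T) : uniq s ->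
  (forall t, t \in s -> exists u, R t u) ->
  (forall t t' u, t \in s -> t' \in s -> R t u -> R t' u -> t = t') ->
  exists r : seq U, [/\ uniq r, size r = size s &
    forall u, u \in r -> exists2 t, t \in s & R t u].
Proof.
elim: s => [|t s IH] /=; first by exists [::].
move=> /andP [ts us] ex inj.
have [||r [ur sr hr]] := IH us.
- by move=> t' t's; apply: ex; rewrite inE t's orbT.
- by move=> t1 t2 u h1 h2; apply: inj; rewrite inE ?h1 ?h2 orbT.
have [u tu] := ex t (mem_head _ _); exists (u :: r); split=> /=.
- rewrite ur andbT; apply: contra ts => /hr [t' t's t'u].
  by rewrite (inj t t' u) ?mem_head ?inE ?t's ?orbT.
- by rewrite sr.
move=> u'; rewrite inE => /predU1P [->|/hr [t' t's t'u']].
  by exists t; rewrite ?mem_head.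
by exists t'; rewrite ?inE ?t's ?orbT.
Qed.

(** Each [l] forbids at most one value [t0], and is absorbed by multiplying [p] by ['X - t0]. *)
Lemma avoid (K : fieldType) (T : eqType) (R : T -> K -> Prop) (s : seq T) (p : {poly K}) :
  (forall p : {poly K}, p != 0 -> exists t, p.[t] != 0) ->
  p != 0 -> (forall l, l \in s -> forall t t', R l t -> R l t' -> t = t') ->
  exists t, p.[t] != 0 /\ forall l, l \in s -> ~ R l t.
Proof.
move=> inf; elim: s p => [|l s IH] p pnz h.
  by have [t pt] := inf p pnz; exists t.
have [q [qnz hq]] : exists q : {poly K}, q != 0 /\ forall t, q.[t] != 0 -> ~ R l t.
  have [[t0 R0]|none] := classic (exists t, R l t).
    exists ('X - t0%:P); rewrite polyXsubC_eq0; split=> // t; rewrite !hornerE subr_eq0.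
    by move=> /eqP ne Rt; apply: ne; apply: (h l) => //; apply: mem_head.
  by exists 1; rewrite oner_eq0; split=> // t _ Rt; apply: none; exists t.
have [||t [pqt ht]] := IH (p * q); first by rewrite mulf_neq0.
  by move=> l' l's; apply: h; rewrite inE l's orbT.
move: pqt; rewrite hornerM mulf_eq0 negb_or => /andP [pt qt].
exists t; split=> // l'; rewrite inE => /predU1P [->|]; [exact: hq|exact: ht].
Qed.

Lemma fraction_infinite (K : fieldType) (p : {poly {fraction {poly K}}}) :
  p != 0 -> exists t, p.[t] != 0.
Proof.
move=> pnz; apply: NNPP => none.
pose ts := [seq tofrac ('X^i : {poly K}) | i <- iota 0 (size p)].
have : (size ts < size p)%N; last by rewrite size_map size_iota ltnn.
apply: max_poly_roots => //.
  apply/allP => t _; apply: contraT => rt; case: none; exists t.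
  exact: rt.
rewrite map_inj_uniq ?iota_uniq // => i j /eqP; rewrite tofrac_eq => /eqP.
by move=> /(congr1 (fun q : {poly K} => size q)); rewrite !size_polyXn => -[].
Qed.

Lemma hv_vbasis (k : fieldType) (w : forms k) (l : {vspace 'rV[k]_4}) :
  all (fun z => hv w id z == 0) (vbasis l) -> forall z, z \in l -> hv w id z = 0.
Proof.
move=> hl z; rewrite -(span_basis (vbasisP l)).
elim: (tval _) z hl => [|v s IH] z /=.
  by rewrite span_nil memv0 => _ /eqP ->; rewrite -(scale0r 0) hvZ mul0r.
move=> /andP [/eqP hv0 hs]; rewrite span_cons => /memv_addP [u /vlineP [a ->]].
by case=> v' /(IH _ hs) hv' ->; rewrite hvD hvZ hv0 hv' mulr0 addr0.
Qed.

Section LinesOnSurface.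

Variables (k : fieldType) (w : forms k).
Local Notation gf := (Fv w (@mpolyC 4 k) (genpt k)).
Local Notation gh := (hv w (@mpolyC 4 k) (genpt k)).
Local Notation gq := (qv w (@mpolyC 4 k) (genpt k)).

Variable L : seq {vspace 'rV[k]_4}.
Hypothesis uL : uniq L.
Hypothesis hL : forall l, l \in L ->
  [/\ line l, line_in_surface l gf & line_meets_conic l gh gq].

Variables (K : fieldType) (phi : {rmorphism k -> K}).
Hypothesis inf : forall p : {poly K}, p != 0 -> exists t, p.[t] != 0.

(* Relative to a coordinate system as in [conic_lines_count]. *)
Lemma lines_count (W : forms K) (e0 e1 e2 e3 : 'rV[K]_4) :
  frame e0 e1 e2 e3 -> smooth_forms W ->
  (forall x, Fv W id x = Fv w phi x) -> (forall x, hv W id x = hv w phi x) ->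
  (forall x, qv w phi x = 0 -> qv W id x = 0) ->
  [/\ hv W id e0 = 0, hv W id e1 = 0, hv W id e2 = 0 & hv W id e3 = 1] ->
  [/\ qv W id e0 = 0, qv W id e1 = -1 & qv W id e2 = 0] ->
  [/\ qp W id e0 e1 = 0, qp W id e0 e2 = 1 & qp W id e1 e2 = 0] ->
  rv W id e2 != 0 ->
  (forall l, l \in L -> e2 \in base_change phi l ->
     forall z, z \in base_change phi l -> hv W id z = 0) ->
  (size L <= 48)%N.
Proof.
move=> fr sm FW hW qW [h0 h1 h2 h3] [q0 q1 q2] [q01 q02 q12] r2 e2L.
pose inplane l := all (fun z => hv w id z == 0) (vbasis l).
have surf l : l \in L -> forall z, z \in base_change phi l -> Fv W id z = 0.
  move=> /hL [_ h _] z zl; rewrite FW -Fv_meval.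
  exact: h.
pose R1 l (x : K * K) := [/\ (ga W e0 e1 e2).[x.1] != 0,
    (map_poly (horner_eval x.1) (gf2 W e0 e1 e2 e3)).[x.2] = 0,
    (map_poly (horner_eval x.1) (gf3 W e0 e1 e2 e3)).[x.2] = 0 &
    (map_poly (horner_eval x.1) (gf4 W e0 e1 e2 e3)).[x.2] = 0] /\
  [/\ e0 + x.1 *: e1 + x.1 ^+ 2 *: e2 \in base_change phi l &
    dir W e0 e1 e2 e3 x.1 x.2 \in base_change phi l].
pose R2 (l : {vspace 'rV[k]_4}) (x : K * K) :=
  [/\ rv W id (e0 + x.1 *: e2) = 0,
      rp W id (e0 + x.1 *: e2) (e1 + x.2 *: e2) = 0 &
      rv W id (e1 + x.2 *: e2) = 0] /\
  [/\ e0 + x.1 *: e2 \in base_change phi l & e1 + x.2 *: e2 \in base_change phi l].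
(* Transversal lines are encoded by pairs [(t, l)], lines in the plane by pairs [(a, b)]; each pair
   yields two independent vectors of its line, so the encoding is injective. *)
pose L1 := [seq l <- L | ~~ inplane l]; pose L2 := [seq l <- L | inplane l].
have [||s [us ss hs]] := @choose_seq _ _ R1 L1 (filter_uniq _ uL).
- move=> l; rewrite mem_filter => /andP [nl lL].
  have [ll ls [K1 [f [z [znz zl hz qz]]]]] := hL lL.
  have [x [y [fxy lE bE]]] := line_basis ll.
  rewrite bE map_two_rows in zl; rewrite hv_meval in hz; rewrite qv_meval in qz.
  have nxy : (hv w id x != 0) || (hv w id y != 0).
    apply: contraNT nl; rewrite negb_or !negbK => /andP [/eqP hx /eqP hy].
    apply/allP => b /vbasis_mem; rewrite lE => /two_rowsP [c [d ->]].
    by rewrite hvD !hvZ hx hy !mulr0 addr0.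
  have [pnz pB hp qp] := meet_point fxy nxy znz zl hz qz.
  set p := _ *: x + _ in pnz pB hp qp.
  pose B := map_mx phi (two_rows x y).
  have inB v : onB (two_rows x y) v -> onB B (map_mx phi v) by rewrite /B map_submx.
  have EhW v : hv W id (map_mx phi v) = phi (hv w id v) by rewrite hW hv_map.
  have [v vB hv0] : exists2 v, onB B v & hv W id v != 0.
    case/orP: nxy => nz; [exists (map_mx phi x)|exists (map_mx phi y)];
      rewrite ?EhW ?fmorph_eq0 //; apply: inB; apply/two_rowsP.
      by exists 1, 0; rewrite scale1r scale0r addr0.
    by exists 0, 1; rewrite scale1r scale0r add0r.
  have e2B : ~~ onB B e2.
    apply: contra hv0; rewrite -bE => e2B; apply/eqP.
    by apply: (e2L l) => //; rewrite bE.
  have sB z' : onB B z' -> Fv W id z' = 0 by rewrite -bE; apply: surf.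
  have pnz' : map_mx phi p != 0 by rewrite map_mx_eq0.
  have hp' : hv W id (map_mx phi p) = 0 by rewrite EhW hp rmorph0.
  have qp' : qv W id (map_mx phi p) = 0.
    by apply: qW; rewrite -[LHS](qv_map w id phi) qp rmorph0.
  have [t [u [hx [hQ hd]]]] := transversal_point inf fr sm h0 h1 h2 h3 q0 q1 q2
    q01 q02 q12 sB pnz' (inB _ pB) hp' qp' vB hv0 e2B.
  by exists (t, u); split=> //; rewrite !bE.
- move=> l l' [t u]; rewrite !mem_filter => /andP [_ lL] /andP [_ l'L].
  case=> /= [[gnz _ _ _] [ul vl]] [_ [ul' vl']].
  have [ll _ _] := hL lL; have [ll' _ _] := hL l'L.
  apply: line_eq ll ll' _ ul vl ul' vl' => a b E.
  have b0 : b = 0.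
    have := congr1 (hv W id) E; rewrite hvD !hvZ (hv_dir h0 h1 h2 h3).
    rewrite !hvD !hvZ h0 h1 h2 !mulr0 !addr0 mulr0 add0r.
    have -> : hv W id 0 = 0 by rewrite -(scale0r (0 : 'rV[K]_4)) hvZ mul0r.
    by move/eqP; rewrite mulf_eq0 (negbTE gnz) orbF => /eqP.
  split=> //; move: E; rewrite b0 scale0r addr0 !scalerDr => E.
  have [|-> //] := plane_free fr (y0 := a) (y1 := a * t) (y2 := a * t ^+ 2).
  by rewrite -[RHS]E !scalerA.
have [||m [um sm' hm]] := @choose_seq _ _ R2 L2 (filter_uniq _ uL).
- move=> l; rewrite mem_filter => /andP [il lL].
  have [ll _ _] := hL lL; have [x [y [fxy lE bE]]] := line_basis ll.
  pose B := map_mx phi (two_rows x y).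
  have sB z : onB B z -> Fv W id z = 0 by rewrite -bE; apply: surf.
  have EhW v : hv W id (map_mx phi v) = phi (hv w id v) by rewrite hW hv_map.
  have BE : B = two_rows (map_mx phi x) (map_mx phi y) by rewrite /B map_two_rows.
  have hl := hv_vbasis il.
  have hB z : onB B z -> hv W id z = 0.
    rewrite BE => /two_rowsP [a [b ->]]; rewrite hvD !hvZ !EhW.
    rewrite !hl ?rmorph0 ?mulr0 ?addr0 // lE; apply/two_rowsP.
      by exists 0, 1; rewrite scale1r scale0r add0r.
    by exists 1, 0; rewrite scale1r scale0r addr0.
  have fxy' : free2 (map_mx phi x) (map_mx phi y).
    apply/two_rows_free; rewrite -map_two_rows /row_free mxrank_map.
    by move/two_rows_free: fxy.
  have xB : onB B (map_mx phi x).
    by rewrite BE; apply/two_rowsP; exists 1, 0; rewrite scale1r scale0r addr0.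
  have yB : onB B (map_mx phi y).
    by rewrite BE; apply/two_rowsP; exists 0, 1; rewrite scale1r scale0r add0r.
  have [a [b [hr [ha hb]]]] := residual_point inf fr h0 h1 h2 h3 q0 q1 q2 q01 q02 q12
    r2 sB hB xB yB fxy'.
  by exists (a, b); split=> //; rewrite !bE.
- move=> l l' [a b]; rewrite !mem_filter => /andP [_ lL] /andP [_ l'L].
  case=> /= [_ [ul vl]] [_ [ul' vl']].
  have [ll _ _] := hL lL; have [ll' _ _] := hL l'L.
  apply: line_eq ll ll' _ ul vl ul' vl' => c d E.
  have [|-> ->] := plane_free fr (y0 := c) (y1 := d) (y2 := c * a + d * b).
    by rewrite -[RHS]E; apply/matrixP => i j; rewrite !mxE; ring.
  by [].
have -> : size L = (size s + size m)%N.
  by rewrite ss sm' !size_filter addnC count_predC.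
apply: (conic_lines_count fr sm h0 h1 h2 h3 q0 q1 q2 q01 q02 q12 r2 inf us um).
  by move=> x /hs [l _ []].
by move=> x /hm [l _ []].
Qed.

End LinesOnSurface.

Lemma line_in_plane (k K : fieldType) (f : {rmorphism k -> K}) (w : forms K)
  (l : {vspace 'rV[k]_4}) (u v z : 'rV[K]_4) : line l -> free2 u v ->
  u \in base_change f l -> v \in base_change f l -> hv w id u = 0 -> hv w id v = 0 ->
  z \in base_change f l -> hv w id z = 0.
Proof.
move=> /line_basis [x [y [fr lE bE]]] uv; rewrite !bE => ul vl hu hv0 zl.
have rk : \rank (map_mx f (two_rows x y)) = 2%N.
  by move/two_rows_free: fr; rewrite mxrank_map => /eqP.
have /andP [s _] := two_rows_span rk ul vl uv.
have /two_rowsP [a [b ->]] := submx_trans zl s.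
by rewrite hvD !hvZ hu hv0 !mulr0 addr0.
Qed.

Lemma normal_frame_conic (K : fieldType) (w : forms K) (e0 e1 e2 e3 : 'rV[K]_4)
  (c t : K) : normal_frame w e0 e1 e2 e3 c ->
  let Q := e0 + t *: e1 + t ^+ 2 *: e2 in
  [/\ Q != 0, hv w id Q = 0 & qv w id Q = 0].
Proof.
move=> [fr [h0 h1 h2 h3] [q0 q1 q2] [q01 q02 q12] cnz] Q; split.
- apply/eqP; rewrite /Q -[e0]scale1r => /(plane_free fr) [/eqP].
  by rewrite oner_eq0.
- by rewrite !hvD !hvZ h0 h1 h2 !mulr0 !addr0.
rewrite !qvD !qvZ q0 q1 q2 !qpDl !qpZl !qpZr q01 q02 q12; ring.
Qed.

(* A line outside the plane of the conic contains at most one of its points. *)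
Lemma point_off_lines (k K : fieldType) (f : {rmorphism k -> K}) (w : forms K)
  (L : seq {vspace 'rV[k]_4}) (e0 e1 e2 e3 : 'rV[K]_4) (c : K) :
  (forall p : {poly K}, p != 0 -> exists t, p.[t] != 0) ->
  smooth_forms w -> normal_frame w e0 e1 e2 e3 c ->
  (forall l, l \in L -> line l) ->
  exists P : 'rV[K]_4,
  [/\ P != 0, hv w id P = 0, qv w id P = 0, rv w id P != 0 &
    forall l, l \in L -> P \in base_change f l ->
    forall z, z \in base_change f l -> hv w id z = 0].
Proof.
move=> inf sm nf hL.
have pnz := residual_conic_neq sm nf.
pose Q t := e0 + t *: e1 + t ^+ 2 *: e2.
pose R (l : {vspace 'rV[k]_4}) t := Q t \in base_change f l /\
  ~ forall z, z \in base_change f l -> hv w id z = 0.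
have [|t [pt ht]] := @avoid K _ R L _ inf pnz.
  move=> l lL t t' [Ql nl] [Ql' _]; apply: NNPP => ne; case: nl => z.
  have [_ hQ _] := normal_frame_conic t nf; have [_ hQ' _] := normal_frame_conic t' nf.
  apply: (line_in_plane (hL l lL) _ Ql Ql' hQ hQ') => a b E.
  have [fr _ _ _ _] := nf.
  have [|ab E1 _] := plane_free fr (y0 := a + b) (y1 := a * t + b * t')
      (y2 := a * t ^+ 2 + b * t' ^+ 2).
    by rewrite -[RHS]E; apply/matrixP => i j; rewrite !mxE; ring.
  have /eqP : b * (t' - t) = 0.
    by rewrite -[RHS]E1 -[a](addrK b) ab; ring.
  rewrite mulf_eq0 subr_eq0 => /orP [/eqP b0|/eqP tt]; last by case: ne.
  by split=> //; rewrite -ab b0 addr0.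
exists (Q t); have [Qnz hQ qQ] := normal_frame_conic t nf; split=> //.
  apply: contraNneq pt => r0; apply/eqP.
  rewrite -[LHS]/(horner_eval t _) rv_map.
  have evC : horner_eval t \o polyC = id.
    by apply: functional_extensionality => z; rewrite /= /horner_eval hornerC.
  rewrite evC -[RHS]r0; congr rv.
  rewrite /pt !map_mxD !map_mxZ -!map_mx_comp evC.
  have idm (x : 'rV[K]_4) : map_mx id x = x by apply/matrixP => ? ?; rewrite mxE.
  have eX : horner_eval t 'X = t := hornerX t.
  have eXn : horner_eval t ('X ^+ 2) = t ^+ 2 := hornerXn t 2.
  by rewrite -[X in _ = _ + X *: _ + _]eX -[X in _ = _ + X *: _]eXn !idm.
by move=> l lL Ql; apply: NNPP => nl; apply: (ht l lL).
Qed.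

(** The normal form is used twice: at [P0] it parametrizes the conic, which allows the choice of a
    general point [P]; at [P] it makes this general point the one missed by the parametrization. *)
Lemma lines_count_at_point (k : fieldType) (w : forms k) (L : seq {vspace 'rV[k]_4})
  (K : fieldType) (phi : {rmorphism k -> K}) (P0 : 'rV[K]_4) : uniq L ->
  (forall l, l \in L -> [/\ line l,
     line_in_surface l (Fv w (@mpolyC 4 k) (genpt k)) &
     line_meets_conic l (hv w (@mpolyC 4 k) (genpt k))
       (qv w (@mpolyC 4 k) (genpt k))]) ->
  smooth_forms w -> irreducible_forms w -> (exists x, hv w id x != 0) ->
  (forall p : {poly K}, p != 0 -> exists t, p.[t] != 0) ->
  P0 != 0 -> hv w phi P0 = 0 -> qv w phi P0 = 0 -> (size L <= 48)%N.
Proof.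
move=> uL hL sw iw hw inf P0nz hP0 qP0.
have sw1 := smooth_map (f := phi) sw; have iw1 := irreducible_map (f := phi) iw.
set W1 := map_forms phi w in sw1 iw1.
have hw1 : exists x : 'rV[K]_4, hv W1 id x != 0.
  have [x xnz] := hw; exists (map_mx phi x).
  by rewrite -[hv W1 id _]/(hv w phi _) -[X in X != _](hv_map w id phi) fmorph_eq0.
have [e0 [e1 [e3 [c nf]]]] := normal_frame_through hw1 iw1 P0nz hP0 qP0.
have lL l : l \in L -> line l by case/hL.
have [P [Pnz hP qP rP offP]] := point_off_lines phi inf sw1 nf lL.
have [f0 [f1 [f3 [d nf']]]] := normal_frame_through hw1 iw1 Pnz hP qP.
have [q012 qp012] := normal_frame_scale nf'.
have [fr h012 _ _ dnz] := nf'.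
pose I : {rmorphism K -> K} := idfun.
apply: (lines_count uL hL inf fr (smooth_scale dnz sw1) _ _ _ h012 q012 qp012 _ offP).
- by move=> x; apply: (Fv_scale W1 I dnz).
- by [].
- by move=> x qx; rewrite (qv_scale d W1 I) [X in _ * X]qx mulr0.
- by rewrite (rv_scale d W1 I) mulf_neq0.
Qed.

Local Close Scope ring_scope.

Theorem theorem1p1 (k : fieldType) (f h q : {mpoly k[4]}) :
  smooth_quartic f ->
  conic h q ->
  geometrically_irreducible [:: h; q] ->
  conic_in_surface h q f ->
  forall L : seq {vspace 'rV[k]_4},
    uniq L ->
    (forall l, l \in L ->
       [/\ line l, line_in_surface l f & line_meets_conic l h q]) ->
    size L <= 48.
Proof.
move=> sf [hh hnz qh hq] gi cs L uL hL.
have [w [hE qE fE]] := conic_equation sf.1 hh qh cs; subst h q f.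
have sw := smooth_quartic_forms sf.
have hw : exists x : 'rV[k]_4, (hv w id x != 0)%R.
  apply: NNPP => none; case/eqP: hnz; rewrite /hv /lin big1 // => j _.
  have [->|tj] := eqVneq (th w j) 0%R; first by rewrite mpolyC0 mul0r.
  case: none; exists (delta_mx 0 j)%R; rewrite /hv /lin (bigD1 j) //= big1.
    by rewrite mxE !eqxx mulr1 addr0.
  by move=> i ij; rewrite mxE (negbTE ij) andbF mulr0.
have iw := irreducible_formsP hw hq gi.
have [->//|[l0 l0L]] : L = [::] \/ exists l, l \in L.
  by case: {uL hL} L => [|l L]; [left|right; exists l; apply: mem_head].
(* The conic may have no point over [k]; a first line of [L] supplies one over [K0], and passing to
   rational functions makes the field infinite. *)
have [_ _ [K0 [phi0 [x0 [x0nz _ hx0 qx0]]]]] := hL l0 l0L.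
rewrite hv_meval in hx0; rewrite qv_meval in qx0.
pose K : fieldType := {fraction {poly K0}}.
pose psi : {rmorphism K0 -> K} := (@tofrac {poly K0}) \o polyC.
pose phi : {rmorphism k -> K} := psi \o phi0.
have inf : forall p : {poly K}, (p != 0)%R -> exists t, (p.[t] != 0)%R.
  exact: fraction_infinite.
have P0nz : (map_mx psi x0 != 0)%R by rewrite map_mx_eq0.
apply: (lines_count_at_point (phi := phi) uL hL sw iw hw inf P0nz).
  by rewrite -[LHS](hv_map w phi0 psi) hx0 rmorph0.
by rewrite -[LHS](qv_map w phi0 psi) qx0 rmorph0.
Qed.
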